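(* Let $s\ge 2$ be an integer. The complex manifolds $\Omega^1_{coef}(-1^s)$, $\Omega^1_{zp}(-1^s)$ and $\Omega^1_{rp}(-1^s)$ (defined in the context) are biholomorphic to one another.
   Context: Notation: $\widehat{\mathbb C}=\mathbb C\cup\{\infty\}$ is the Riemann sphere, $\mathbb C^*=\mathbb C\setminus\{0\}$, $\mathcal S(n)$ is the symmetric group on $n$ elements, acting on $\widehat{\mathbb C}^n$ by permuting coordinates. $\widehat{\mathbb C}^s\setminus\Delta=\{(p_1,\dots,p_s)\in\widehat{\mathbb C}^s : p_\iota\neq p_\kappa \text{ for all } \iota\neq\kappa\}$. These three manifolds parametrize rational 1-forms on $\widehat{\mathbb C}$ with exactly $s$ poles, all simple. (1) Coefficients. $\Omega^1_{coef}(-1^s)$ is the Zariski open subset of $\mathbb{CP}^{2s-1}$ of points $[a_{s-2}:\dots:a_0:b_s:\dots:b_0]$ such that, with $Q(z)=a_{s-2}z^{s-2}+\dots+a_0$ and $P(z)=b_sz^s+\dots+b_0$, the resultant $\mathcal D(P,Q)$ of $P$ and $Q$ is nonzero and the discriminant $\mathcal D(P,P')$ of $P$ is nonzero. Here $P$ and $Q$ are regarded as polynomials of formal degrees $s$ and $s-2$ (so $b_s=0$ is allowed, corresponding to a pole at $\infty$). (2) Zeros–poles. Let $$M_s=\left\{\{c_1,\dots,c_{s-2},p_1,\dots,p_s\}\in \frac{\widehat{\mathbb C}^{s-2}}{\mathcal S(s-2)}\times\frac{\widehat{\mathbb C}^s\setminus\Delta}{\mathcal S(s)} : c_j\neq p_\iota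 \text{ for all } j,\iota\right\},$$ an open dense complex submanifold of $\mathbb{CP}^{s-2}\times\mathbb{CP}^s$ via the biholomorphisms $\widehat{\mathbb C}^n/\mathcal S(n)\cong\mathbb{CP}^n$. For $u=\{c_1,\dots,c_{s-2},p_1,\dots,p_s\}\in M_s$ let $Q_u(z)$ be the product of the factors $(z-c_j)$ over those $j$ with $c_j\neq\infty$, and $P_u(z)$ the product of the factors $(z-p_\iota)$ over those $\iota$ with $p_\iota\ne\infty$. For $\alpha\in I=\{1,2,\dots,2s-1\}$ let $\mathcal U_\alpha=\{u\in M_s : Q_u(\alpha)\ne0,\ P_u(\alpha)\neq0\}$. $\Omega^1_{zp}(-1^s)$ is the total space of the principal $\mathbb C^*$-bundle over $M_s$ with transition functions $$\phi_{\alpha\beta}:\mathcal U_\alpha\cap\mathcal U_\beta\to\mathbb C^*,\qquad \phi_{\alpha\beta}(u)=\frac{Q_u(\alpha)}{P_u(\alpha)}\cdot\frac{P_u(\beta)}{Q_u(\beta)},$$ i.e. $(u,\lambda)\in\mathcal U_\beta\times\mathbb C^*$ is glued to $(u,\phi_{\alpha\beta}(u)\lambda)\in\mathcal U_\alpha\times\mathbb C^*$. (3) Residues–poles. Let $H_s=\{(r_1,\dots,r_s)\in(\mathbb C^* )^s : r_1+\dots+r_s=0\}$. Then $$\Omega^1_{rp}(-1^s)=\frac{H_s\times(\widehat{\mathbb C}^s\setminus\Delta)}{\mathcal S(s)},$$ where $\mathcal S(s)$ acts diagonally by $\sigma\cdot(r_1,\dots,r_s,p_1,\dots,p_s)=(r_{\sigma(1)},\dots,r_{\sigma(s)},p_{\sigma(1)},\dots,p_{\sigma(s)})$;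 this action is free and properly discontinuous, so the quotient is a $(2s-1)$-dimensional complex manifold. *)

(* Defs.v *)
From HB Require Import structures.
From mathcomp Require Import all_boot all_order all_algebra all_fingroup.
From mathcomp Require Import generic_quotient complex ring zify.
From mathcomp Require Import boolp classical_sets functions cardinality reals.
From mathcomp Require Import topology prodnormedzmodule normedtype derive.

Set Implicit Arguments.
Unset Strict Implicit.
Unset Printing Implicit Defensive.

Import Order.TTheory GRing.Theory Num.Theory.
Import numFieldNormedType.Exports.

Local Open Scope classical_set_scope.
Local Open Scope ring_scope.
Local Open Scope quotient_scope.

Record chart (X E : Type) := Chart { cdom : set X; cfun :> X -> E }.

(* The model is C^n up to linear isomorphism: below it is always a finite
   product of spaces of row vectors. *)
Record charted (K : numFieldType) := Charted {
  points : choiceType;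
  model : normedModType K;
  atlas : set (chart points model) }.

Arguments atlas {K} c.

Definition carrier (K : numFieldType) (X : charted K) : Type := points X.
Coercion carrier : charted >-> Sortclass.
HB.instance Definition _ (K : numFieldType) (X : charted K) :=
  Choice.copy (carrier X) (points X).

Section Manifolds.
Context {K : numFieldType}.
Implicit Types X Y : charted K.

Section AtlasTopology.
Variable X : charted K.

(* The topology carried by an atlas: U is open iff its trace on every chart is
   open in the model, i.e. the charts are homeomorphisms onto their images. *)
Definition atlas_op (U : set X) := forall c x, atlas X c -> cdom c x -> U x ->
  \forall v \near c x, forall y, cdom c y -> c y = v -> U y.

Let atlas_opT : atlas_op setT.
Proof. by move=> c x _ _ _; near=> v. Unshelve. all: by end_near. Qed.

Let atlas_opI : setI_closed atlas_op.
Proof.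
move=> U V oU oV c x cA cx [Ux Vx].
near=> v => y cy yv; split; move: y cy yv; near: v; [exact: oU|exact: oV].
Unshelve. all: by end_near. Qed.

Let atlas_op_bigU (I : Type) (f : I -> set X) :
  (forall i, atlas_op (f i)) -> atlas_op (\bigcup_i f i).
Proof.
move=> of_ c x cA cx [i _ fix_]; near=> v => y cy yv; exists i => //.
by move: y cy yv; near: v; exact: of_.
Unshelve. all: by end_near. Qed.

HB.instance Definition _ := isOpenTopological.Build (carrier X)
  atlas_opT atlas_opI atlas_op_bigU.

End AtlasTopology.

(* In every pair of charts c, d, the map d \o f \o c^-1 is defined near c x and
   coincides there with a function g that is complex-differentiable at c x. *)
Definition holomorphic X Y (f : X -> Y) :=
  forall c d x, atlas X c -> atlas Y d -> cdom c x -> cdom d (f x) ->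
    exists2 g : model X -> model Y, differentiable g (c x) &
      \forall v \near c x, forall y, cdom c y -> c y = v ->
        cdom d (f y) /\ d (f y) = g v.

(* The last clause says that the transition maps are holomorphic. *)
Definition complex_manifold X :=
  [/\ @hausdorff_space X /\ @second_countable X,
      forall x : X, exists2 c, atlas X c & cdom c x,
      forall c : chart X (model X), atlas X c -> set_inj (cdom c) c,
      forall c : chart X (model X), atlas X c -> open (c @` cdom c) &
      holomorphic (@id X)].

Definition biholomorphic X Y := exists f : X -> Y, exists g : Y -> X,
  [/\ cancel f g, cancel g f, holomorphic f & holomorphic g].

(* Structure induced by an injection with open image. *)
Definition pullback_charted (T : choiceType) X (phi : T -> X) : charted K :=
  @Charted K T (model X)
    [set Chart (phi @^-1` cdom c) (c \o phi) | c in atlas X].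

Definition sub_charted X (A : set X) : charted K :=
  @pullback_charted (set_type A) X set_val.

Definition prod_charted X Y : charted K :=
  @Charted K (X * Y)%type (model X * model Y)%type
    [set Chart (cdom c `*` cdom d) (fun x => (c x.1, d x.2))
      | c in atlas X & d in atlas Y].

(* Quotient by the orbits of a free, properly discontinuous action: the charts
   are c \o t with t a section of the projection over V, with open image. *)
Definition quot_charted X (e : equiv_rel X) : charted K :=
  @Charted K {eq_quot e} (model X)
    [set k | exists c V (t : {eq_quot e} -> X),
      [/\ atlas X c, forall q, V q -> \pi_({eq_quot e}) (t q) = q,
          @open X (t @` V), t @` V `<=` cdom c & k = Chart V (c \o t)]].

End Manifolds.

Section Proj.
Context {K : numFieldType}.
Variable m : nat.

Definition hvec := {v : 'rV[K]_m | v != 0}.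
HB.instance Definition _ := Choice.on hvec.

Definition hvec_rel (v w : hvec) : bool :=
  `[< exists2 k : K, k != 0 & val w = k *: val v >].

Lemma hvec_rel_refl : reflexive hvec_rel.
Proof. by move=> v; apply/asboolP; exists 1; rewrite ?oner_neq0 ?scale1r. Qed.

Lemma hvec_rel_sym : symmetric hvec_rel.
Proof.
suff H v w : hvec_rel v w -> hvec_rel w v by move=> v w; apply/idP/idP; exact: H.
move=> /asboolP[k k0 vw]; apply/asboolP; exists k^-1; first by rewrite invr_eq0.
by rewrite vw scalerA mulVf// scale1r.
Qed.

Lemma hvec_rel_trans : transitive hvec_rel.
Proof.
move=> v u w /asboolP[k k0 uv] /asboolP[l l0 vw]; apply/asboolP.
by exists (l * k); rewrite ?mulf_neq0// vw uv scalerA.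
Qed.

Canonical hvec_equiv :=
  EquivRel hvec_rel hvec_rel_refl hvec_rel_sym hvec_rel_trans.

Definition hcoord (x : {eq_quot hvec_equiv}) : 'rV[K]_m := val (repr x).

(* CP^(m-1) with its affine charts v |-> (v_j / v_i)_(j != i). *)
Definition Proj_chart (i : 'I_m) : chart {eq_quot hvec_equiv} 'rV[K]_m.-1 :=
  Chart [set x | hcoord x 0 i != 0]
    (fun x => col' i ((hcoord x 0 i)^-1 *: hcoord x)).

Definition Proj : charted K :=
  @Charted K {eq_quot hvec_equiv} 'rV[K]_m.-1 (range Proj_chart).

Definition Proj_pt (v : 'rV[K]_m) (v0 : v != 0) : Proj :=
  \pi_({eq_quot hvec_equiv}) (Sub v v0 : hvec).

End Proj.
Arguments Proj : clear implicits.

Section FormalResultant.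
Context {K : comNzRingType}.
Implicit Types (p q : {poly K}) (m n d : nat).

(* Resultant of p and q regarded as polynomials of formal degrees m and n. *)
Definition formal_resultant m n p q : K :=
  \det (col_mx (\matrix_(i < n, j < n + m) (p * 'X^i)`_j)
               (\matrix_(i < m, j < n + m) (q * 'X^i)`_j)).

(* Discriminant D(p, p') of p regarded as a polynomial of formal degree d. The
   Sylvester determinant of (p, p') for the degrees (d, d-1) has the factor p_d,
   since the column of the highest power has entries 0, p_d and d * p_d; the
   discriminant is the cofactor of p_d, a polynomial in the coefficients of p
   that does not vanish identically on p_d = 0. See formal_discrE. *)
Definition formal_discr d p : K :=
  \det (col_mx
    (\matrix_(i < d.-1, j < d.-1 + d)
      if j == (d.-1 + d).-1 :> nat then (i == d.-2 :> nat)%:R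
      else (p * 'X^i)`_j)
    (\matrix_(i < d, j < d.-1 + d)
      if j == (d.-1 + d).-1 :> nat then (i == d.-1 :> nat)%:R *+ d
      else (p^`() * 'X^i)`_j)).

Lemma formal_discrE d p : (0 < d)%N -> (size p <= d.+1)%N ->
  formal_resultant d d.-1 p p^`() = p`_d * formal_discr d p.
Proof.
case: d => // d _ sp; rewrite /formal_discr /formal_resultant /=.
set B := (X in _ = _ * \det X).
pose D : 'rV[K]_(d + d.+1) :=
  \row_j (if j == (d + d.+1).-1 :> nat then p`_d.+1 else 1).
have -> : p`_d.+1 = \det (diag_mx D).
  rewrite det_diag (bigD1 (cast_ord (esym (addnS d d)) ord_max))//= mxE/=.
  rewrite ifT ?big1 ?mulr1//; last by apply/eqP; lia.
  move=> j jd; rewrite mxE; case: ifP => // /eqP e.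
  by case/eqP: jd; apply/val_inj; rewrite /= e addnS.
rewrite mulrC -det_mulmx; congr (\det _).
have p0 k : (d.+1 < k)%N -> p`_k = 0.
  by move=> dk; apply/leq_sizeP: dk.
rewrite mul_mx_diag; apply/matrixP => i j; rewrite /B !mxE.
case: (fintype.split i) => k; rewrite !mxE; case: eqP => [e|_]; rewrite ?mulr1//;
  rewrite e addnS/= coefMXn ?coef_deriv.
  have kd := ltn_ord k; rewrite ltnNge (leq_trans (ltnW kd) (leq_addr _ _))/=.
  case: eqP => [ek|ne]; first by rewrite mul1r; congr _`_ _; lia.
  by rewrite mul0r p0//; lia.
have kd : (k <= d)%N by rewrite -ltnS.
rewrite ltnNge (leq_trans kd (leq_addr _ _))/=.
case: eqP => [ek|ne]; last by rewrite mul0rn mul0r p0 ?mul0rn//; lia.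
have -> : (d + d - k = d)%N by lia.
by rewrite mulr_natl.
Qed.

End FormalResultant.

Section Sphere.
Context {K : numFieldType}.

Definition sphere := option K.
HB.instance Definition _ := Choice.on sphere.

(* None is the point at infinity. *)
Definition chart0 : chart sphere K := Chart [set~ None] (odflt 0).
Definition chart_oo : chart sphere K :=
  Chart [set~ Some 0] (fun x => if x is Some z then z^-1 else 0).

Definition spheres_chart n (c : 'I_n -> chart sphere K) :
    chart {ffun 'I_n -> sphere} 'rV[K]_n :=
  @Chart {ffun 'I_n -> sphere} 'rV[K]_n
    [set p | forall i, cdom (c i) (p i)] (fun p => \row_i c i (p i)).

Definition spheres (n : nat) : charted K :=
  @Charted K {ffun 'I_n -> sphere} 'rV[K]_n
    [set spheres_chart c
      | c in [set c | forall i, c i = chart0 \/ c i = chart_oo]].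

Definition spheres_minus_diag n : charted K :=
  sub_charted [set p : spheres n | injective (p : {ffun _ -> _})].

(* (z - c_1) ... (z - c_n), without the factors with c_j = oo *)
Definition root_poly n (c : {ffun 'I_n -> sphere}) : {poly K} :=
  \prod_j (if c j is Some z then 'X - z%:P else 1).

Lemma root_poly_monic n (c : {ffun 'I_n -> sphere}) : root_poly c \is monic.
Proof.
by apply: monic_prod => i _; case: (c i) => [z|]; rewrite ?monicXsubC ?monic1.
Qed.

Lemma size_root_poly n (c : {ffun 'I_n -> sphere}) :
  (size (root_poly c) <= n.+1)%N.
Proof.
elim: n c => [|n IH] c; rewrite /root_poly; first by rewrite big_ord0 size_poly1.
rewrite big_ord_recr/=; set p := \prod_(_ < _) _.
have := IH [ffun i => c (widen_ord (leqnSn n) i)].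
rewrite /root_poly (eq_bigr (fun i =>
  if c (widen_ord (leqnSn n) i) is Some z then 'X - z%:P else 1)); last first.
  by move=> i _; rewrite ffunE.
rewrite -/p => sp; case: (c ord_max) => [z|]; last by rewrite mulr1 (leq_trans sp).
by rewrite (leq_trans (size_polyMleq _ _))// size_XsubC addn2/= ltnS.
Qed.

Lemma root_poly_rV_neq0 n (c : {ffun 'I_n -> sphere}) :
  (poly_rV (root_poly c) : 'rV_n.+1) != 0.
Proof.
apply/eqP => /(congr1 rVpoly); rewrite poly_rV_K ?size_root_poly// linear0.
by apply/eqP/monic_neq0/root_poly_monic.
Qed.

End Sphere.
Arguments sphere : clear implicits.
Arguments spheres : clear implicits.
Arguments spheres_minus_diag : clear implicits.

Section Permute.
Variables (T : choiceType) (n : nat).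

Definition permute (s : 'S_n) (f : {ffun 'I_n -> T}) : {ffun 'I_n -> T} :=
  [ffun i => f (s i)].

Lemma permute1 f : permute 1%g f = f.
Proof. by apply/ffunP => i; rewrite ffunE perm1. Qed.

Lemma permuteM s t f : permute s (permute t f) = permute (s * t)%g f.
Proof. by apply/ffunP => i; rewrite !ffunE permM. Qed.

Lemma permuteK s : cancel (permute s) (permute s^-1%g).
Proof. by move=> f; rewrite permuteM mulVg permute1. Qed.

Definition sym_rel (f g : {ffun 'I_n -> T}) := [exists s : 'S_n, g == permute s f].

Lemma sym_rel_refl : reflexive sym_rel.
Proof. by move=> f; apply/existsP; exists 1%g; rewrite permute1. Qed.

Lemma sym_rel_sym : symmetric sym_rel.
Proof.
suff H f g : sym_rel f g -> sym_rel g f by move=> f g; apply/idP/idP; exact: H.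
by move=> /existsP[s /eqP->]; apply/existsP; exists s^-1%g; rewrite permuteK.
Qed.

Lemma sym_rel_trans : transitive sym_rel.
Proof.
move=> g f h /existsP[s /eqP->] /existsP[t /eqP->].
by apply/existsP; exists (t * s)%g; rewrite permuteM.
Qed.

Canonical sym_equiv := EquivRel sym_rel sym_rel_refl sym_rel_sym sym_rel_trans.

(* T^n / S(n) *)
Definition Sym := {eq_quot sym_equiv}.
HB.instance Definition _ := Choice.on Sym.

Definition members (x : Sym) : {ffun 'I_n -> T} := repr x.

End Permute.

Section Omega.
(* to be instantiated with the field R[i] of complex numbers *)
Variable C : numFieldType.
Variable s : nat.

(* s - 1 = s.-2.+1 as 2 <= s; coordinates of CP^(2s-1) are listed by increasing
   degree: a_0, ..., a_(s-2), b_0, ..., b_s. *)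
Definition Omega_coef : charted C :=
  sub_charted [set x : Proj C (s.-2.+1 + s.+1) |
    let Q := rVpoly (lsubmx (hcoord x)) in
    let P := rVpoly (rsubmx (hcoord x)) in
    formal_resultant s s.-2 P Q != 0 /\ formal_discr s P != 0].

Definition zeros_poles : set (Sym (sphere C) s.-2 * Sym (sphere C) s) :=
  [set u | injective (members u.2) /\
    forall j i, members u.1 j <> members u.2 i].

Definition numer (u : set_type zeros_poles) := root_poly (members (val u).1).
Definition denom (u : set_type zeros_poles) := root_poly (members (val u).2).

(* The identification of sphere^n / S(n) with CP^n sends an n-tuple of points of the sphere to the
   coefficients of its root polynomial, of formal degree n. *)
Definition Ms_embed (u : set_type zeros_poles) :
    prod_charted (Proj C s.-2.+1) (Proj C s.+1) :=
  (Proj_pt (root_poly_rV_neq0 (members (val u).1)),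
   Proj_pt (root_poly_rV_neq0 (members (val u).2))).

Definition Ms : charted C := pullback_charted Ms_embed.

(* the index a : 'I_(2s-1) stands for the point a + 1 of {1, ..., 2s-1} *)
Definition idx (a : 'I_(2 * s - 1)) : C := a.+1%:R.

Definition Ua (a : 'I_(2 * s - 1)) : set Ms :=
  [set u | (numer u).[idx a] != 0 /\ (denom u).[idx a] != 0].

Definition phi (a b : 'I_(2 * s - 1)) (u : Ms) : C :=
  (numer u).[idx a] / (denom u).[idx a] * ((denom u).[idx b] / (numer u).[idx b]).

(* disjoint union of the products Ua b * C^*, with elements ((b, u), l) *)
Definition zp_total :=
  set_type [set x : 'I_(2 * s - 1) * Ms * C | Ua x.1.1 x.1.2 /\ x.2 != 0].
HB.instance Definition _ := Choice.on zp_total.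

Definition zp_rel (x y : zp_total) : bool :=
  let: (b, u, l) := val x in let: (a, v, k) := val y in
  (v == u) && (k == phi a b u * l).

Lemma zp_rel_refl : reflexive zp_rel.
Proof.
move=> x; rewrite /zp_rel; case: x => -[[b u] l] /= /set_mem/= [[n0 d0] l0].
by rewrite eqxx/= /phi; apply/eqP; field; apply/andP.
Qed.

Lemma zp_rel_sym : symmetric zp_rel.
Proof.
suff H x y : zp_rel x y -> zp_rel y x by move=> x y; apply/idP/idP; exact: H.
rewrite /zp_rel; case: x => -[[b u] l] /= /set_mem/= [[n0 d0] l0].
case: y => -[[a v] k] /= /set_mem/= [[n1 d1] k0].
move=> /andP[/eqP vu /eqP ->]; rewrite vu in n1 d1 *; rewrite eqxx/= /phi.
by apply/eqP; field; do ?[apply/andP; split].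
Qed.

Lemma zp_rel_trans : transitive zp_rel.
Proof.
move=> y x z; rewrite /zp_rel.
case: x => -[[b u] l] /= /set_mem/= [[n0 d0] l0].
case: y => -[[a v] k] /= /set_mem/= [[n1 d1] k0].
case: z => -[[c w] m] /= /set_mem/= [[n2 d2] m0].
move=> /andP[/eqP vu /eqP ->] /andP[/eqP wv /eqP ->].
rewrite wv vu eqxx/= /phi; rewrite ?wv ?vu in n1 d1 n2 d2 *.
by apply/eqP; field; do ?[apply/andP; split].
Qed.

Canonical zp_equiv := EquivRel zp_rel zp_rel_refl zp_rel_sym zp_rel_trans.

(* The trivialization over Ua a, followed by a chart of the base. *)
Definition zp_chart (a : 'I_(2 * s - 1)) (c : chart Ms (model Ms)) :
    chart {eq_quot zp_equiv} (model Ms * C)%type :=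
  Chart [set q | let: (_, u, _) := val (repr q) in Ua a u /\ cdom c u]
    (fun q => let: (b, u, l) := val (repr q) in (c u, phi a b u * l)).

Definition Omega_zp : charted C :=
  @Charted C {eq_quot zp_equiv} (model Ms * C)%type
    [set zp_chart a c | a in [set: 'I_(2 * s - 1)] & c in atlas Ms].

Definition residues : set {ffun 'I_s -> C} :=
  [set r | (forall i, r i != 0) /\ \sum_i r i = 0].

Definition Hs_chart : chart (set_type residues) 'rV[C]_s.-1 :=
  Chart setT (fun r : set_type residues =>
    \row_(i < s.-1) val r (widen_ord (leq_pred s) i)).

Definition Hs : charted C :=
  @Charted C (set_type residues) 'rV[C]_s.-1 [set Hs_chart]%classic.

Definition rp_cover := prod_charted Hs (spheres_minus_diag C s).

Definition rp_rel (x y : rp_cover) : bool :=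
  [exists t : 'S_s, (val y.1 == permute t (val x.1)) &&
                    (val y.2 == permute t (val x.2))].

Lemma rp_rel_refl : reflexive rp_rel.
Proof. by move=> x; apply/existsP; exists 1%g; rewrite !permute1 !eqxx. Qed.

Lemma rp_rel_sym : symmetric rp_rel.
Proof.
suff H x y : rp_rel x y -> rp_rel y x by move=> x y; apply/idP/idP; exact: H.
move=> /existsP[t /andP[/eqP e1 /eqP e2]]; apply/existsP; exists t^-1%g.
by rewrite e1 e2 !permuteK !eqxx.
Qed.

Lemma rp_rel_trans : transitive rp_rel.
Proof.
move=> y x z /existsP[t /andP[/eqP e1 /eqP e2]].
move=> /existsP[t' /andP[/eqP f1 /eqP f2]].
by apply/existsP; exists (t' * t)%g; rewrite f1 f2 e1 e2 !permuteM !eqxx.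
Qed.

Canonical rp_equiv := EquivRel rp_rel rp_rel_refl rp_rel_sym rp_rel_trans.

Definition Omega_rp : charted C := quot_charted rp_equiv.

End Omega.

(* Main.v *)
(* A form with simple poles is (Q / P) dz, with P and Q binary forms of degrees s
   and s - 2, and also \sum_i r_i dz / (z - p_i) with \sum_i r_i = 0. In
   homogeneous coordinates of the sphere, with brackets [u, v] = u_2 v_1 - u_1 v_2,
   the pole at infinity needs no special treatment: if P is the product of the
   [p_i, -], then the resultant and the discriminant do not vanish iff the p_i
   are distinct and Q does not vanish at them, and r_i is Q(p_i) divided by the
   product over j <> i of the [p_j, p_i].

   Zeros-poles: (u, mu) |-> [mu Q_u : P_u] is a bijection onto the space of
   coefficients, rational in the charts in both directions.

   Residues-poles: the map to the coefficients is polynomial in the charts. Its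
   inverse is holomorphic because simple roots depend holomorphically on the
   coefficients: the roots persist, since P(p) / P(q) is the product of the
   [p_i, p] / [p_i, q]; and if p is a root of P_0 then, for P near P_0, the
   displacement of this root is P(p) times a continuous function.

   The space of coefficients is an open subset of the projective space, hence a
   manifold. For the two other spaces, Hausdorffness, second countability and the
   holomorphy of the transition maps are transported by these bijections. *)
Require Import Defs.
From mathcomp Require Import all_boot all_order all_algebra all_fingroup.
From mathcomp Require Import generic_quotient complex ring zify.
From mathcomp Require Import boolp classical_sets functions cardinality reals.
From mathcomp Require Import topology normedtype landau derive.

Set Implicit Arguments.
Unset Strict Implicit.
Unset Printing Implicit Defensive.

Import Order.TTheory GRing.Theory Num.Theory.
Import numFieldNormedType.Exports.

Local Open Scope classical_set_scope.
Local Open Scope ring_scope.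
Local Open Scope quotient_scope.

(** * Binary forms and points of the sphere *)

(** The three spaces meet in row vectors of length 2 s, taken up to a non-zero factor. Zeros-poles
    and residues-poles data have a canonical row, with monic denominator, but a point of the
    projective space only has the row of a chosen representative, and chart coordinates lead to yet
    other normalizations. Hence the many statements [exists2 k, k != 0 & _ = k *: _]: the factor k
    is never asked to be differentiable, because the charts divide it out.

    One counting principle, that a form of degree n - 1 with n zeros on the sphere is zero, yields
    the criteria for both determinants and the interpolation that produces the residues.

    Holomorphy asks for differentiability at the centre of each comparison only. So it is enough
    that the roots are continuous at that point and that the factor P(p), which vanishes there, is
    multiplied by a continuous function; no implicit function theorem enters.

    The charts of the residues-poles space come from arbitrary local sections of the projection, so
    that a local inverse, once found, still has to be brought into the image of the given section;
    this is where the openness of that image is used. *)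

Section HomogeneousEvaluation.
Context {K : fieldType}.
Implicit Types (p q : {poly K}) (x y : K * K).

(* The value at x of the binary form of degree n whose dehomogenization is p. *)
Definition heval n p x : K := \sum_(k < n.+1) p`_k * x.1 ^+ k * x.2 ^+ (n - k).

Definition lin x : {poly K} := x.2 *: 'X - x.1%:P.

Definition br x y : K := x.2 * y.1 - x.1 * y.2.

Lemma hevalE n p x : (size p <= n.+1)%N -> x.2 != 0 ->
  heval n p x = x.2 ^+ n * p.[x.1 / x.2].
Proof.
move=> sp x0; rewrite (horner_coef_wide _ sp) mulr_sumr; apply: eq_bigr => k _.
have kn : (k <= n)%N by rewrite -ltnS.
have -> : x.2 ^+ n = x.2 ^+ (n - k) * x.2 ^+ k by rewrite -exprD subnK.
by rewrite expr_div_n; field; rewrite expf_neq0.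
Qed.

Lemma heval_oo n p x : x.2 = 0 -> heval n p x = p`_n * x.1 ^+ n.
Proof.
move=> x0; rewrite /heval big_ord_recr/= subnn expr0 mulr1 big1 ?add0r// => k _.
by rewrite x0 expr0n subn_eq0 leqNgt ltn_ord mulr0.
Qed.

Lemma hevalD n p q x : heval n (p + q) x = heval n p x + heval n q x.
Proof.
by rewrite /heval -big_split; apply: eq_bigr => k _; rewrite coefD !mulrDl.
Qed.

Lemma hevalZ n (k : K) p x : heval n (k *: p) x = k * heval n p x.
Proof.
by rewrite /heval mulr_sumr; apply: eq_bigr => i _; rewrite coefZ !mulrA.
Qed.

Lemma hevalN n p x : heval n (- p) x = - heval n p x.
Proof. by rewrite -scaleN1r hevalZ mulN1r. Qed.

Lemma hevalB n p q x : heval n (p - q) x = heval n p x - heval n q x.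
Proof. by rewrite hevalD hevalN. Qed.

Lemma heval0 n x : heval n 0 x = 0.
Proof. by rewrite -(scale0r 0) hevalZ mul0r. Qed.

Lemma heval_sum n (I : Type) (r : seq I) (P : pred I) (F : I -> {poly K}) x :
  heval n (\sum_(i <- r | P i) F i) x = \sum_(i <- r | P i) heval n (F i) x.
Proof.
by elim/big_rec2: _ => [|i a b _ <-]; rewrite ?heval0// hevalD.
Qed.

(** Away from infinity this is [hornerM]. At infinity only the coefficients of top formal degree
    survive, and the only contribution to the degree m + n is the product of those of degrees m and
    n, be it zero or not. *)
Lemma hevalM m n p q x : (size p <= m.+1)%N -> (size q <= n.+1)%N ->
  heval (m + n) (p * q) x = heval m p x * heval n q x.
Proof.
move=> sp sq; have spq : (size (p * q)%R <= (m + n).+1)%N.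
  by rewrite (leq_trans (size_polyMleq _ _))//; lia.
have [x0|x0] := eqVneq x.2 0; last first.
  by rewrite !hevalE// hornerM exprD; ring.
rewrite !heval_oo//; suff -> : (p * q)`_(m + n) = p`_m * q`_n.
  by rewrite exprD; ring.
have mm : (m < (m + n).+1)%N by lia.
rewrite coefM (bigD1 (Ordinal mm))//= addKn big1 ?addr0// => j jm.
have [jm'|jm'] := ltnP m j.
  by rewrite nth_default ?mul0r// (leq_trans sp).
rewrite [q`__]nth_default ?mulr0// (leq_trans sq)//.
have {jm}/eqP jm : (j : nat) != m by apply: contraNneq jm => e; apply/eqP/val_inj.
by lia.
Qed.

Lemma heval1 x : heval 1 1 x = x.2.
Proof. by rewrite /heval !big_ord_recl big_ord0/= !coef1/=; ring. Qed.

Lemma heval01 x : heval 0 1 x = 1.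
Proof. by rewrite /heval !big_ord_recl big_ord0/= !coef1/=; ring. Qed.

Lemma heval1X x : heval 1 'X x = x.1.
Proof. by rewrite /heval !big_ord_recl big_ord0/= !coefX/=; ring. Qed.

Lemma heval_lin y x : heval 1 (lin y) x = br y x.
Proof.
rewrite /heval !big_ord_recl big_ord0/= /lin !coefB !coefZ !coefX !coefC/= /br.
by ring.
Qed.

Lemma heval_up n p x : (size p <= n.+1)%N -> heval n.+1 p x = x.2 * heval n p x.
Proof.
by move=> sp; rewrite -{1}[p]mul1r -add1n hevalM ?heval1 ?size_poly1.
Qed.

Lemma hevalXM n p x : (size p <= n.+1)%N ->
  heval n.+1 ('X * p) x = x.1 * heval n p x.
Proof.
by move=> sp; rewrite -add1n hevalM ?heval1X ?size_polyX.
Qed.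

Lemma size_lin y : (size (lin y) <= 2)%N.
Proof.
rewrite /lin (leq_trans (size_polyD _ _))// geq_max size_polyN.
rewrite (leq_trans (size_polyC_leq1 _))// andbT.
by rewrite (leq_trans (size_scale_leq _ _))// size_polyX.
Qed.

Lemma size_prod_lin (I : Type) (r : seq I) (P : pred I) (y : I -> K * K) :
  (size (\prod_(i <- r | P i) lin (y i))%R <= (\sum_(i <- r | P i) 1).+1)%N.
Proof.
elim/big_rec2: _ => [|i a b _ sb]; first by rewrite size_poly1.
rewrite (leq_trans (size_polyMleq _ _))//.
by have := size_lin (y i); lia.
Qed.

Lemma heval_prod_lin (I : Type) (r : seq I) (P : pred I) (y : I -> K * K) x :
  heval (\sum_(i <- r | P i) 1) (\prod_(i <- r | P i) lin (y i)) x =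
  \prod_(i <- r | P i) br (y i) x.
Proof.
elim: r => [|i r IH]; first by rewrite !big_nil heval01.
rewrite !big_cons; case: (P i) => //.
by rewrite hevalM ?size_lin ?size_prod_lin// heval_lin IH.
Qed.

Lemma brxx x : br x x = 0.
Proof. by rewrite /br; ring. Qed.

Lemma lin_scale k x : lin (k * x.1, k * x.2) = k *: lin x.
Proof. by rewrite /lin/= scalerBr scalerA polyCM mul_polyC. Qed.

Lemma lin_eq0 x : (lin x == 0) = (x == 0).
Proof.
apply/eqP/eqP => [l0|->]; last by rewrite /lin/= scale0r subrr.
have := congr1 (fun p => p`_1) l0; have := congr1 (fun p => p`_0) l0.
rewrite /lin !coefB !coefZ !coefX !coefC/= mulr1 mulr0 subr0 sub0r => /eqP.
by rewrite oppr_eq0 => /eqP x1 x2; rewrite [x]surjective_pairing x1 x2.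
Qed.

End HomogeneousEvaluation.

Section Points.
Context {K : numFieldType}.
Implicit Types (x y : sphere K) (p q u w : {poly K}).

(* Homogeneous coordinates; the sign makes [lin (pt None) = 1]. *)
Definition pt x : K * K := if x is Some z then (z, 1) else (-1, 0).

Lemma pt_neq0 x : pt x != 0.
Proof.
by case: x => [z|]; rewrite xpair_eqE/= ?oner_eq0 ?oppr_eq0 ?oner_eq0 ?andbF.
Qed.

Lemma br_pt_eq0 x y : (br (pt x) (pt y) == 0) = (x == y).
Proof.
case: x y => [z|] [w|]; rewrite /br/=.
- by rewrite mul1r mulr1 subr_eq0 eq_sym.
- by rewrite mulr0 subr0 mul1r oppr_eq0 oner_eq0.
- by rewrite mul0r mulN1r sub0r opprK oner_eq0.
- by rewrite mul0r mulr0 subr0 !eqxx.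
Qed.

Lemma root_polyE n (c : {ffun 'I_n -> sphere K}) :
  root_poly c = \prod_i lin (pt (c i)).
Proof.
apply: eq_bigr => i _; rewrite /lin; case: (c i) => [z|]/=.
  by rewrite scale1r.
by rewrite scale0r sub0r polyCN opprK.
Qed.

Lemma root_polyD1 n (c : {ffun 'I_n -> sphere K}) i :
  root_poly c = lin (pt (c i)) * \prod_(j | j != i) lin (pt (c j)).
Proof. by rewrite root_polyE (bigD1 i). Qed.

Lemma sum1_neq n (i : 'I_n) : (\sum_(j | j != i) 1 = n.-1)%N.
Proof. by rewrite sum1_card cardC1 card_ord. Qed.

Lemma size_prod_lin_neq n (i : 'I_n) (y : 'I_n -> K * K) :
  (size (\prod_(j | j != i) lin (y j))%R <= n)%N.
Proof.
have n0 : (0 < n)%N by case: i => m; apply: leq_trans.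
by have := size_prod_lin (index_enum _) (fun j => j != i) y; rewrite sum1_neq prednK.
Qed.

Lemma heval_prod_lin_neq n (i : 'I_n) (y : 'I_n -> K * K) v :
  heval n.-1 (\prod_(j | j != i) lin (y j)) v = \prod_(j | j != i) br (y j) v.
Proof. by rewrite -heval_prod_lin sum1_neq. Qed.

Lemma heval_root_poly n (c : {ffun 'I_n -> sphere K}) v :
  heval n (root_poly c) v = \prod_i br (pt (c i)) v.
Proof. by rewrite root_polyE -heval_prod_lin sum1_card card_ord. Qed.

(** The finite points are roots of p. Infinity occurs at most once among the points, and a zero
    there kills the coefficient of degree n - 1, which makes up for the missing root. *)
Lemma heval_vanish n p (x : 'I_n -> sphere K) : injective x ->
  (size p <= n)%N -> (forall i, heval n.-1 p (pt (x i)) = 0) -> p = 0.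
Proof.
case: n x => [|n] x xi sp p0; first by apply/eqP; rewrite -size_poly_leq0.
pose s := pmap id (codom x).
have us : uniq s.
  rewrite (@pmap_uniq _ _ id Some)//; first by case.
  by rewrite map_inj_uniq ?enum_uniq.
have rs : all (root p) s.
  apply/allP => z; rewrite mem_pmap map_id => /codomP[i xz].
  have := p0 i; rewrite -xz hevalE//= ?oner_neq0// expr1n mul1r divr1.
  by move/eqP.
have cs : (size s + count (pred1 None) (codom x) = n.+1)%N.
  rewrite size_pmap -[RHS](card_ord n.+1) -(size_codom x).
  by elim: (codom x) => //= -[z|] l /=; lia.
apply: (roots_geq_poly_eq0 rs us).
have [i xi0|nx] := pickP (fun i => x i == None); last first.
  rewrite (_ : count _ _ = 0)%N ?addn0 in cs; first by rewrite cs.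
  apply/eqP; rewrite eqn0Ngt -has_count; apply/hasPn => y /codomP[i ->].
  by rewrite /= nx.
have c1 : (count (pred1 None) (codom x) <= 1)%N.
  by rewrite count_uniq_mem ?leq_b1// map_inj_uniq ?enum_uniq.
have := p0 i; rewrite (eqP xi0) heval_oo//= => /eqP.
rewrite mulf_eq0 expf_eq0 oppr_eq0 oner_eq0 andbF orbF => /eqP pn.
have : (size p <= n)%N.
  apply/leq_sizeP => j; rewrite leq_eqVlt => /orP[/eqP<-//|nj].
  by rewrite nth_default// (leq_trans sp).
by move=> /leq_trans; apply; lia.
Qed.

Lemma root_poly_permute n (c : {ffun 'I_n -> sphere K}) (t : 'S_n) :
  root_poly (permute t c) = root_poly c.
Proof.
rewrite /root_poly [RHS](reindex_inj (@perm_inj _ t)).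
by apply: eq_bigr => i _; rewrite ffunE.
Qed.

(** Unique factorization determines the multiset of finite entries; the multiplicity of infinity is
    what remains of the total n. *)
Lemma root_poly_inj n (c d : {ffun 'I_n -> sphere K}) :
  root_poly c = root_poly d -> exists t : 'S_n, d = permute t c.
Proof.
have rE (e : {ffun 'I_n -> sphere K}) :
    root_poly e = \prod_(z <- pmap id (codom e)) ('X - z%:P).
  rewrite big_pmap /codom /image_mem big_map big_enum/=.
  by apply: eq_bigr => i _; case: (e i).
rewrite !rE => /prod_XsubC_eq pe.
have cN (e : {ffun 'I_n -> sphere K}) :
    (size (pmap id (codom e)) + count_mem None (codom e) = n)%N.
  rewrite size_pmap -[RHS](card_ord n) -(size_codom e).
  by elim: (codom e) => //= -[z|] l /=; lia.
have cS (e : {ffun 'I_n -> sphere K}) z :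
    count_mem (Some z) (codom e) = count_mem z (pmap id (codom e)).
  by elim: (codom e) => //= -[w|] l /= ->.
have : perm_eq (codom d) (codom c).
  apply/allP => -[z|] _ /=; first by rewrite !cS (seq.permP pe).
  have := cN d; rewrite -[RHS](cN c) (perm_size pe) => /eqP.
  by rewrite eqn_add2l.
move=> pdc.
have [t dt] : exists t : 'S_n,
    codom_tuple d = [tuple tnth [tuple c i | i < n] (t i) | i < n] :> seq _.
  by apply/tuple_permP; rewrite /= -codomE.
exists t; apply/ffunP => i; rewrite ffunE.
have /(congr1 (fun s => nth None s i)) := dt.
rewrite (nth_map i) ?size_enum_ord// nth_ord_enum.
by rewrite (nth_map i) ?size_enum_ord// nth_ord_enum tnth_mktuple.
Qed.

End Points.

(** * Resultants and discriminants *)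

Section ResultantKernel.
Context {K : fieldType}.
Implicit Types (p q u w : {poly K}).

Let mul_rowpoly d e (v : 'rV[K]_d) p j :
  (v *m \matrix_(i < d, j < e) (p * 'X^i)`_j) 0 j = (rVpoly v * p)`_j.
Proof.
rewrite mxE [rVpoly v]/rVpoly poly_def mulr_suml coef_sum.
apply: eq_bigr => i _; rewrite mxE valK /= -scalerAl coefZ; congr (_ * _`__).
by rewrite mulrC.
Qed.

Lemma size_rVpoly d (v : 'rV[K]_d) : (size (rVpoly v) <= d)%N.
Proof. exact: size_poly. Qed.

Lemma size_polyM_bound m n p q : (size p <= m)%N -> (size q <= n.+1)%N ->
  (size (p * q)%R <= m + n)%N.
Proof.
move=> sp sq; rewrite (leq_trans (size_polyMleq _ _))//.
by move: (size p) (size q) sp sq => a b; lia.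
Qed.

(** A row vector in the left kernel of the Sylvester matrix is a pair of cofactors u, w, whose size
    bounds are the heights of the two blocks. *)
Lemma formal_resultant_eq0P m n p q :
    (size p <= m.+1)%N -> (size q <= n.+1)%N ->
  reflect (exists u w, [/\ (u != 0) || (w != 0), (size u <= n)%N,
                           (size w <= m)%N & u * p + w * q = 0])
    (formal_resultant m n p q == 0).
Proof.
move=> sp sq; apply: (iffP det0P) => [[v v0 e]|[u [w [uw su sw e]]]].
- exists (rVpoly (lsubmx v)), (rVpoly (rsubmx v)).
  rewrite !size_rVpoly; split=> //.
    apply: contraNT v0; rewrite negb_or !negbK => /andP[/eqP l0 /eqP r0].
    by rewrite -[v]hsubmxK -[lsubmx v]rVpolyK l0 -[rsubmx v]rVpolyK r0 !linear0 row_mx0.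
  apply/polyP => k; rewrite coef0; have [kmn|mnk] := ltnP k (n + m); last first.
    rewrite nth_default// (leq_trans _ mnk)// (leq_trans (size_polyD _ _))//.
    rewrite geq_max size_polyM_bound ?size_rVpoly//= addnC.
    by rewrite size_polyM_bound ?size_rVpoly.
  move/rowP: e => /(_ (Ordinal kmn)); rewrite -{1}[v]hsubmxK mul_row_col.
  by rewrite mxE !mul_rowpoly mxE coefD.
- exists (row_mx (poly_rV u) (poly_rV w)).
    apply: contraTneq uw => /eqP; rewrite row_mx_eq0 => /andP[/eqP u0 /eqP w0].
    by rewrite -(poly_rV_K su) -(poly_rV_K sw) u0 w0 !linear0 eqxx.
  rewrite mul_row_col; apply/rowP => j; rewrite mxE !mul_rowpoly !poly_rV_K//.
  by rewrite -coefD e coef0 mxE.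
Qed.

(** The coefficient of degree 2 d - 2 of u p + w p' is p_d (u_(d-2) + d w_(d-1)). The modified last
    column imposes the vanishing of the second factor, which is more than that of the product when
    p_d = 0. *)
Lemma formal_discr_eq0P d p : (1 < d)%N -> (size p <= d.+1)%N ->
  reflect (exists u w, [/\ (u != 0) || (w != 0), (size u <= d.-1)%N,
      (size w <= d)%N, u * p + w * p^`() = 0 & u`_d.-2 + w`_d.-1 *+ d = 0])
    (formal_discr d p == 0).
Proof.
case: d => [|[|d]]// _ sp.
pose N := (d.+1 + d.+2)%N.
have Nd : N.-1 = d.+1 + d.+1 :> nat by rewrite /N; lia.
have last_lt : (N.-1 < N)%N by rewrite /N; lia.
(* Both blocks have this shape: Sylvester columns, except that the last column is c in row f and
   zero elsewhere. *)
have entry e f (v : 'rV[K]_e) r (c : K) (j : 'I_N) :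
    (v *m \matrix_(i < e, j < N)
       if j == N.-1 :> nat then (i == f :> nat)%:R * c else (r * 'X^i)`_j) 0 j
    = if j == N.-1 :> nat then (rVpoly v)`_f * c else (rVpoly v * r)`_j.
  case: ifP => [jN|jN]; last first.
    by rewrite -(mul_rowpoly v); rewrite !mxE; apply: eq_bigr => i _; rewrite !mxE jN.
  rewrite mxE coef_rVpoly; case: insubP => [i _ fi|]; last first.
    rewrite -leqNgt mul0r => ef; apply: big1 => i _; rewrite mxE jN.
    by rewrite (_ : _ == _ = false) ?mul0r ?mulr0//; have := ltn_ord i; lia.
  rewrite (bigD1 i)//= mxE jN fi eqxx mul1r big1 ?addr0// => k ki.
  by rewrite mxE jN -fi (inj_eq val_inj) (negbTE ki) mul0r mulr0.
have det_mx : formal_discr d.+2 p = \det (col_mx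
    (\matrix_(i < d.+1, j < N)
       if j == N.-1 :> nat then (i == d :> nat)%:R * 1 else (p * 'X^i)`_j)
    (\matrix_(i < d.+2, j < N)
       if j == N.-1 :> nat then (i == d.+1 :> nat)%:R * (d.+2)%:R
       else (p^`() * 'X^i)`_j)).
  rewrite /formal_discr; congr (\det (col_mx _ _)).
    by apply/matrixP => i j; rewrite !mxE mulr1.
  by apply/matrixP => i j; rewrite !mxE mulr_natr.
have sp' : (size p^`() <= d.+2)%N.
  by rewrite (leq_trans (size_poly _ _))//; move: (size p) sp => a; lia.
rewrite det_mx {det_mx}; apply: (iffP det0P) => [[v v0 e]|[u [w [uw su sw e1 e2]]]].
- have su := size_rVpoly (lsubmx v); have sw := size_rVpoly (rsubmx v).
  have e2 : (rVpoly (lsubmx v))`_d + (rVpoly (rsubmx v))`_d.+1 *+ d.+2 = 0.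
    move/rowP: e => /(_ (Ordinal last_lt)).
    rewrite -{1}[v]hsubmxK mul_row_col mxE !entry mxE eqxx mulr1.
    by rewrite mulr_natr.
  exists (rVpoly (lsubmx v)), (rVpoly (rsubmx v)); split=> //.
    apply: contraNT v0; rewrite negb_or !negbK => /andP[/eqP l0 /eqP r0].
    by rewrite -[v]hsubmxK -[lsubmx v]rVpolyK l0 -[rsubmx v]rVpolyK r0 !linear0 row_mx0.
  set u := rVpoly _ in su e2 *; set w := rVpoly _ in sw e2 *.
  (* Evaluation at (1, 0), the point at infinity, reads off the coefficient of top formal degree. *)
  have top (a b : {poly K}) m n : (size a <= m.+1)%N -> (size b <= n.+1)%N ->
      (a * b)`_(m + n) = a`_m * b`_n.
    move=> sa sb; have := hevalM (1, 0) sa sb.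
    by rewrite !heval_oo//= !expr1n !mulr1.
  apply/polyP => k; rewrite coef0; have [kN|kN|kN] := ltngtP k N.-1.
  + have kN' : (k < N)%N by lia.
    move/rowP: e => /(_ (Ordinal kN')); rewrite -{1}[v]hsubmxK mul_row_col.
    by rewrite mxE !entry mxE/= ltn_eqF// coefD.
  + rewrite nth_default// (leq_trans _ kN)// (leq_trans (size_polyD _ _))//.
    have -> : (N.-1.+1 = d.+1 + d.+2)%N by lia.
    rewrite geq_max.
    by rewrite size_polyM_bound//= addnC size_polyM_bound.
  + have kd : k = (d + d.+2)%N by rewrite kN Nd; lia.
    rewrite coefD {1}kd top// kN Nd top//.
    by rewrite coef_deriv mulrnAr -mulrnAl -mulrDl e2 mul0r.
- exists (row_mx (poly_rV u) (poly_rV w)).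
    apply: contraTneq uw => /eqP; rewrite row_mx_eq0 => /andP[/eqP u0 /eqP w0].
    by rewrite -(poly_rV_K su) -(poly_rV_K sw) u0 w0 !linear0 eqxx.
  rewrite mul_row_col; apply/rowP => j; rewrite mxE !entry !poly_rV_K//.
  rewrite mxE; case: ifP => _; last by rewrite -coefD e1 coef0.
  by rewrite mulr1 mulr_natr.
Qed.

End ResultantKernel.

(** * The two determinants in terms of zeros and poles *)

Section Conditions.
Context {K : numFieldType}.
Implicit Types (p q u w : {poly K}).

(** If u p + w q = 0, then at the zeros of p the form w, of degree m - 1, vanishes m times. Hence w
    = 0, and then u = 0. *)
Lemma formal_resultant_neq0 m n p q (x : 'I_m -> sphere K) : (0 < m)%N ->
  injective x -> p != 0 -> (size p <= m.+1)%N -> (size q <= n.+1)%N ->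
  (forall i, heval m p (pt (x i)) = 0) ->
  (forall i, heval n q (pt (x i)) != 0) -> formal_resultant m n p q != 0.
Proof.
move=> m0 xi p0 sp sq px qx; apply/(formal_resultant_eq0P sp sq).
move=> [u [w [uw su sw e]]]; suff w0 : w = 0.
  move: e uw; rewrite w0 mul0r addr0 eqxx orbF => /eqP.
  by rewrite mulf_eq0 (negbTE p0) orbF => ->.
apply: (heval_vanish xi sw) => i; apply/eqP.
have := heval0 (m.-1 + n) (pt (x i)); rewrite -e hevalD => /eqP.
rewrite [X in _ + X]hevalM ?prednK//.
suff -> : heval (m.-1 + n) (u * p) (pt (x i)) = 0.
  by rewrite add0r mulf_eq0 (negbTE (qx i)) orbF.
(* For n = 0 the size bound forces u = 0; otherwise u is a form of degree n - 1 and u p one of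
   degree (n - 1) + m. *)
case: n su {sq qx e} => [|n] su.
  by rewrite (_ : u = 0) ?mul0r ?heval0//; apply/eqP; rewrite -size_poly_leq0.
by rewrite (_ : m.-1 + n.+1 = n + m)%N ?hevalM ?px ?mulr0//; lia.
Qed.

Lemma formal_resultant_common_root m n p q y : lin y * p != 0 ->
  (size p <= m)%N -> (size q <= n)%N ->
  formal_resultant m n (lin y * p) (lin y * q) == 0.
Proof.
move=> p0 sp sq; have sl := size_lin y.
apply/formal_resultant_eq0P.
- by rewrite mulrC (leq_trans (size_polyM_bound sp sl))// addn1.
- by rewrite mulrC (leq_trans (size_polyM_bound sq sl))// addn1.
exists q, (- p); split; rewrite ?size_polyN//; last by ring.
rewrite oppr_eq0; apply/orP; right; apply: contraNneq p0 => ->.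
by rewrite mulr0.
Qed.

(** By Euler's identity n p - X p' is the partial derivative of the form in the second variable, of
    degree n - 1: the terms of degree n cancel. *)
Lemma size_euler n p : (size p <= n.+1)%N -> (size (p *+ n - 'X * p^`())%R <= n)%N.
Proof.
move=> sp; apply/leq_sizeP => j nj; rewrite coefB coefMn coefXM.
case: eqP => [j0|/eqP j0].
  by move: nj; rewrite j0 leqn0 => /eqP ->; rewrite mulr0n subr0.
rewrite coef_deriv prednK ?lt0n//; move: nj; rewrite leq_eqVlt => /orP[/eqP ->|nj].
  by rewrite subrr.
by rewrite nth_default ?mul0rn ?subrr// (leq_trans sp).
Qed.

Lemma deriv_lin (y : K * K) : (lin y)^`() = y.2%:P.
Proof. by rewrite /lin derivB derivZ derivX derivC subr0 alg_polyC. Qed.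

Lemma size_deriv_leq n p : (size p <= n.+1)%N -> (size p^`() <= n)%N.
Proof. by move=> sp; rewrite (leq_trans (size_poly _ _))// -subn1 leq_subLR. Qed.

Lemma br_prod_neq0 s (x : 'I_s -> sphere K) i : injective x ->
  \prod_(j | j != i) br (pt (x j)) (pt (x i)) != 0.
Proof.
by move=> xi; apply/prodf_neq0 => j ji; rewrite br_pt_eq0 (inj_eq xi).
Qed.

(* If u P + w P' = 0, then w (d P - X P') = (d w + X u) P, and the last equation
   of [formal_discr_eq0P] bounds the degree of d w + X u by d - 2. Hence w
   vanishes, as a form of degree d - 1, at the zeros of P, where the two partial
   derivatives of the form P do not both vanish. *)
Lemma formal_discr_neq0 d (k : K) (x : {ffun 'I_d -> sphere K}) : (1 < d)%N ->
  k != 0 -> injective x -> formal_discr d (k *: root_poly x) != 0.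
Proof.
move=> d1 k0 xi; have sP := size_root_poly x.
have P0 := monic_neq0 (root_poly_monic x).
have spk : (size (k *: root_poly x)%R <= d.+1)%N by rewrite size_scale.
apply/(formal_discr_eq0P d1 spk) => -[u [w [uw su sw]]].
rewrite derivZ -!scalerAr -scalerDr => /eqP.
rewrite scaler_eq0 (negbTE k0)/= => /eqP e top.
set P := root_poly x in sP P0 e.
suff w0 : w = 0.
  move: e uw; rewrite w0 mul0r addr0 eqxx orbF => /eqP.
  by rewrite mulf_eq0 (negbTE P0) orbF => ->.
apply: (heval_vanish xi sw) => i.
pose y := pt (x i); pose Q := \prod_(j | j != i) lin (pt (x j)).
have sQ : (size Q <= d)%N by exact: size_prod_lin_neq.
have PE : P = lin y * Q by exact: root_polyD1.
have Py : heval d P y = 0.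
  by rewrite heval_root_poly (bigD1 i)//= brxx mul0r.
have Qy : heval d.-1 Q y != 0 by rewrite heval_prod_lin_neq br_prod_neq0.
have hlin q : (size q <= d.-1)%N -> heval d.-1 (lin y * q) y = 0.
  move=> sq; have dE : (d.-1 = 1 + d.-2)%N by lia.
  by rewrite {1}dE hevalM ?size_lin ?heval_lin ?brxx ?mul0r// (leq_trans sq)// dE.
have sP' : (size P^`() <= d.-1.+1)%N by rewrite size_deriv_leq// prednK//; lia.
have P'y : heval d.-1 P^`() y = y.2 * heval d.-1 Q y.
  rewrite PE derivM deriv_lin hevalD mul_polyC hevalZ hlin ?addr0//.
  by rewrite size_deriv_leq// prednK//; lia.
pose E := P *+ d - 'X * P^`(); have sE : (size E <= d.-1.+1)%N.
  by rewrite prednK ?size_euler//; lia.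
have Ey : heval d.-1 E y = - y.1 * heval d.-1 Q y.
  have -> : E = lin y * (Q *+ d.-1 - 'X * Q^`()) - y.1 *: Q.
    rewrite /E PE derivM deriv_lin.
    have dE : d%:R = (d.-1)%:R + 1 :> {poly K}.
      by rewrite natr1 (prednK (ltnW d1)).
    by rewrite -[_ *+ d]mulr_natr -[_ *+ d.-1]mulr_natr dE /lin -!mul_polyC; ring.
  by rewrite hevalB hlin ?hevalZ ?sub0r ?mulNr// size_euler// prednK//; lia.
pose v := w *+ d + 'X * u; have sv : (size v <= d.-1)%N.
  have sv : (size v <= d)%N.
    rewrite (leq_trans (size_polyD _ _))// geq_max.
    rewrite -scaler_nat (leq_trans (size_scale_leq _ _))//= mulrC.
    have sX : (size ('X : {poly K}) <= 2)%N by rewrite size_polyX.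
    by rewrite (leq_trans (size_polyM_bound su sX))//; lia.
  apply/leq_sizeP => j; rewrite leq_eqVlt => /orP[/eqP<-|dj]; last first.
    by rewrite nth_default// (leq_trans sv)//; lia.
  rewrite coefD coefMn coefXM (_ : d.-1 == 0 = false)%N; last by lia.
  by rewrite addrC.
have eE : w * E = v * P.
  rewrite /E /v mulrBr mulrDl mulrnAr mulrnAl; congr (_ + _).
  rewrite mulrCA -mulrA -mulrN; congr (_ * _).
  by apply/eqP; rewrite -subr_eq0 -opprD oppr_eq0 addrC e.
have dd : (d.-1 + d.-1 = d.-2 + d)%N by lia.
have up q : (size q <= d.-1)%N -> heval (d.-1 + d.-1) (q * P) y = 0.
  by move=> sq; rewrite dd hevalM ?Py ?mulr0// (leq_trans sq)//; lia.
have sw' : (size w <= d.-1.+1)%N by rewrite prednK//; lia.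
have w1 : heval d.-1 w y * y.1 = 0.
  have := up v sv; rewrite -eE hevalM// Ey => /eqP.
  by rewrite mulrA mulf_eq0 (negbTE Qy) orbF mulrN oppr_eq0 => /eqP.
have w2 : heval d.-1 w y * y.2 = 0.
  have := heval0 (d.-1 + d.-1) y; rewrite -e hevalD up// add0r hevalM// P'y.
  by move/eqP; rewrite mulrA mulf_eq0 (negbTE Qy) orbF => /eqP.
apply/eqP; apply: contraTT (pt_neq0 (x i)) => wy; rewrite negbK -/y.
move/eqP: w1; move/eqP: w2; rewrite !mulf_eq0 (negbTE wy)/= => y2 y1.
by rewrite [y]surjective_pairing xpair_eqE y1 y2.
Qed.

Lemma formal_discr_double_root d p (y : K * K) : (1 < d)%N ->
  lin y * (lin y * p) != 0 -> (size p <= d.-1)%N ->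
  formal_discr d (lin y * (lin y * p)) == 0.
Proof.
move=> d1 p0 sp; have sl := size_lin y.
have slp : (size (lin y * p)%R <= d)%N.
  by rewrite mulrC (leq_trans (size_polyM_bound sp sl))//; lia.
apply/formal_discr_eq0P => //.
  by rewrite mulrC (leq_trans (size_polyM_bound slp sl))// addn1.
have sp' : (size p^`() <= d.-2)%N by rewrite size_deriv_leq//; lia.
(* For P with the double factor l = [lin y], the cofactors are - P' / l and P / l. *)
exists (- (p * y.2%:P *+ 2 + p^`() * lin y)), (lin y * p); split=> //.
- apply/orP; right; apply: contraNneq p0 => ->; by rewrite mulr0.
- rewrite size_polyN (leq_trans (size_polyD _ _))// geq_max.
  rewrite -scaler_nat (leq_trans (size_scale_leq _ _))/=.
    by rewrite (leq_trans (size_polyM_bound sp' sl))//; lia.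
  by rewrite -[X in (_ <= X)%N]addn0 size_polyM_bound// size_polyC_leq1.
- by rewrite !derivM deriv_lin; ring.
have c1 n (q r : {poly K}) : (size q <= n.+1)%N -> (size r <= 2)%N ->
    (q * r)`_n.+1 = q`_n * r`_1.
  move=> sq sr; have := hevalM (1, 0) sq sr.
  by rewrite !heval_oo//= !expr1n !mulr1 addn1.
have lin1 : (lin y)`_1 = y.2.
  by rewrite coefB coefZ coefX coefC/= mulr1 subr0.
case: d d1 sp sp' {slp p0} => [|[|d]]//= _ sp sp'.
rewrite [lin y * p]mulrC c1// lin1 coefN coefD coefMn coefMC.
case: d sp sp' => [|d] sp sp'; last by rewrite c1// lin1 coef_deriv; ring.
rewrite (_ : p^`() = 0) ?mul0r ?coef0; last by apply/eqP; rewrite -size_poly_leq0.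
by ring.
Qed.

Lemma formal_discr0 d : (1 < d)%N -> formal_discr d (0 : {poly K}) == 0.
Proof.
move=> d1; apply/formal_discr_eq0P => //; first by rewrite size_poly0.
exists 0, 1; rewrite size_poly0 size_poly1 oner_eq0 eqxx derivC !mulr0 addr0.
split=> //; first by lia.
by rewrite coef0 coef1 (_ : d.-1 == 0 = false)%N ?mul0rn ?addr0//; lia.
Qed.

Lemma formal_resultant0 m n p : (0 < m)%N -> (size p <= m.+1)%N ->
  formal_resultant m n p 0 == 0.
Proof.
move=> m0 sp; apply/formal_resultant_eq0P => //; first by rewrite size_poly0.
by exists 0, 1; rewrite size_poly0 size_poly1 oner_eq0 eqxx mul0r mulr0 addr0.
Qed.

Lemma lin_dvd_root_poly n (c : {ffun 'I_n -> sphere K}) i :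
  exists2 q, root_poly c = lin (pt (c i)) * q & (size q <= n)%N.
Proof.
exists (\prod_(j | j != i) lin (pt (c j)));
  rewrite ?size_prod_lin_neq//; exact: root_polyD1.
Qed.

Lemma simple_poles_condP s k l (x : {ffun 'I_s -> sphere K})
    (c : {ffun 'I_s.-2 -> sphere K}) : (1 < s)%N -> k != 0 -> l != 0 ->
  formal_resultant s s.-2 (k *: root_poly x) (l *: root_poly c) != 0 /\
  formal_discr s (k *: root_poly x) != 0 <->
  injective x /\ forall j i, c j <> x i.
Proof.
move=> s1 k0 l0; have sx := size_root_poly x; have sc := size_root_poly c.
have x0 : k *: root_poly x != 0.
  by rewrite scaler_eq0 negb_or k0 monic_neq0 ?root_poly_monic.
split=> [[res disc]|[xi cx]]; last first.
  split; last exact: formal_discr_neq0.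
  apply: (formal_resultant_neq0 (x := x)) => //; rewrite ?size_scale//.
  - exact: ltnW.
  - by move=> i; rewrite hevalZ heval_root_poly (bigD1 i)//= brxx mul0r mulr0.
  move=> i; rewrite hevalZ heval_root_poly mulf_neq0//.
  by apply/prodf_neq0 => j _; rewrite br_pt_eq0; apply/eqP.
split.
  move=> i j xij; apply: contraNeq disc => ij.
  have -> : k *: root_poly x = lin (pt (x i)) * (lin (pt (x i)) *
      (k *: \prod_(h | (h != i) && (h != j)) lin (pt (x h)))).
    rewrite root_polyE (bigD1 i)//= (bigD1 j)/= 1?eq_sym// xij.
    by rewrite -!scalerAr.
  apply: formal_discr_double_root => //.
    apply: contraNneq x0; rewrite -!scalerAr => /eqP.
    rewrite scaler_eq0 (negbTE k0)/= => /eqP e.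
    by rewrite root_polyE (bigD1 i)//= (bigD1 j)/= 1?eq_sym// -xij e scaler0.
  rewrite size_scale// (leq_trans (size_prod_lin _ _ _))//.
  have := sum1_neq i; rewrite (bigD1 j)/= 1?eq_sym// => <-.
  by rewrite add1n.
move=> j i cx; move: res; rewrite (_ : _ == _ = true)//.
have [p ep sp] := lin_dvd_root_poly x i; have [q eq sq] := lin_dvd_root_poly c j.
rewrite ep eq cx !scalerAr in x0 *.
by apply: formal_resultant_common_root => //; rewrite size_scale.
Qed.

End Conditions.

(** * Partial fractions with poles anywhere on the sphere *)

Section PartialFractions.
Context {K : numFieldType} {s : nat}.
Implicit Types (r : 'I_s -> K) (y : 'I_s -> K * K).

(* The numerator of the form \sum_i r_i d log (y_i.2 z - y_i.1). *)
Definition pfrac r y : {poly K} :=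
  \sum_i (r i * (y i).2) *: \prod_(j | j != i) lin (y j).

Let term_lin (k : K) y i :
  'X * ((k * (y i).2) *: \prod_(j | j != i) lin (y j)) -
  (k * (y i).1) *: \prod_(j | j != i) lin (y j) = k *: \prod_j lin (y j).
Proof.
rewrite -!scalerA -scalerAr -scalerBr; congr (_ *: _).
by rewrite [RHS](bigD1 i)//= /lin mulrBl mul_polyC -scalerAl -scalerAr.
Qed.

(** The two sides differ by [\sum_i r i] times the product of all the factors. This lowers the
    degree of [pfrac] to s - 2, and exchanges the weights (y i).2, which vanish at infinity, for (y
    i).1. *)
Lemma pfracX r y : \sum_i r i = 0 ->
  'X * pfrac r y = \sum_i (r i * (y i).1) *: \prod_(j | j != i) lin (y j).
Proof.
move=> r0; apply/eqP; rewrite -subr_eq0 mulr_sumr -sumrB.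
rewrite (eq_bigr (fun i => r i *: \prod_j lin (y j))); last first.
  by move=> i _; exact: term_lin.
by rewrite -scaler_suml r0 scale0r.
Qed.

Lemma size_pfrac r y : (0 < s)%N -> \sum_i r i = 0 -> (size (pfrac r y) <= s.-1)%N.
Proof.
move=> s0 r0; have [->|q0] := eqVneq (pfrac r y) 0; first by rewrite size_poly0.
rewrite -ltnS prednK// -size_mulX// mulrC pfracX//.
apply: (leq_trans (size_sum _ _ _)); apply/bigmax_leqP => i _.
by rewrite (leq_trans (size_scale_leq _ _))// size_prod_lin_neq.
Qed.

Let heval_term r (a : 'I_s -> K) y i :
  heval s.-1 (\sum_k (r k * a k) *: \prod_(j | j != k) lin (y j)) (y i) =
  a i * (r i * \prod_(j | j != i) br (y j) (y i)).
Proof.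
rewrite heval_sum (bigD1 i)//= hevalZ heval_prod_lin_neq [X in _ + X]big1 ?addr0.
  by rewrite [r i * a i]mulrC mulrA.
move=> k ki; rewrite hevalZ heval_prod_lin_neq (bigD1 i) 1?eq_sym//=.
by rewrite brxx mul0r mulr0.
Qed.

(** Evaluating the sum term by term gives the equality multiplied by (y i).2, and the sum of
    [pfracX] gives it multiplied by (y i).1; one of the two factors can be cancelled. *)
Lemma heval_pfrac r y i : (1 < s)%N -> \sum_i r i = 0 -> y i != 0 ->
  heval s.-2 (pfrac r y) (y i) = r i * \prod_(j | j != i) br (y j) (y i).
Proof.
move=> s1 r0 yi; have sQ := size_pfrac y (ltnW s1) r0.
have s2 : (s.-2.+1 = s.-1)%N by rewrite prednK//; lia.
have e2 := heval_term r (fun k => (y k).2) y i.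
have e1 := heval_term r (fun k => (y k).1) y i.
rewrite -pfracX// -s2 hevalXM ?s2// in e1.
rewrite -/(pfrac r y) -s2 heval_up ?s2// in e2.
have [y2|y2] := eqVneq (y i).2 0; last exact: (mulfI y2).
have y1 : (y i).1 != 0.
  by apply: contraNneq yi => y1; rewrite [y i]surjective_pairing y1 y2.
exact: (mulfI y1).
Qed.

(** This is Lagrange interpolation, applied to both Q and X Q as forms of degree s - 1. Comparing
    the two expansions gives [\sum_i r i] times a non-zero product equal to 0, which is the residue
    theorem. *)
Lemma pfrac_exists (Q : {poly K}) (x : 'I_s -> sphere K) : (1 < s)%N ->
    injective x -> (size Q <= s.-1)%N ->
  let r i := heval s.-2 Q (pt (x i)) /
             \prod_(j | j != i) br (pt (x j)) (pt (x i)) in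
  Q = pfrac r (fun i => pt (x i)) /\ \sum_i r i = 0.
Proof.
move=> s1 xi sQ r; pose y i := pt (x i).
have s2 : (s.-2.+1 = s.-1)%N by rewrite prednK//; lia.
have s3 : (s.-1.+1 = s)%N by rewrite prednK//; lia.
have rE i : r i * \prod_(j | j != i) br (y j) (y i) = heval s.-2 Q (y i).
  by rewrite /r divfK// br_prod_neq0.
have sS (a : 'I_s -> K) :
    (size (\sum_k a k *: \prod_(j | j != k) lin (y j))%R <= s)%N.
  apply: (leq_trans (size_sum _ _ _)); apply/bigmax_leqP => i _.
  by rewrite (leq_trans (size_scale_leq _ _))// size_prod_lin_neq.
have vanish (p q : {poly K}) : (size p <= s)%N -> (size q <= s)%N ->
    (forall i, heval s.-1 p (y i) = heval s.-1 q (y i)) -> p = q.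
  move=> sp sq pq; apply/eqP; rewrite -subr_eq0; apply/eqP.
  apply: (heval_vanish xi) => [|i]; last by rewrite hevalB pq subrr.
  by rewrite (leq_trans (size_polyD _ _))// geq_max sp size_polyN.
have e2 : Q = pfrac r y.
  apply: vanish => [||i]; [by rewrite (leq_trans sQ)// leq_pred|exact: sS|].
  by rewrite heval_term rE -s2 heval_up ?s2.
have e1 : 'X * Q = \sum_i (r i * (y i).1) *: \prod_(j | j != i) lin (y j).
  apply: vanish => [||i]; last by rewrite heval_term rE -s2 hevalXM ?s2.
    have sX : (size ('X : {poly K}) <= 2)%N by rewrite size_polyX.
    by rewrite mulrC (leq_trans (size_polyM_bound sQ sX))// addn1 s3.
  exact: sS.
split=> //; apply/eqP.
have := subrr ('X * Q); rewrite {1}e2 e1 mulr_sumr -sumrB.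
rewrite (eq_bigr (fun i => r i *: \prod_j lin (y j))); last first.
  by move=> i _; exact: term_lin.
rewrite -scaler_suml => /eqP; rewrite scaler_eq0 => /orP[//|].
move/eqP/eqP; rewrite prodf_seq_eq0 => /hasP[i _].
by rewrite lin_eq0 (negbTE (pt_neq0 _)).
Qed.

Lemma prod_lin_scale (k : 'I_s -> K) y :
  \prod_i lin (k i * (y i).1, k i * (y i).2) = (\prod_i k i) *: \prod_i lin (y i).
Proof.
rewrite -scaler_prod; apply: eq_bigr => i _; exact: lin_scale.
Qed.

(** Together with [prod_lin_scale]: other homogeneous coordinates of the poles multiply Q and P by
    the same factor, so that the residues and the projective point stay the same and a different
    chart may be used at each pole. *)
Lemma pfrac_scale (k : 'I_s -> K) r y :
  pfrac r (fun i => (k i * (y i).1, k i * (y i).2)) = (\prod_i k i) *: pfrac r y.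
Proof.
rewrite /pfrac scaler_sumr; apply: eq_bigr => i _ /=.
under eq_bigr do rewrite lin_scale.
by rewrite scaler_prod !scalerA [in RHS](bigD1 i)//=; congr (_ *: _); ring.
Qed.

End PartialFractions.

Lemma root_poly_exists (C : numClosedFieldType) n (p : {poly C}) : p != 0 ->
  (size p <= n.+1)%N -> exists c : {ffun 'I_n -> sphere C},
  p = lead_coef p *: root_poly c.
Proof.
move=> p0 sp; have [r pr] := closed_field_poly_normal p.
have sr : (size r <= n)%N.
  rewrite -ltnS -(size_prod_XsubC r id) -(@size_scale _ (lead_coef p)) -?pr//.
  by rewrite lead_coef_eq0.
pose g i := oapp (fun z => 'X - z%:P) 1 (nth None [seq Some z | z <- r] i).
(* The default value [None] fills the places beyond the finite roots with infinity. *)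
exists [ffun i : 'I_n => nth None [seq Some z | z <- r] i].
rewrite {1}pr; congr (_ *: _); rewrite /root_poly.
rewrite (eq_bigr (fun i : 'I_n => g i)); last first.
  by move=> i _; rewrite ffunE /g; case: nth.
rewrite -(big_mkord xpredT g) (big_cat_nat (n := size r))//=.
rewrite [X in _ * X]big_nat_cond [X in _ * X]big1 ?mulr1; last first.
  by move=> i /andP[/andP[ri _] _]; rewrite /g nth_default ?size_map.
rewrite (big_nth 0); apply: eq_big_nat => i /andP[_ ir].
by rewrite /g (nth_map 0).
Qed.

(** * Differential calculus *)

Section Calculus.
Context {K : numFieldType} {V : normedModType K}.
Implicit Types (f g : V -> K) (x : V).

Lemma dif_ext (W : normedModType K) (f g : V -> W) x : f =1 g ->
  differentiable f x -> differentiable g x.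
Proof. by move=> /funext ->. Qed.

Lemma dif_mul f g x : differentiable f x -> differentiable g x ->
  differentiable (fun v => f v * g v) x.
Proof. exact: differentiableM. Qed.

Lemma dif_add (W : normedModType K) (f g : V -> W) x :
  differentiable f x -> differentiable g x ->
  differentiable (fun v => f v + g v) x.
Proof. exact: differentiableD. Qed.

Lemma dif_opp (W : normedModType K) (f : V -> W) x :
  differentiable f x -> differentiable (fun v => - f v) x.
Proof. exact: differentiableN. Qed.

Lemma dif_sub (W : normedModType K) (f g : V -> W) x :
  differentiable f x -> differentiable g x ->
  differentiable (fun v => f v - g v) x.
Proof. by move=> df dg; apply: dif_add => //; exact: dif_opp. Qed.

Lemma dif_sum (W : normedModType K) (I : Type) (r : seq I) (P : pred I)
    (f : I -> V -> W) x : (forall i, P i -> differentiable (f i) x) ->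
  differentiable (fun v => \sum_(i <- r | P i) f i v) x.
Proof.
move=> df; elim: r => [|i r IH].
  by apply: dif_ext (differentiable_cst _ _) => v; rewrite big_nil.
have -> : (fun v => \sum_(i <- i :: r | P i) f i v) = (fun v => if P i then
    f i v + \sum_(i <- r | P i) f i v else \sum_(i <- r | P i) f i v).
  by apply/funext => v; rewrite big_cons.
case Pi: (P i) => //.
by apply: dif_add => //; exact: df.
Qed.

Lemma dif_prod (I : Type) (r : seq I) (P : pred I) (f : I -> V -> K) x :
  (forall i, P i -> differentiable (f i) x) ->
  differentiable (fun v => \prod_(i <- r | P i) f i v) x.
Proof.
move=> df; elim: r => [|i r IH].
  by apply: dif_ext (differentiable_cst _ _) => v; rewrite big_nil.
have -> : (fun v => \prod_(i <- i :: r | P i) f i v) = (fun v => if P i then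
    f i v * \prod_(i <- r | P i) f i v else \prod_(i <- r | P i) f i v).
  by apply/funext => v; rewrite big_cons.
case Pi: (P i) => //.
by apply: dif_mul => //; exact: df.
Qed.

Lemma dif_exp f n x : differentiable f x -> differentiable (fun v => f v ^+ n) x.
Proof.
move=> df; elim: n => [|n IH].
  by apply: dif_ext (differentiable_cst _ _) => v; rewrite expr0.
have -> : (fun v => f v ^+ n.+1) = (fun v => f v * f v ^+ n).
  by apply/funext => v; rewrite exprS.
exact: dif_mul.
Qed.

Lemma dif_div f g x : differentiable f x -> differentiable g x -> g x != 0 ->
  differentiable (fun v => f v / g v) x.
Proof. by move=> df dg g0; apply: dif_mul => //; exact: differentiableV. Qed.

Lemma dif_mx m n (f : V -> 'M[K]_(m, n)) x :
  (forall i j, differentiable (fun v => f v i j) x) -> differentiable f x.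
Proof.
move=> df.
have -> : f = (fun v => \sum_i \sum_j f v i j *: delta_mx i j).
  by apply/funext => v; rewrite -matrix_sum_delta.
apply: dif_sum => i _; apply: dif_sum => j _; exact: differentiableZl.
Qed.

Lemma dif_entry m n (f : V -> 'M[K]_(m, n)) i j x : differentiable f x ->
  differentiable (fun v => f v i j) x.
Proof. by move=> df; exact: (differentiable_comp df (differentiable_coord _ _ _)). Qed.

Lemma dif_det n (f : V -> 'M[K]_n) x :
  (forall i j, differentiable (fun v => f v i j) x) ->
  differentiable (fun v => \det (f v)) x.
Proof.
move=> df; apply: dif_sum => s _.
by apply: dif_mul; [exact: differentiable_cst|exact: dif_prod].
Qed.

Lemma near_neq0 f x : differentiable f x -> f x != 0 -> \forall v \near x, f v != 0.
Proof.
move=> /differentiable_continuous cf f0.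
exact: cvgr_neq0 f0.
Qed.

Lemma near_norm_lt f g x : differentiable f x -> differentiable g x ->
  `|f x| < `|g x| -> \forall v \near x, `|f v| < `|g v|.
Proof.
move=> /differentiable_continuous cf /differentiable_continuous cg fg.
pose e := (`|g x| - `|f x|) / 2; have e0 : 0 < e by rewrite divr_gt0 ?subr_gt0.
move/cvgr_dist_lt : cf => /(_ _ e0) cf; move/cvgr_dist_lt : cg => /(_ _ e0) cg.
near=> v.
have fv : `|f x - f v| < e by near: v.
have gv : `|g x - g v| < e by near: v.
have h1 : `|f v| < `|f x| + e.
  by rewrite -ltrBlDl (le_lt_trans (lerB_dist _ _))// distrC.
have h2 : `|g x| < `|g v| + e.
  by rewrite -ltrBlDl (le_lt_trans (lerB_dist _ _)).
rewrite (lt_le_trans h1)// -(lerD2r e) (le_trans _ (ltW h2))//.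
by rewrite /e -addrA -splitr addrC subrK.
Unshelve. all: by end_near. Qed.

(** Near x, A is O(v - x) and k - k x is o(1), so A (k - k x) is o(v - x) and A k has the same
    differential at x as A multiplied by the constant k x. This turns the continuity of the roots
    into their differentiability. *)
Lemma dif_mul_cont (A k : V -> K) x : differentiable A x -> A x = 0 ->
  {for x, continuous k} -> differentiable (fun v => A v * k v) x.
Proof.
move=> dA A0 ck.
have -> : (fun v => A v * k v) = (fun v => A v * k x + A v * (k v - k x)).
  by apply/funext => v; rewrite -mulrDr addrC subrK.
apply: dif_add; first by apply: dif_mul => //; exact: differentiable_cst.
set h := fun v => _.
have [c c0 Ac] := linear_lipschitz (diff_continuous dA).
have hx : h x = 0 by rewrite /h A0 mul0r.
have ho : h \o shift x = cst (h x) + (\0 : V -> K) +o_ 0 id.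
  apply/eqaddoP => e e0.
  (* Here c bounds the differential of A and 1 the remainder, so that A is at most c + 1 times the
     displacement near x. *)
  have ce : 0 < e / (c + 1) by rewrite divr_gt0// addr_gt0.
  have {}ck : \forall y \near (0 : V), `|k x - k (y + x)| < e / (c + 1).
    have : \forall y \near x, `|k x - k y| < e / (c + 1).
      by move/cvgr_dist_lt : ck; exact.
    by rewrite (near_shift 0 x) subr0.
  have /eqaddoP/(_ 1 ltr01) := diff_locally dA => dAo.
  have {}dAo : \forall y \near (0 : V), `|A (y + x) - 'd A x y| <= `|y|.
    near=> y; have -> : A (y + x) - 'd A x y = (A \o shift x - (cst (A x) + 'd A x)) y.
      by rewrite A0 !fctE/= add0r.
    by rewrite -[leRHS]mul1r; near: y.
  near=> y; have -> : (h \o shift x - (cst (h x) + \0)) y = h (y + x).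
    by rewrite hx !fctE/= addr0 subr0.
  have Ay : `|A (y + x)| <= (c + 1) * `|y|.
    rewrite -(subrK ('d A x y) (A (y + x))) (le_trans (ler_normD _ _))//.
    by rewrite addrC mulrDl mul1r lerD//; near: y.
  have c1 : 0 < c + 1 by rewrite addr_gt0.
  have ky : `|k (y + x) - k x| <= e / (c + 1) by rewrite distrC ltW//; near: y.
  rewrite /h normrM (le_trans (ler_pM _ _ Ay ky))//.
  by rewrite [leLHS](_ : _ = e * `|y|)//; field; rewrite gt_eqF.
apply/diff_locallyP.
have -> : 'd h x = (\0 : {linear V -> K}) :> (V -> K).
  by apply: diff_unique => //; exact: cst_continuous.
by split; [exact: cst_continuous|exact: ho].
Unshelve. all: by end_near. Qed.

End Calculus.

(** * Charted spaces *)

Section ChartedTheory.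
Context {K : numFieldType}.
Implicit Types X Y Z : charted K.

Definition covered X := forall x : X, exists2 c, atlas X c & cdom c x.

Lemma charted_openE X (U : set X) : open U = atlas_op U.
Proof. by []. Qed.

Lemma holomorphic_comp X Y Z (f : X -> Y) (g : Y -> Z) : covered Y ->
  holomorphic f -> holomorphic g -> holomorphic (g \o f).
Proof.
move=> covY hf hg c d x Ac Ad cx dx; have [e Ae ex] := covY (f x).
have [F dF nF] := hf _ _ _ Ac Ae cx ex.
have [G dG nG] := hg _ _ _ Ae Ad ex dx.
have [_ Fx] := nbhs_singleton nF _ cx erefl.
exists (G \o F); first by apply: differentiable_comp => //; rewrite -Fx.
have /differentiable_continuous cF := dF.
have nG' : \forall v \near c x, forall y, cdom e y -> e y = F v ->
    cdom d (g y) /\ d (g y) = G (F v).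
  by rewrite Fx in nG; exact: (cF _ nG).
apply: filterS2 nF nG' => v Fv Gv y cy yv; have [ey eyF] := Fv y cy yv.
exact: Gv.
Qed.

Lemma holomorphic_preimage_open X Y (f : X -> Y) (U : set Y) : covered Y ->
  holomorphic f -> open U -> open (f @^-1` U).
Proof.
move=> covY hf; rewrite !charted_openE => oU c x Ac cx Ux.
have [d Ad dx] := covY (f x).
have [F dF nF] := hf _ _ _ Ac Ad cx dx.
have [_ Fx] := nbhs_singleton nF _ cx erefl.
have /differentiable_continuous cF := dF.
have nU : \forall v \near c x, forall y, cdom d y -> d y = F v -> U y.
  by have := oU _ _ Ad dx Ux; rewrite Fx => nU; exact: (cF _ nU).
apply: filterS2 nF nU => v Fv Uv y cy yv; have [dy dyF] := Fv y cy yv.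
exact: (Uv (f y)).
Qed.

(** Read in another chart, c becomes a transition map, which is defined on an open set and
    continuous; hence c is continuous for the atlas topology. *)
Lemma chart_preimage_open X (c : chart X (model X)) (W : set (model X)) :
  holomorphic (@id X) -> atlas X c -> open W ->
  open [set x : X | cdom c x /\ W (c x)].
Proof.
move=> hid Ac oW; rewrite charted_openE => d x Ad dx [cx Wx].
have [G dG nG] := hid _ _ _ Ad Ac dx cx.
have [_ Gx] := nbhs_singleton nG _ dx erefl.
have /differentiable_continuous cG := dG.
have nW : \forall v \near d x, W (G v).
  have : nbhs (c x) W by apply: open_nbhs_nbhs; split.
  by rewrite Gx => nW; exact: (cG _ nW).
apply: filterS2 nG nW => v Gv Wv y dy yv; have [cy cyG] := Gv y dy yv.
by split=> //; rewrite cyG.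
Qed.

Lemma chart_image_open X (c : chart X (model X)) (U : set X) :
  atlas X c -> open (c @` cdom c) -> open U -> U `<=` cdom c -> open (c @` U).
Proof.
move=> Ac oc oU Uc; rewrite openE => _ [x Ux <-]; rewrite /interior.
have cx := Uc _ Ux.
have nc : \forall v \near c x, (c @` cdom c) v.
  by apply: open_nbhs_nbhs; split => //; exists x.
move: oU; rewrite charted_openE => /(_ c x Ac cx Ux) nU.
apply: filterS2 nc nU => v [y cy yv] Uv.
by exists y => //; exact: Uv.
Qed.

Lemma biholomorphic_sym X Y : biholomorphic X Y -> biholomorphic Y X.
Proof. by move=> [f [g [fK gK hf hg]]]; exists g, f. Qed.

Lemma biholomorphic_trans X Y Z : covered X -> covered Y -> covered Z ->
  biholomorphic X Y -> biholomorphic Y Z -> biholomorphic X Z.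
Proof.
move=> cX cY cZ [f [g [fK gK hf hg]]] [f' [g' [fK' gK' hf' hg']]].
exists (f' \o f), (g \o g'); split; first exact: can_comp.
- exact: can_comp.
- exact: holomorphic_comp.
- exact: holomorphic_comp.
Qed.

(** The preimages of a countable base of the model under countably many charts form a countable
    base. *)
Lemma second_countable_atlas X : countable (atlas X) ->
  @second_countable (model X) -> covered X ->
  holomorphic (@id X) -> @second_countable X.
Proof.
move=> cA [B cB [Bo Bb]] cov hid.
exists [set U | exists c b, [/\ atlas X c, B b &
  U = [set x : X | cdom c x /\ b (c x)]]].
  rewrite (_ : [set U | _] = (fun cb : chart X (model X) * set (model X) =>
    [set x : X | cdom cb.1 x /\ cb.2 (cb.1 x)]) @` (atlas X `*` B)).
    exact: sub_countable (card_image_le _ _) (countableX cA cB).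
  apply/seteqP; split=> [U [c [b [Ac Bb' ->]]]|U [[c b] [/= Ac Bb'] <-]].
    by exists (c, b).
  by exists c, b.
split=> [U [c [b [Ac Bb' ->]]]|x].
  by apply: chart_preimage_open => //; exact: Bo.
move=> U /nbhs_interior; rewrite nbhsE => -[V [oV Vx] VU].
have [c Ac cx] := cov x.
move: oV; rewrite charted_openE => /(_ c x Ac cx Vx) nV.
have [b [Bb' bx] bV] := Bb (c x) _ nV.
exists [set y : X | cdom c y /\ b (c y)] => /=.
  by split=> //; exists c, b.
move=> y [cy bcy]; apply: (interior_subset (A := U)); apply: VU.
exact: (bV _ bcy).
Qed.

(* Hausdorffness, second countability and the compatibility of the charts are
   transported; the remaining axioms concern each single chart. *)
Lemma complex_manifold_biholomorphic X Y : complex_manifold X ->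
  biholomorphic X Y -> covered Y ->
  (forall c : chart Y (model Y), atlas Y c -> set_inj (cdom c) c) ->
  (forall c : chart Y (model Y), atlas Y c -> open (c @` cdom c)) ->
  complex_manifold Y.
Proof.
move=> [[hX [B cB [Bo Bb]]] covX _ _ _] [f [g [fK gK hf hg]]] covY injY oY.
split=> //; last first.
  have -> : @id Y = f \o g by apply/funext => y /=; rewrite gK.
  exact: holomorphic_comp.
split.
  move: hX; rewrite !open_hausdorff => hX x y xy.
  have /hX[[U V]/= [Ux Vy] [oU oV UV]] : g x != g y.
    by apply: contra_neq xy => /(can_inj gK).
  rewrite !inE in Ux Vy; exists (g @^-1` U, g @^-1` V) => /=; first by rewrite !inE.
  split; [exact: holomorphic_preimage_open|exact: holomorphic_preimage_open|].
  apply/eqP/seteqP; split=> // z [/= Uz Vz].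
  by move/eqP/seteqP : UV => [UV _]; apply: (UV (g z)).
exists [set g @^-1` U | U in B]; first exact: sub_countable (card_image_le _ _) cB.
split=> [_ [U BU <-]|y U].
  by apply: holomorphic_preimage_open => //; exact: Bo.
rewrite nbhsE => -[V [oV Vy] VU].
have oV' : open (f @^-1` V) by exact: holomorphic_preimage_open.
have [|b [Bb' bx] bV] := Bb (g y) (f @^-1` V).
  by apply: open_nbhs_nbhs; split => //=; rewrite gK.
exists (g @^-1` b) => /=; first by split=> //; exists b.
by move=> z bz; apply: VU; rewrite -(gK z); exact: bV.
Qed.

Lemma biholomorphic_bij X Y (f : X -> Y) : holomorphic f -> injective f ->
  (forall y, exists x, f x = y) ->
  (forall g : Y -> X, cancel g f -> holomorphic g) -> biholomorphic X Y.
Proof.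
move=> hf fi fs hg; have [g gK] := choice fs.
by exists f, g; split=> // [x|]; [apply: fi; rewrite gK|exact: hg].
Qed.

End ChartedTheory.

(** * Polynomials with differentiable coefficients *)

Section PolynomialCalculus.
Context {K : numFieldType} {V : normedModType K}.
Implicit Types (p q : V -> {poly K}) (x : V).

(** Coefficientwise, so that no bound on the degree has to be carried along. *)
Definition pdif p x := forall k, differentiable (fun v => (p v)`_k) x.

Lemma pdif_cst (p : {poly K}) x : pdif (fun=> p) x.
Proof. by move=> k; exact: differentiable_cst. Qed.

Lemma pdif_add p q x : pdif p x -> pdif q x -> pdif (fun v => p v + q v) x.
Proof.
move=> dp dq k; apply: (dif_ext (f := fun v => (p v)`_k + (q v)`_k)).
  by move=> v; rewrite coefD.
exact: dif_add.
Qed.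

Lemma pdif_mul p q x : pdif p x -> pdif q x -> pdif (fun v => p v * q v) x.
Proof.
move=> dp dq k.
apply: (dif_ext (f := fun v => \sum_(j < k.+1) (p v)`_j * (q v)`_(k - j))).
  by move=> v; rewrite coefM.
by apply: dif_sum => i _; exact: dif_mul.
Qed.

Lemma pdif_scale (f : V -> K) p x : differentiable f x -> pdif p x ->
  pdif (fun v => f v *: p v) x.
Proof.
move=> df dp k; apply: (dif_ext (f := fun v => f v * (p v)`_k)).
  by move=> v; rewrite coefZ.
exact: dif_mul.
Qed.

Lemma pdif_C (f : V -> K) x : differentiable f x -> pdif (fun v => (f v)%:P) x.
Proof.
move=> df k; apply: (dif_ext (f := fun v => if k == 0%N then f v else 0)).
  by move=> v; rewrite coefC.
by case: eqP => _ //; exact: differentiable_cst.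
Qed.

Lemma pdif_sum (I : Type) (r : seq I) (P : pred I) (f : I -> V -> {poly K}) x :
  (forall i, P i -> pdif (f i) x) -> pdif (fun v => \sum_(i <- r | P i) f i v) x.
Proof.
move=> df k; apply: (dif_ext (f := fun v => \sum_(i <- r | P i) (f i v)`_k)).
  by move=> v; rewrite coef_sum.
by apply: dif_sum => i Pi; exact: df.
Qed.

Lemma pdif_prod (I : Type) (r : seq I) (P : pred I) (f : I -> V -> {poly K}) x :
  (forall i, P i -> pdif (f i) x) -> pdif (fun v => \prod_(i <- r | P i) f i v) x.
Proof.
move=> df; elim: r => [|i r IH] k.
  apply: (dif_ext (f := fun=> (1 : {poly K})`_k)); last exact: differentiable_cst.
  by move=> v; rewrite big_nil.
apply: (dif_ext (f := fun v => (if P i then f i v * \prod_(i <- r | P i) f i v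
   else \prod_(i <- r | P i) f i v)`_k)); first by move=> v; rewrite big_cons.
case Pi: (P i) => //.
by apply: pdif_mul => //; exact: df.
Qed.

Lemma pdif_lin (a b : V -> K) x : differentiable a x -> differentiable b x ->
  pdif (fun v => lin (a v, b v)) x.
Proof.
move=> da db; apply: pdif_add => [|k]; first exact: pdif_scale (pdif_cst _ _).
apply: (dif_ext (f := fun v => - (a v)%:P`_k)); first by move=> v; rewrite coefN.
by apply: dif_opp; exact: pdif_C.
Qed.

Lemma pdif_deriv p x : pdif p x -> pdif (fun v => (p v)^`()) x.
Proof.
move=> dp k; apply: (dif_ext (f := fun v => (p v)`_k.+1 * (k.+1)%:R)).
  by move=> v; rewrite coef_deriv mulr_natr.
by apply: dif_mul => //; exact: differentiable_cst.
Qed.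

Lemma pdif_rVpoly d (f : V -> 'rV[K]_d) x : differentiable f x ->
  pdif (fun v => rVpoly (f v)) x.
Proof.
move=> df k; case ki: (insub k : option 'I_d) => [i|].
  apply: (dif_ext (f := fun v => f v 0 i)); last exact: dif_entry.
  by move=> v; rewrite coef_rVpoly ki.
apply: (dif_ext (f := fun=> 0)); last exact: differentiable_cst.
by move=> v; rewrite coef_rVpoly ki.
Qed.

Lemma dif_poly_rV d p x : pdif p x ->
  differentiable (fun v => poly_rV (p v) : 'rV_d) x.
Proof.
move=> dp; apply: dif_mx => i j.
by apply: (dif_ext (f := fun v => (p v)`_j)) => // v; rewrite mxE.
Qed.

Lemma dif_row_mx m n1 n2 (f : V -> 'M[K]_(m, n1)) (g : V -> 'M[K]_(m, n2)) x :
  differentiable f x -> differentiable g x ->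
  differentiable (fun v => row_mx (f v) (g v)) x.
Proof.
move=> df dg; apply: dif_mx => i j; rewrite -(splitK j).
case: (fintype.split j) => k /=.
  by apply: (dif_ext (f := fun v => f v i k)) => [v|];
    [rewrite row_mxEl|exact: dif_entry].
by apply: (dif_ext (f := fun v => g v i k)) => [v|];
  [rewrite row_mxEr|exact: dif_entry].
Qed.

Lemma dif_lsubmx m n1 n2 (f : V -> 'M[K]_(m, n1 + n2)) x :
  differentiable f x -> differentiable (fun v => lsubmx (f v)) x.
Proof.
move=> df; apply: dif_mx => i j.
apply: (dif_ext (f := fun v => f v i (lshift n2 j))); last exact: dif_entry.
by move=> v; rewrite mxE.
Qed.

Lemma dif_rsubmx m n1 n2 (f : V -> 'M[K]_(m, n1 + n2)) x :
  differentiable f x -> differentiable (fun v => rsubmx (f v)) x.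
Proof.
move=> df; apply: dif_mx => i j.
apply: (dif_ext (f := fun v => f v i (rshift n1 j))); last exact: dif_entry.
by move=> v; rewrite mxE.
Qed.

Lemma dif_affine_chart m (f : V -> 'rV[K]_m) i x :
  differentiable f x -> f x 0 i != 0 ->
  differentiable (fun v => col' i ((f v 0 i)^-1 *: f v)) x.
Proof.
move=> df fi; apply: dif_mx => a j.
apply: (dif_ext (f := fun v => f v 0 (lift i j) / f v 0 i)) => [v|].
  by rewrite !mxE ord1 mulrC.
by apply: dif_div => //; exact: dif_entry.
Qed.

Lemma dif_heval n p (a b : V -> K) x : pdif p x -> differentiable a x ->
  differentiable b x -> differentiable (fun v => heval n (p v) (a v, b v)) x.
Proof.
move=> dp da db; apply: dif_sum => i _; apply: dif_mul; last exact: dif_exp.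
by apply: dif_mul; [exact: dp|exact: dif_exp].
Qed.

Lemma dif_horner n p z x : (forall v, (size (p v) <= n)%N) -> pdif p x ->
  differentiable (fun v => (p v).[z]) x.
Proof.
move=> sp dp; apply: (dif_ext (f := fun v => \sum_(i < n) (p v)`_i * z ^+ i)).
  by move=> v; rewrite -horner_coef_wide.
by apply: dif_sum => i _; apply: dif_mul => //; exact: differentiable_cst.
Qed.

Lemma dif_formal_resultant m n p q x : pdif p x -> pdif q x ->
  differentiable (fun v => formal_resultant m n (p v) (q v)) x.
Proof.
move=> dp dq; apply: dif_det => i j; rewrite -(splitK i).
case: (fintype.split i) => k /=.
  apply: (dif_ext (f := fun v => (p v * 'X^k)`_j)) => [v|].
    by rewrite col_mxEu mxE.
  by apply: pdif_mul => //; exact: pdif_cst.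
apply: (dif_ext (f := fun v => (q v * 'X^k)`_j)) => [v|].
  by rewrite col_mxEd mxE.
by apply: pdif_mul => //; exact: pdif_cst.
Qed.

Lemma dif_formal_discr d p x : pdif p x ->
  differentiable (fun v => formal_discr d (p v)) x.
Proof.
move=> dp; apply: dif_det => i j; rewrite -(splitK i).
case: (fintype.split i) => k /=.
  apply: (dif_ext (f := fun v => if j == (d.-1 + d).-1 :> nat
      then (k == d.-2 :> nat)%:R else (p v * 'X^k)`_j)) => [v|].
    by rewrite col_mxEu mxE.
  case: (_ == _); first exact: differentiable_cst.
  by apply: pdif_mul => //; exact: pdif_cst.
apply: (dif_ext (f := fun v => if j == (d.-1 + d).-1 :> nat
    then (k == d.-1 :> nat)%:R *+ d else ((p v)^`() * 'X^k)`_j)) => [v|].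
  by rewrite col_mxEd mxE.
case: (_ == _); first exact: differentiable_cst.
by apply: pdif_mul; [exact: pdif_deriv|exact: pdif_cst].
Qed.

End PolynomialCalculus.

(** * Affine charts of the projective space *)

Section ProjectiveSpace.
Context {K : numFieldType} {m : nat}.
Implicit Types (x y : Proj K m).

Lemma hcoord_neq0 x : hcoord x != 0.
Proof. exact: (valP (repr x)). Qed.

Lemma hcoord_pt (v : 'rV[K]_m) (v0 : v != 0) :
  exists2 k, k != 0 & hcoord (Proj_pt v0) = k *: v.
Proof.
have /eqmodP/= : (Sub v v0 : @hvec K m) = repr (Proj_pt v0) %[mod {eq_quot @hvec_equiv K m}].
  by rewrite reprK.
by move=> /asboolP[k k0 e]; exists k.
Qed.

Lemma Proj_eq x y k : k != 0 -> hcoord y = k *: hcoord x -> x = y.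
Proof.
move=> k0 e; rewrite -[x]reprK -[y]reprK; apply/eqmodP/asboolP.
by exists k.
Qed.

(* The inverse of [Proj_chart i]. *)
Definition affine_lift (i : 'I_m) (v : 'rV[K]_m.-1) : 'rV[K]_m :=
  \row_j (if unlift i j is Some k then v 0 k else 1).

Lemma affine_lift_i i v : affine_lift i v 0 i = 1.
Proof. by rewrite mxE unlift_none. Qed.

Lemma dif_affine_lift i v : differentiable (affine_lift i) v.
Proof.
apply: dif_mx => a j; case ij: (unlift i j) => [k|]; last first.
  apply: (dif_ext (f := fun _ : 'rV[K]_m.-1 => 1 : K)); last exact: differentiable_cst.
  by move=> w; rewrite mxE ij.
apply: (dif_ext (f := fun w : 'rV[K]_m.-1 => w 0 k : K)) => [w|]; first by rewrite mxE ij.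
exact: differentiable_coord.
Qed.

Lemma affine_liftK (i : 'I_m) (v : 'rV[K]_m) : v 0 i != 0 ->
  v = v 0 i *: affine_lift i (col' i ((v 0 i)^-1 *: v)).
Proof.
move=> vi; apply/rowP => j; rewrite !mxE; case: unliftP => [k ->|->].
  by rewrite !mxE mulrA divff// mul1r.
by rewrite mulr1.
Qed.

Lemma col'_affine_lift i v k : k != 0 ->
  col' i ((k * affine_lift i v 0 i)^-1 *: (k *: affine_lift i v)) = v.
Proof.
move=> k0; rewrite affine_lift_i mulr1 scalerA mulVf// scale1r.
by apply/rowP => j; rewrite !mxE liftK.
Qed.

End ProjectiveSpace.

(** * The three spaces *)

Section CoefficientManifold.
Context {C : numClosedFieldType} {s : nat}.
Hypothesis s_ge2 : (2 <= s)%N.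
Local Notation N := (s.-2.+1 + s.+1)%N.
Implicit Types (Q P : {poly C}).

Definition numer_row (v : 'rV[C]_N) := rVpoly (lsubmx v).
Definition denom_row (v : 'rV[C]_N) := rVpoly (rsubmx v).

Definition simple_row (v : 'rV[C]_N) :=
  formal_resultant s s.-2 (denom_row v) (numer_row v) != 0 /\
  formal_discr s (denom_row v) != 0.

(* The coordinates of the form (Q / P) dz. *)
Definition form_row (Q P : {poly C}) : 'rV[C]_N := row_mx (poly_rV Q) (poly_rV P).

Lemma numer_form_row Q P : (size Q <= s.-1)%N -> numer_row (form_row Q P) = Q.
Proof. by move=> sQ; rewrite /numer_row row_mxKl poly_rV_K// prednK//; lia. Qed.

Lemma denom_form_row Q P : (size P <= s.+1)%N -> denom_row (form_row Q P) = P.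
Proof. by move=> sP; rewrite /denom_row row_mxKr poly_rV_K. Qed.

Lemma form_rowK v : form_row (numer_row v) (denom_row v) = v.
Proof. by rewrite /form_row !rVpolyK hsubmxK. Qed.

Lemma form_rowZ k Q P : form_row (k *: Q) (k *: P) = k *: form_row Q P.
Proof. by rewrite /form_row !linearZ/= scale_row_mx. Qed.

Lemma numer_rowZ k v : numer_row (k *: v) = k *: numer_row v.
Proof. by rewrite /numer_row !linearZ. Qed.

Lemma denom_rowZ k v : denom_row (k *: v) = k *: denom_row v.
Proof. by rewrite /denom_row !linearZ. Qed.

Lemma size_numer_row v : (size (numer_row v) <= s.-1)%N.
Proof. by rewrite (leq_trans (size_rVpoly _))// prednK//; lia. Qed.

Lemma size_denom_row v : (size (denom_row v) <= s.+1)%N.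
Proof. exact: size_rVpoly. Qed.

(** The two determinants exclude P = 0 and Q = 0, so both forms split over the algebraically closed
    field and [simple_poles_condP] applies to their zeros. *)
Lemma simple_rowP v : simple_row v <->
  exists k l (p : {ffun 'I_s -> sphere C}) (c : {ffun 'I_s.-2 -> sphere C}),
    [/\ k != 0, l != 0, injective p /\ (forall j i, c j <> p i),
        denom_row v = k *: root_poly p & numer_row v = l *: root_poly c].
Proof.
split=> [[res disc]|[k [l [p [c [k0 l0 pc dv nv]]]]]]; last first.
  by rewrite /simple_row dv nv; exact/simple_poles_condP.
have P0 : denom_row v != 0.
  by apply: contraNneq disc => ->; exact: formal_discr0.
have Q0 : numer_row v != 0.
  apply: contraNneq res => ->; apply: formal_resultant0; first exact: ltnW.
  exact: size_denom_row.
have [p Pp] := root_poly_exists P0 (size_denom_row v).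
have [c Qc] : exists c : {ffun 'I_s.-2 -> sphere C},
    numer_row v = lead_coef (numer_row v) *: root_poly c.
  by apply: root_poly_exists => //; rewrite (leq_trans (size_numer_row v))//; lia.
exists (lead_coef (denom_row v)), (lead_coef (numer_row v)), p, c.
rewrite !lead_coef_eq0; split=> //.
apply/(@simple_poles_condP _ _ (lead_coef (denom_row v)) (lead_coef (numer_row v))) => //.
- by rewrite lead_coef_eq0.
- by rewrite lead_coef_eq0.
- by rewrite -Pp -Qc.
Qed.

Lemma simple_rowZ k v : k != 0 -> simple_row v -> simple_row (k *: v).
Proof.
move=> k0 /simple_rowP[a [b [p [c [a0 b0 pc dv nv]]]]]; apply/simple_rowP.
exists (k * a), (k * b), p, c.
by rewrite !mulf_neq0// denom_rowZ numer_rowZ dv nv !scalerA.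
Qed.

Lemma simple_row_neq0 v : simple_row v -> v != 0.
Proof.
move=> [_]; apply: contraNneq => ->.
by rewrite /denom_row !linear0; exact: formal_discr0.
Qed.

(** The representative is picked by [repr] without any continuity; only the line spanned by this row
    is meaningful. *)
Definition coef_row (x : Omega_coef C s) : 'rV[C]_N := hcoord (set_val x).

Lemma simple_coef_row x : simple_row (coef_row x).
Proof. exact: (set_valP x). Qed.

Lemma coef_row_inj x y k : k != 0 -> coef_row y = k *: coef_row x -> x = y.
Proof. by move=> k0 e; apply: val_inj; exact: (Proj_eq k0 e). Qed.

Lemma coef_point v : simple_row v ->
  exists x : Omega_coef C s, exists2 k, k != 0 & coef_row x = k *: v.
Proof.
move=> sv; have v0 := simple_row_neq0 sv.
have [k k0 e] := hcoord_pt v0.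
have sx : simple_row (hcoord (Proj_pt v0)) by rewrite e; exact: simple_rowZ.
by exists (exist _ (Proj_pt v0) (mem_set sx)), k.
Qed.

Definition coef_chart (i : 'I_N) : chart (Omega_coef C s) 'rV[C]_N.-1 :=
  Chart (set_val @^-1` cdom (Proj_chart i)) (Proj_chart i \o set_val).

Lemma atlas_coefP c : atlas (Omega_coef C s) c <-> exists i, c = coef_chart i.
Proof.
split=> [[_ [i _ <-] <-]|[i ->]]; first by exists i.
by exists (Proj_chart i); first exists i.
Qed.

Lemma coef_chartE i (x : Omega_coef C s) : cdom (coef_chart i) x ->
  coef_row x = coef_row x 0 i *: affine_lift i (coef_chart i x).
Proof. exact: affine_liftK. Qed.

Lemma coef_chart_val i (x : Omega_coef C s) k (w : 'rV[C]_N.-1) : k != 0 ->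
  coef_row x = k *: affine_lift i w -> cdom (coef_chart i) x /\ coef_chart i x = w.
Proof.
rewrite /coef_row => k0 e; split=> /=.
  by rewrite /= e mxE affine_lift_i mulr1.
by rewrite e mxE col'_affine_lift.
Qed.

Lemma covered_coef : covered (Omega_coef C s).
Proof.
move=> x; have /rV0Pn[i xi] : coef_row x != 0 by exact: hcoord_neq0.
by exists (coef_chart i) => //; apply/atlas_coefP; exists i.
Qed.

(** A local differentiable lift h to homogeneous coordinates is enough. The factor k may vary
    arbitrarily with y, since the affine chart divides by the coordinate i. *)
Lemma holomorphic_to_coef (X : charted C) (f : X -> Omega_coef C s) :
  (forall c x, atlas X c -> cdom c x ->
    exists2 h : model X -> 'rV[C]_N, differentiable h (c x) &
      \forall v \near c x, forall y, cdom c y -> c y = v ->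
        exists2 k, k != 0 & coef_row (f y) = k *: h v) ->
  holomorphic f.
Proof.
move=> hf c _ x Ac /atlas_coefP[i ->] cx dx; have [h dh nh] := hf c x Ac cx.
have hi0 : h (c x) 0 i != 0.
  have [k k0 e] := nbhs_singleton nh _ cx erefl.
  by move: dx; rewrite /= -/(coef_row _) e mxE mulf_eq0 negb_or => /andP[].
have dhi j : differentiable (fun v => h v 0 j) (c x) by exact: dif_entry.
exists (fun v => col' i ((h v 0 i)^-1 *: h v)).
  exact: dif_affine_chart.
apply: filterS2 nh (near_neq0 (dhi i) hi0) => v hv hvi y cy yv.
have [k k0 e] := hv y cy yv; have := affine_liftK hvi; set w := col' _ _ => hE.
by apply: (coef_chart_val (k := k * h v 0 i)); rewrite ?mulf_neq0// e {1}hE scalerA.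
Qed.

Lemma holomorphic_coef_id : holomorphic (@id (Omega_coef C s)).
Proof.
apply: holomorphic_to_coef => _ x /atlas_coefP[i ->] cx.
exists (affine_lift i); first exact: dif_affine_lift.
near=> v => y cy <-; exists (coef_row y 0 i) => //; exact: coef_chartE.
Unshelve. all: by end_near. Qed.

Lemma near_simple_row (V : normedModType C) (f : V -> 'rV[C]_N) x :
  differentiable f x -> simple_row (f x) -> \forall v \near x, simple_row (f v).
Proof.
move=> df [res disc].
have dP : pdif (fun v => denom_row (f v)) x by apply: pdif_rVpoly; exact: dif_rsubmx.
have dQ : pdif (fun v => numer_row (f v)) x by apply: pdif_rVpoly; exact: dif_lsubmx.
by apply: filterS2 (near_neq0 (dif_formal_resultant s s.-2 dP dQ) res)
                   (near_neq0 (dif_formal_discr s dP) disc).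
Qed.

Lemma set_inj_coef_chart i : set_inj (cdom (coef_chart i)) (coef_chart i).
Proof.
move=> x y /set_mem cx /set_mem cy e.
have xi : coef_row x 0 i != 0 by []. have yi : coef_row y 0 i != 0 by [].
apply: (coef_row_inj (k := coef_row y 0 i / coef_row x 0 i)).
  by rewrite mulf_neq0// invr_eq0.
rewrite [LHS](coef_chartE cy) -e -scalerA; congr (_ *: _).
by rewrite [X in _ = _ *: X](coef_chartE cx) scalerK.
Qed.

Lemma coef_chart_open i : open (coef_chart i @` cdom (coef_chart i)).
Proof.
rewrite openE => _ [x cx <-]; rewrite /interior.
have sx : simple_row (affine_lift i (coef_chart i x)).
  have xi : coef_row x 0 i != 0 by [].
  rewrite -[affine_lift _ _](scalerK xi) -coef_chartE//.
  by apply: simple_rowZ; rewrite ?invr_eq0//; exact: simple_coef_row.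
apply: filterS (near_simple_row (@dif_affine_lift _ _ i _) sx) => v sv.
have [y [k k0 e]] := coef_point sv; have [cy yv] := coef_chart_val k0 e.
by exists y.
Qed.

(** Points with a common non-zero coordinate lie in one chart. Otherwise there are i and j with x_i
    and y_j non-zero and x_j = y_i = 0, and the scale-invariant open conditions |z_j| < |z_i| and
    |z_i| < |z_j| separate them. *)
Lemma hausdorff_coef : @hausdorff_space (Omega_coef C s).
Proof.
have opn i j : @open (Omega_coef C s)
    [set x | `|coef_row x 0 i| < `|coef_row x 0 j|].
  rewrite charted_openE => _ x /atlas_coefP[k ->] cx /= xij.
  have sc (y : Omega_coef C s) : cdom (coef_chart k) y ->
    (`|coef_row y 0 i| < `|coef_row y 0 j|) =
    (`|affine_lift k (coef_chart k y) 0 i| < `|affine_lift k (coef_chart k y) 0 j|).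
    move=> cy; have e j' : coef_row y 0 j' =
        coef_row y 0 k * affine_lift k (coef_chart k y) 0 j'.
      by rewrite {1}(coef_chartE cy) mxE.
    by rewrite (e i) (e j) !normrM ltr_pM2l ?normr_gt0.
  rewrite sc// in xij.
  have dl j' : differentiable (fun v => affine_lift k v 0 j') (coef_chart k x).
    by apply: dif_entry; exact: dif_affine_lift.
  apply: filterS (near_norm_lt (dl i) (dl j) xij) => v vij y cy yv.
  by move: vij; rewrite -yv -sc.
rewrite open_hausdorff => x y xy.
have [[i /andP[xi yi]]|nij] :=
    pselect (exists i, (coef_row x 0 i != 0) && (coef_row y 0 i != 0)).
  pose c := coef_chart i; have Ac : atlas (Omega_coef C s) c by apply/atlas_coefP; exists i.
  have := @norm_hausdorff _ 'rV[C]_N.-1; rewrite open_hausdorff => /(_ (c x) (c y)).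
  case=> [|[U V] /= [Ux Vy] [oU oV UV]].
    by apply: contra_neq xy => /set_inj_coef_chart; apply; rewrite inE.
  exists ([set z : Omega_coef C s | cdom c z /\ U (c z)],
          [set z : Omega_coef C s | cdom c z /\ V (c z)]) => /=.
    by rewrite !inE/=; rewrite !inE in Ux Vy.
  split; [| |apply/eqP/seteqP; split=> // z [[_ Uz] [_ Vz]]].
  - exact: (@chart_preimage_open _ (Omega_coef C s) c U holomorphic_coef_id Ac oU).
  - exact: (@chart_preimage_open _ (Omega_coef C s) c V holomorphic_coef_id Ac oV).
  by move/eqP/seteqP : UV => [UV _]; apply: (UV (c z)).
have /rV0Pn[i xi] : coef_row x != 0 by exact: hcoord_neq0.
have /rV0Pn[j yj] : coef_row y != 0 by exact: hcoord_neq0.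
have yi : coef_row y 0 i = 0.
  by apply/eqP; apply/negPn/negP => yi; apply: nij; exists i; rewrite xi.
have xj : coef_row x 0 j = 0.
  by apply/eqP; apply/negPn/negP => xj; apply: nij; exists j; rewrite xj.
exists ([set z | `|coef_row z 0 j| < `|coef_row z 0 i|],
        [set z | `|coef_row z 0 i| < `|coef_row z 0 j|]) => /=.
  by rewrite !inE/= xj yi normr0 !normr_gt0.
split; [exact: opn|exact: opn|].
apply/eqP/seteqP; split=> // z [/= h1 h2].
by have := lt_trans h1 h2; rewrite ltxx.
Qed.

Lemma complex_manifold_coef : @second_countable 'rV[C]_N.-1 ->
  complex_manifold (Omega_coef C s).
Proof.
move=> sc; split; last exact: holomorphic_coef_id.
- split; first exact: hausdorff_coef.
  apply: second_countable_atlas => //.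
  + rewrite (_ : atlas _ = range coef_chart).
      by apply: sub_countable (card_image_le _ _) _; exact: countableP.
    apply/seteqP; split=> [c /atlas_coefP[i ->]|_ [i _ <-]]; first by exists i.
    by apply/atlas_coefP; exists i.
  + exact: covered_coef.
  + exact: holomorphic_coef_id.
- exact: covered_coef.
- by move=> _ /atlas_coefP[i ->]; exact: set_inj_coef_chart.
- by move=> _ /atlas_coefP[i ->]; exact: coef_chart_open.
Qed.

End CoefficientManifold.

Section PairCalculus.
Context {K : numFieldType} {V W : normedModType K}.

Lemma dif_fst (x : V * W) : differentiable (fun v : V * W => v.1) x.
Proof.
have := @linear_differentiable _ _ _ (fst : {linear (V * W)%type -> V}) x.
by apply => y; exact: cvg_fst.
Qed.

Lemma dif_snd (x : V * W) : differentiable (fun v : V * W => v.2) x.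
Proof.
have := @linear_differentiable _ _ _ (snd : {linear (V * W)%type -> W}) x.
by apply => y; exact: cvg_snd.
Qed.

End PairCalculus.

Lemma Proj_chart_val (K : numFieldType) m (i : 'I_m) (x : Proj K m) k
    (w : 'rV[K]_m.-1) : k != 0 -> hcoord x = k *: affine_lift i w ->
  cdom (Proj_chart i) x /\ Proj_chart i x = w.
Proof.
move=> k0 e; split; first by rewrite /= e mxE affine_lift_i mulr1.
by rewrite /= e mxE col'_affine_lift.
Qed.

(** * The bundle over zeros and poles *)

Section ZerosPoles.
Context {C : numClosedFieldType} {s : nat}.
Hypothesis s_ge2 : (2 <= s)%N.
Local Notation N := (s.-2.+1 + s.+1)%N.
Local Notation ZP := (Omega_zp C s).
Implicit Types (q : ZP) (u : Ms C s).

Lemma members_pi (T : choiceType) n (f : {ffun 'I_n -> T}) :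
  exists t, members (\pi_(Defs.Sym T n) f) = permute t f.
Proof.
have /eqmodP/= : f = members (\pi_(Defs.Sym T n) f) %[mod Defs.Sym T n] by rewrite reprK.
by move=> /existsP[t /eqP]; exists t.
Qed.

Lemma members_eq n (x y : Defs.Sym (sphere C) n) :
  root_poly (members x) = root_poly (members y) -> x = y.
Proof.
move=> /root_poly_inj[t xy]; rewrite -[x]reprK -[y]reprK; apply/eqmodP => /=.
by apply/existsP; exists t; rewrite -/(members y) xy.
Qed.

Lemma Ms_eq u u' : numer u = numer u' -> denom u = denom u' -> u = u'.
Proof.
move=> /members_eq e1 /members_eq e2; apply: val_inj.
by rewrite [val u]surjective_pairing e1 e2 -surjective_pairing.
Qed.

Lemma Ms_point (p : {ffun 'I_s -> sphere C}) (c : {ffun 'I_s.-2 -> sphere C}) :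
  injective p -> (forall j i, c j <> p i) ->
  exists u : Ms C s, numer u = root_poly c /\ denom u = root_poly p.
Proof.
move=> pi cp; have [t1 e1] := members_pi c; have [t2 e2] := members_pi p.
have zp : zeros_poles (\pi_(Defs.Sym (sphere C) s.-2) c, \pi_(Defs.Sym (sphere C) s) p).
  split=> /= [i j|j i]; rewrite ?e1 e2 !ffunE; last exact: cp.
  by move=> /pi /perm_inj.
exists (SigSub (mem_set zp)); rewrite /numer /denom /= e1 e2.
by rewrite !root_poly_permute.
Qed.

Lemma numer_monic u : numer u \is monic. Proof. exact: root_poly_monic. Qed.
Lemma denom_monic u : denom u \is monic. Proof. exact: root_poly_monic. Qed.

Lemma size_numer u : (size (numer u) <= s.-1)%N.
Proof.
have -> : s.-1 = s.-2.+1 by rewrite prednK//; lia.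
exact: size_root_poly.
Qed.

Lemma size_denom u : (size (denom u) <= s.+1)%N.
Proof. exact: size_root_poly. Qed.

Definition zp_base q : Ms C s := (val (repr q)).1.2.

(* q is the form zp_mult q * (numer / denom) dz. *)
Definition zp_mult q : C :=
  (val (repr q)).2 * ((denom (zp_base q)).[idx C (val (repr q)).1.1] /
                      (numer (zp_base q)).[idx C (val (repr q)).1.1]).

Lemma zp_reprP q : Ua (val (repr q)).1.1 (zp_base q) /\ (val (repr q)).2 != 0.
Proof. exact: (set_valP (repr q)). Qed.

Lemma zp_mult_neq0 q : zp_mult q != 0.
Proof.
by have [[n0 d0] l0] := zp_reprP q; rewrite !mulf_neq0// invr_neq0.
Qed.

(** In the trivialization over [Ua a] the fibre coordinate is the value at [idx a] of the rational
    function m Q_u / P_u, with m = [zp_mult q]; the transition function [phi] compares the values at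
    two points. *)
Lemma zp_coordE a q :
  phi a (val (repr q)).1.1 (zp_base q) * (val (repr q)).2 =
  (numer (zp_base q)).[idx C a] / (denom (zp_base q)).[idx C a] * zp_mult q.
Proof. by rewrite -[LHS]mulrA [_ * (val (repr q)).2]mulrC. Qed.

Lemma zp_inj q q' : zp_base q = zp_base q' -> zp_mult q = zp_mult q' -> q = q'.
Proof.
move=> eb em; rewrite -[q]reprK -[q']reprK; apply/eqmodP => /=.
have [[n0 d0] l0] := zp_reprP q; have [[n0' d0'] l0'] := zp_reprP q'.
move: eb em n0 d0 l0 n0' d0' l0'; rewrite /zp_mult /zp_base /zp_rel.
case: (val (repr q)) => -[b u] l; case: (val (repr q')) => -[a v] k /= uv.
rewrite -uv => em n0 d0 l0 n0' d0' l0'; rewrite eqxx/= /phi.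
apply/eqP; apply: (mulIf (x := (denom u).[idx C a] / (numer u).[idx C a])).
  by rewrite mulf_neq0// invr_neq0.
by rewrite -em; field; do ?[apply/andP; split].
Qed.

Lemma zp_point u (m : C) : m != 0 -> exists q, zp_base q = u /\ zp_mult q = m.
Proof.
move=> m0.
(* The product Q_u P_u is non-zero of degree at most 2 s - 2, so it cannot vanish at all of the 2 s
   - 1 points [idx a]. *)
have [a [n0 d0]] : exists a, Ua a u.
  pose r := [seq idx C a | a : 'I_(2 * s - 1)].
  have ur : uniq r.
    rewrite map_inj_uniq ?enum_uniq// => a b /eqP; rewrite /idx eqr_nat.
    by move/eqP => -[] /val_inj.
  have : ~~ all (root (numer u * denom u)) r.
    apply: contraTN isT => ar.
    have nd0 : numer u * denom u != 0.
      by rewrite mulf_neq0 ?monic_neq0 ?numer_monic ?denom_monic.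
    have := leq_trans (max_poly_roots nd0 ar ur)
                      (size_polyM_bound (size_numer u) (size_denom u)).
    by rewrite /r size_map -cardE card_ord; lia.
  rewrite -has_predC => /hasP[_ /mapP[a _ ->]].
  by rewrite /= rootM negb_or => /andP[n0 d0]; exists a.
pose l := m * ((numer u).[idx C a] / (denom u).[idx C a]).
have l0 : l != 0 by rewrite !mulf_neq0// invr_neq0.
pose x : zp_total C s := exist _ (a, u, l) (mem_set (conj (conj n0 d0) l0)).
exists (\pi_(ZP) x).
have /eqmodP/= : x = repr (\pi_(ZP) x) %[mod ZP] by rewrite reprK.
have := zp_reprP (\pi_(ZP) x); rewrite /zp_mult /zp_base /zp_rel.
case: (val (repr _)) => -[b v] k /= [[n0' d0'] k0].
move=> /andP[/eqP vu /eqP ->]; rewrite vu in n0' d0' *; split=> //.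
by rewrite /phi /l; field; do ?[apply/andP; split].
Qed.

Definition zp_row q : 'rV[C]_N :=
  form_row (zp_mult q *: numer (zp_base q)) (denom (zp_base q)).

Lemma numer_zp_row q : numer_row (zp_row q) = zp_mult q *: numer (zp_base q).
Proof.
by rewrite numer_form_row// (leq_trans (size_scale_leq _ _))// size_numer.
Qed.

Lemma denom_zp_row q : denom_row (zp_row q) = denom (zp_base q).
Proof. by rewrite denom_form_row ?size_denom. Qed.

Lemma simple_zp_row q : simple_row (zp_row q).
Proof.
apply/simple_rowP => //; have [pi cp] := set_valP (zp_base q).
exists 1, (zp_mult q), (members (val (zp_base q)).2), (members (val (zp_base q)).1).
by rewrite oner_neq0 zp_mult_neq0 numer_zp_row denom_zp_row scale1r.
Qed.

(** Since P_u and Q_u are monic, leading coefficients give k = 1 and then equal multipliers; what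
    remains determines u. *)
Lemma zp_row_inj q q' k : zp_row q' = k *: zp_row q -> q = q'.
Proof.
move=> e.
have ed : denom (zp_base q') = k *: denom (zp_base q).
  by rewrite -!denom_zp_row e denom_rowZ.
have en : zp_mult q' *: numer (zp_base q') = k *: (zp_mult q *: numer (zp_base q)).
  by rewrite -!numer_zp_row e numer_rowZ.
have k1 : k = 1.
  have /(congr1 lead_coef) := ed; rewrite lead_coefZ.
  by rewrite !(monicP (denom_monic _)) mulr1 => <-.
rewrite k1 !scale1r in ed en.
have em : zp_mult q' = zp_mult q.
  have /(congr1 lead_coef) := en; rewrite !lead_coefZ.
  by rewrite !(monicP (numer_monic _)) !mulr1.
apply: zp_inj; last by rewrite em.
apply: Ms_eq; last by rewrite ed.
by rewrite em in en; rewrite (scalerI (zp_mult_neq0 q) en).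
Qed.

Lemma zp_row_surj (v : 'rV[C]_N) : simple_row v ->
  exists q, exists2 k, k != 0 & zp_row q = k *: v.
Proof.
move=> /(simple_rowP s_ge2)[k [l [p [c [k0 l0 [pi cp] dv nv]]]]].
have [u [nu du]] := Ms_point pi cp.
have [|q [qu qm]] := zp_point u (m := l / k); first by rewrite mulf_neq0 ?invr_eq0.
exists q, k^-1; first by rewrite invr_eq0.
rewrite /zp_row qu qm nu du -[v]form_rowK dv nv -form_rowZ !scalerA mulVf// scale1r.
by rewrite mulrC.
Qed.

Definition ms_chart (i : 'I_s.-2.+1) (j : 'I_s.+1) : chart (Ms C s) (model (Ms C s)) :=
  Chart (@Ms_embed C s @^-1` (cdom (Proj_chart i) `*` cdom (Proj_chart j)))
        (fun u => (Proj_chart i (Ms_embed u).1, Proj_chart j (Ms_embed u).2)).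

Lemma atlas_zpP c : atlas ZP c <-> exists a i j, c = zp_chart a (ms_chart i j).
Proof.
split=> [[a _ [_ [_ [_ [i _ <-] [_ [j _ <-] <-]] <-] <-]]|[a [i [j ->]]]].
  by exists a, i, j.
exists a => //; exists (ms_chart i j) => //.
exists (Chart (cdom (@Proj_chart C _ i) `*` cdom (@Proj_chart C _ j))
  (fun x => (Proj_chart i x.1, Proj_chart j x.2))) => //.
by exists (Proj_chart i); [exists i|exists (Proj_chart j); [exists j|]].
Qed.

Lemma zp_cdomE a i j q : cdom (zp_chart a (ms_chart i j)) q =
  (Ua a (zp_base q) /\ cdom (ms_chart i j) (zp_base q)).
Proof.
have E (A B D : Type) (P : B -> Prop) (x : A * B * D) :
  (let: (_, u, _) := x in P u) = P x.1.2 by case: x => -[].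
exact: (E _ _ _ (fun u => Ua a u /\ cdom (ms_chart i j) u) (val (repr q))).
Qed.

Lemma zp_chartE a i j q :
  zp_chart a (ms_chart i j) q = (ms_chart i j (zp_base q),
    (numer (zp_base q)).[idx C a] / (denom (zp_base q)).[idx C a] * zp_mult q).
Proof.
rewrite -zp_coordE.
have E (A B D T : Type) (P : A -> B -> D -> T) (x : A * B * D) :
  (let: (b, u, l) := x in P b u l) = P x.1.1 x.1.2 x.2 by case: x => -[].
exact: (E _ _ _ _ (fun b u l => (ms_chart i j u, phi a b u * l)) (val (repr q))).
Qed.

Lemma ms_chart_val i j u k l w z : k != 0 -> l != 0 ->
  poly_rV (numer u) = k *: affine_lift i w ->
  poly_rV (denom u) = l *: affine_lift j z ->
  cdom (ms_chart i j) u /\ ms_chart i j u = (w, z).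
Proof.
move=> k0 l0 en ed; rewrite /ms_chart /=.
have [k' k'0 hn] := hcoord_pt (@root_poly_rV_neq0 C _ (members (val u).1)).
have [l' l'0 hd] := hcoord_pt (@root_poly_rV_neq0 C _ (members (val u).2)).
have hn' := etrans hn (congr1 ( *:%R k') en); rewrite scalerA in hn'.
have hd' := etrans hd (congr1 ( *:%R l') ed); rewrite scalerA in hd'.
have [cn vn] := Proj_chart_val (mulf_neq0 k'0 k0) hn'.
have [cd vd] := Proj_chart_val (mulf_neq0 l'0 l0) hd'.
by split; [split|rewrite /Ms_embed/= -[in RHS]vn -[in RHS]vd].
Qed.

Lemma ms_chartE i j u : cdom (ms_chart i j) u ->
  exists k l, [/\ k != 0, l != 0,
    numer u = k *: rVpoly (affine_lift i (ms_chart i j u).1) &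
    denom u = l *: rVpoly (affine_lift j (ms_chart i j u).2)].
Proof.
move=> [/= cn cd].
have [k' k'0 hn] := hcoord_pt (@root_poly_rV_neq0 C _ (members (val u).1)).
have [l' l'0 hd] := hcoord_pt (@root_poly_rV_neq0 C _ (members (val u).2)).
have en := affine_liftK cn; have ed := affine_liftK cd.
set k := hcoord _ 0 _ in en; set l := hcoord _ 0 _ in ed.
exists (k'^-1 * k), (l'^-1 * l); rewrite !mulf_neq0 ?invr_eq0//; split=> //.
  rewrite -linearZ/= -scalerA -en hn scalerA mulVf// scale1r poly_rV_K//.
  exact: size_root_poly.
rewrite -linearZ/= -scalerA -ed hd scalerA mulVf// scale1r poly_rV_K//.
exact: size_root_poly.
Qed.

End ZerosPoles.

(** * From zeros and poles to coefficients and back *)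

Section ZerosPolesBiholomorphism.
Context {C : numClosedFieldType} {s : nat}.
Hypothesis s_ge2 : (2 <= s)%N.
Local Notation N := (s.-2.+1 + s.+1)%N.
Local Notation ZP := (Omega_zp C s).
Implicit Types (q : ZP) (u : Ms C s).

Lemma lsubmx_row (v : 'rV[C]_N) : lsubmx v = poly_rV (numer_row v).
Proof. by rewrite rVpolyK. Qed.

Lemma rsubmx_row (v : 'rV[C]_N) : rsubmx v = poly_rV (denom_row v).
Proof. by rewrite rVpolyK. Qed.

(** The chart of q can be read off any row L on the line of [zp_row q]: the base coordinates do not
    see x and y, and in the quotient of the values at [idx a] the factor k cancels. *)
Lemma zp_chart_val a i j q k (L : 'rV[C]_N) x y w z : k != 0 ->
  zp_row q = k *: L -> x != 0 -> y != 0 ->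
  lsubmx L = x *: affine_lift i w -> rsubmx L = y *: affine_lift j z ->
  (numer_row L).[idx C a] != 0 -> (denom_row L).[idx C a] != 0 ->
  cdom (zp_chart a (ms_chart i j)) q /\
  zp_chart a (ms_chart i j) q =
    ((w, z), (numer_row L).[idx C a] / (denom_row L).[idx C a]).
Proof.
move=> k0 e x0 y0 eL eR na da; have m0 := zp_mult_neq0 q.
have eq1 : numer (zp_base q) = ((zp_mult q)^-1 * k) *: numer_row L.
  by rewrite -scalerA -numer_rowZ -e numer_zp_row// scalerA mulVf// scale1r.
have eq2 : denom (zp_base q) = k *: denom_row L.
  by rewrite -denom_rowZ -e denom_zp_row.
have [||||cu vu] := @ms_chart_val C s i j (zp_base q) ((zp_mult q)^-1 * k * x) (k * y) w z.
- by rewrite !mulf_neq0 ?invr_eq0.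
- by rewrite mulf_neq0.
- by rewrite eq1 linearZ/= -lsubmx_row eL scalerA.
- by rewrite eq2 linearZ/= -rsubmx_row eR scalerA.
have cq : cdom (zp_chart a (ms_chart i j)) q.
  rewrite zp_cdomE; split=> //; rewrite /Ua /= eq1 eq2 !hornerZ !mulf_neq0 ?invr_eq0//.
split=> //; rewrite zp_chartE// vu eq1 eq2 !hornerZ; congr (_, _).
by field; rewrite m0 k0 da.
Qed.

(** The fibre coordinate m Q(a) / P(a) returns the multiplier m. The row does not depend on the
    scale of Q, and that of P only multiplies it by a constant, so affine lifts can stand for the
    monic polynomials. *)
Definition zp_lift (a : 'I_(2 * s - 1)) i j (v : model ZP) : 'rV[C]_N :=
  let Q := rVpoly (affine_lift i v.1.1) in
  let P := rVpoly (affine_lift j v.1.2) in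
  form_row ((v.2 * P.[idx C a] / Q.[idx C a]) *: Q) P.

Lemma zp_row_lift a i j q : cdom (zp_chart a (ms_chart i j)) q ->
  exists k, [/\ k != 0,
    zp_row q = k *: zp_lift a i j (zp_chart a (ms_chart i j) q),
    (rVpoly (affine_lift i (zp_chart a (ms_chart i j) q).1.1)).[idx C a] != 0,
    (rVpoly (affine_lift j (zp_chart a (ms_chart i j) q).1.2)).[idx C a] != 0 &
    (zp_chart a (ms_chart i j) q).2 != 0].
Proof.
move=> cq; have [[n0 d0] cu] : Ua a (zp_base q) /\ cdom (ms_chart i j) (zp_base q).
  by rewrite -zp_cdomE.
have [k [l [k0 l0 en ed]]] := ms_chartE cu.
have n1 : (rVpoly (affine_lift i (ms_chart i j (zp_base q)).1)).[idx C a] != 0.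
  by move: n0; rewrite en hornerZ mulf_eq0 negb_or => /andP[].
have d1 : (rVpoly (affine_lift j (ms_chart i j (zp_base q)).2)).[idx C a] != 0.
  by move: d0; rewrite ed hornerZ mulf_eq0 negb_or => /andP[].
have m0 := zp_mult_neq0 q.
rewrite zp_chartE//; exists l; split=> //; last first.
  exact: (mulf_neq0 (mulf_neq0 n0 (invr_neq0 d0)) m0).
move: (ms_chart i j (zp_base q)) en ed n1 d1 => w en ed n1 d1.
rewrite /zp_row /zp_lift -form_rowZ -ed /=; congr (form_row _ _).
rewrite [in LHS]en !scalerA; congr (_ *: _).
by rewrite en ed !hornerZ; field; do ?[apply/andP; split].
Qed.

Let dif_lift1 i (v : model ZP) :
  differentiable (fun v : model ZP => affine_lift i v.1.1) v.
Proof.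
apply: (@differentiable_comp _ _ _ _ (fun v : model ZP => v.1.1) (affine_lift i)).
  by apply: (@differentiable_comp _ _ _ _ (fun v : model ZP => v.1) fst); exact: dif_fst.
exact: dif_affine_lift.
Qed.

Let dif_lift2 j (v : model ZP) :
  differentiable (fun v : model ZP => affine_lift j v.1.2) v.
Proof.
apply: (@differentiable_comp _ _ _ _ (fun v : model ZP => v.1.2) (affine_lift j)).
  apply: (@differentiable_comp _ _ _ _ (fun v : model ZP => v.1) snd).
    exact: dif_fst.
  exact: dif_snd.
exact: dif_affine_lift.
Qed.

Let dif_horner1 (a : 'I_(2 * s - 1)) i (v : model ZP) :
  differentiable (fun v : model ZP => (rVpoly (affine_lift i v.1.1)).[idx C a]) v.
Proof.
apply: (@dif_horner _ _ _ (fun v : model ZP => rVpoly (affine_lift i v.1.1))).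
  by move=> w; exact: size_rVpoly.
by apply: pdif_rVpoly; exact: dif_lift1.
Qed.

Let dif_horner2 (a : 'I_(2 * s - 1)) j (v : model ZP) :
  differentiable (fun v : model ZP => (rVpoly (affine_lift j v.1.2)).[idx C a]) v.
Proof.
apply: (@dif_horner _ _ _ (fun v : model ZP => rVpoly (affine_lift j v.1.2))).
  by move=> w; exact: size_rVpoly.
by apply: pdif_rVpoly; exact: dif_lift2.
Qed.

Lemma dif_zp_lift a i j (v : model ZP) :
  (rVpoly (affine_lift i v.1.1)).[idx C a] != 0 ->
  differentiable (zp_lift a i j) v.
Proof.
move=> n0; apply: dif_row_mx; apply: dif_poly_rV; last first.
  by apply: pdif_rVpoly; exact: dif_lift2.
apply: pdif_scale; last by apply: pdif_rVpoly; exact: dif_lift1.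
by apply: dif_div => //; apply: dif_mul => //; exact: dif_snd.
Qed.

Lemma zp_lift_val a i j q k (v : model ZP) : k != 0 ->
  zp_row q = k *: zp_lift a i j v -> v.2 != 0 ->
  (rVpoly (affine_lift i v.1.1)).[idx C a] != 0 ->
  (rVpoly (affine_lift j v.1.2)).[idx C a] != 0 ->
  cdom (zp_chart a (ms_chart i j)) q /\ zp_chart a (ms_chart i j) q = v.
Proof.
move: v => [[w z] m] /= k0 e m0 n0 d0; set L := zp_lift _ _ _ _ in e.
set x := m * (rVpoly (affine_lift j z)).[idx C a] / (rVpoly (affine_lift i w)).[idx C a].
have x0 : x != 0 by rewrite !mulf_neq0 ?invr_eq0.
have lL : lsubmx L = x *: affine_lift i w by rewrite row_mxKl linearZ/= rVpolyK.
have rL : rsubmx L = 1 *: affine_lift j z by rewrite row_mxKr rVpolyK scale1r.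
have nL : numer_row L = x *: rVpoly (affine_lift i w) by rewrite /numer_row lL linearZ.
have dL : denom_row L = rVpoly (affine_lift j z) by rewrite /denom_row rL scale1r.
have [||cq vq] := zp_chart_val k0 e x0 (oner_neq0 C) lL rL (a := a).
- by rewrite nL hornerZ mulf_neq0.
- by rewrite dL.
split=> //; apply: etrans vq _; rewrite nL dL hornerZ /x; congr (_, _).
by field; rewrite n0 d0.
Qed.

Lemma covered_zp : covered ZP.
Proof.
move=> q; have [[n0 d0] l0] := zp_reprP q.
have /rV0Pn[i ni] : poly_rV (numer (zp_base q)) != 0 :> 'rV[C]_s.-2.+1.
  exact: root_poly_rV_neq0.
have /rV0Pn[j dj] : poly_rV (denom (zp_base q)) != 0 :> 'rV[C]_s.+1.
  exact: root_poly_rV_neq0.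
have [cu _] := ms_chart_val ni dj (affine_liftK ni) (affine_liftK dj).
exists (zp_chart (val (repr q)).1.1 (ms_chart i j)); last by rewrite zp_cdomE.
by apply/atlas_zpP; exists (val (repr q)).1.1, i, j.
Qed.

Lemma set_inj_zp_chart a i j :
  set_inj (cdom (zp_chart a (ms_chart i j))) (zp_chart a (ms_chart i j) : ZP -> _).
Proof.
move=> q q' /set_mem/zp_row_lift[k [k0 e _ _ _]] /set_mem/zp_row_lift[k' [k'0 e' _ _ _]].
move=> qq'; rewrite -qq' in e'; apply: (zp_row_inj s_ge2 (k := k' / k)).
by rewrite e e' scalerA divfK.
Qed.

(** Rows near a simple row are simple, hence come from points of the bundle, and [zp_lift_val]
    returns the prescribed coordinates of these points. *)
Lemma zp_chart_open a i j :
  open (zp_chart a (ms_chart i j) @` cdom (zp_chart a (ms_chart i j)) : set (model ZP)).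
Proof.
rewrite openE => _ [q cq <-]; rewrite /interior.
have [k [k0 e n0 d0 m0]] := zp_row_lift cq.
set v := zp_chart _ _ q in e n0 d0 m0 *.
have dL := dif_zp_lift j n0.
have sv : simple_row (zp_lift a i j v).
  rewrite -[zp_lift _ _ _ _](scalerK k0) -e.
  by apply: simple_rowZ; rewrite ?invr_eq0//; exact: simple_zp_row.
near=> w.
have sw : simple_row (zp_lift a i j w) by near: w; exact: (near_simple_row dL sv).
have [q' [k' k'0 e']] := zp_row_surj s_ge2 sw.
have [|||cq' vq'] := zp_lift_val k'0 e'.
- by near: w; apply: (near_neq0 _ m0); exact: dif_snd.
- by near: w; exact: (near_neq0 (dif_horner1 a i _) n0).
- by near: w; exact: (near_neq0 (dif_horner2 a j _) d0).
by exists q'.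
Unshelve. all: by end_near. Qed.

Lemma biholomorphic_zp_coef : biholomorphic ZP (Omega_coef C s).
Proof.
have /choice[f fE] : forall q, exists x : Omega_coef C s,
    exists2 k, k != 0 & coef_row x = k *: zp_row q.
  by move=> q; apply: (coef_point s_ge2); exact: simple_zp_row.
apply: (biholomorphic_bij (f := f)).
- apply: holomorphic_to_coef => _ q /atlas_zpP[a [i [j ->]]] cq.
  have [k [_ _ n0 _ _]] := zp_row_lift cq.
  exists (zp_lift a i j); first exact: dif_zp_lift.
  near=> v => q' cq' <-; have [l l0 ->] := fE q'.
  have [k' [k'0 -> _ _ _]] := zp_row_lift cq'.
  by exists (l * k'); rewrite ?mulf_neq0// scalerA.
- move=> q q' ff; have [k k0 e] := fE q; have [k' k'0 e'] := fE q'.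
  rewrite ff e' in e; apply: (zp_row_inj s_ge2 (k := k'^-1 * k)).
  by rewrite -scalerA -e scalerA mulVf// scale1r.
- move=> x; have [q [k k0 e]] := zp_row_surj s_ge2 (simple_coef_row x).
  exists q; have [k' k'0 e'] := fE q; rewrite e scalerA in e'.
  apply/esym; apply: (coef_row_inj (k := k' * k)) => //.
  by rewrite mulf_neq0.
move=> g gK _ _ x /atlas_coefP[h ->] /atlas_zpP[a [i [j ->]]] cx cg.
have gE y : cdom (coef_chart h) y ->
    exists2 k, k != 0 & zp_row (g y) = k *: affine_lift h (coef_chart h y).
  move=> cy; have [k k0 e] := fE (g y); rewrite gK in e.
  exists (k^-1 * coef_row y 0 h); first by rewrite mulf_neq0 ?invr_eq0.
  by rewrite -scalerA -coef_chartE// e scalerA mulVf// scale1r.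
pose L (v : model (Omega_coef C s)) := affine_lift h v.
have dL v : differentiable L v by exact: dif_affine_lift.
have dlL v := dif_lsubmx (dL v); have drL v := dif_rsubmx (dL v).
pose Q v := numer_row (L v); pose P v := denom_row (L v).
have dQ v : pdif Q v by exact: pdif_rVpoly.
have dP v : pdif P v by exact: pdif_rVpoly.
have dQa v : differentiable (fun v => (Q v).[idx C a]) v.
  by apply: dif_horner (dQ v) => w; exact: size_rVpoly.
have dPa v : differentiable (fun v => (P v).[idx C a]) v.
  by apply: dif_horner (dP v) => w; exact: size_rVpoly.
pose x0 := coef_chart h x.
have [k k0 e] := gE x cx.
(* These are the denominators of G at x0. They do not vanish because L x0 is proportional to the row
   of g x, which lies in the chart. *)
have [na da Qi Pj] : [/\ (Q x0).[idx C a] != 0, (P x0).[idx C a] != 0,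
    lsubmx (L x0) 0 i != 0 & rsubmx (L x0) 0 j != 0].
  have : Ua a (zp_base (g x)) /\ cdom (ms_chart i j) (zp_base (g x)).
    by rewrite -zp_cdomE.
  move=> [[n0 d0] /ms_chartE [k1 [k2 [k10 k20 e1 e2]]]].
  have m0 := zp_mult_neq0 (g x).
  have en : zp_mult (g x) *: numer (zp_base (g x)) = k *: Q x0.
    by rewrite -numer_zp_row// e numer_rowZ.
  have ed : denom (zp_base (g x)) = k *: P x0 by rewrite -denom_zp_row e denom_rowZ.
  split.
  - have /(congr1 (fun p : {poly C} => p.[idx C a])) := en; rewrite !hornerZ => /eqP.
    by apply: contraTneq => ->; rewrite mulr0 mulf_neq0.
  - have /(congr1 (fun p : {poly C} => p.[idx C a])) := ed; rewrite !hornerZ.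
    by move=> ed'; move: d0; rewrite ed' mulf_eq0 negb_or => /andP[].
  - have Qi : (Q x0)`_i = lsubmx (L x0) 0 i by exact: coef_rVpoly_ord.
    have /(congr1 (fun p : {poly C} => p`_i)) := en.
    rewrite e1 !coefZ Qi coef_rVpoly_ord affine_lift_i mulr1 => /eqP.
    by apply: contraTneq => ->; rewrite mulr0 mulf_neq0.
  - have Pj : (P x0)`_j = rsubmx (L x0) 0 j by exact: coef_rVpoly_ord.
    have /(congr1 (fun p : {poly C} => p`_j)) := ed.
    rewrite e2 !coefZ Pj coef_rVpoly_ord affine_lift_i mulr1 => /eqP.
    by apply: contraTneq => ->; rewrite mulr0.
pose G (v : model (Omega_coef C s)) : model ZP :=
  ((col' i ((lsubmx (L v) 0 i)^-1 *: lsubmx (L v)),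
    col' j ((rsubmx (L v) 0 j)^-1 *: rsubmx (L v))),
   (Q v).[idx C a] / (P v).[idx C a]).
exists G.
  apply: differentiable_pair; last exact: dif_div.
  by apply: differentiable_pair; exact: dif_affine_chart.
near=> v => y cy yv; have [k' k'0] := gE y cy; rewrite yv => e'.
have Lvi : lsubmx (L v) 0 i != 0.
  by near: v; exact: (near_neq0 (dif_entry 0 i (dlL _)) Qi).
have Lvj : rsubmx (L v) 0 j != 0.
  by near: v; exact: (near_neq0 (dif_entry 0 j (drL _)) Pj).
apply: (zp_chart_val k'0 e' Lvi Lvj (affine_liftK Lvi) (affine_liftK Lvj)).
- by near: v; exact: (near_neq0 (dQa _) na).
- by near: v; exact: (near_neq0 (dPa _) da).
Unshelve. all: by end_near. Qed.

End ZerosPolesBiholomorphism.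

(** * Charts of the sphere in homogeneous coordinates *)

Section SphereCharts.
Context {K : numFieldType}.
Implicit Types (x : sphere K) (b : bool) (w : K).

Definition sphere_chart b : chart (sphere K) K := if b then chart_oo else chart0.

(* [chart_pt b w] is the point with coordinate w in the chart b, and [chart_sel b]
   the homogeneous coordinate that does not vanish on this chart. *)
Definition chart_pt b w : K * K := if b then (1, w) else (w, 1).

Definition chart_sel b (v : K * K) : K := if b then v.1 else v.2.

Lemma cdom_sphere_chart b x : cdom (sphere_chart b) x <-> chart_sel b (pt x) != 0.
Proof.
case: b x => -[z|] /=; rewrite ?oner_neq0 ?oppr_eq0 ?oner_neq0 ?eqxx.
- by split=> [|/eqP z0 [/z0]//]; apply: contra_notN => /eqP ->.
- by split.
- by split.
- by split=> // /(_ erefl).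
Qed.

Lemma sphere_chart_pt b x : cdom (sphere_chart b) x ->
  pt x = (chart_sel b (pt x) * (chart_pt b (sphere_chart b x)).1,
          chart_sel b (pt x) * (chart_pt b (sphere_chart b x)).2).
Proof.
move=> /cdom_sphere_chart; case: b x => -[z|] /=;
  rewrite ?eqxx// ?mulr1 ?mul1r ?mulr0// => z0.
by rewrite divff.
Qed.

Lemma sphere_chart_surj b w : exists2 x, cdom (sphere_chart b) x & sphere_chart b x = w.
Proof.
case: b => /=; last by exists (Some w).
have [->|w0] := eqVneq w 0; first by exists None.
exists (Some w^-1); last by rewrite invrK.
by move=> [] /eqP; rewrite invr_eq0 (negbTE w0).
Qed.

Lemma sphere_chart_inj b x y : cdom (sphere_chart b) x -> cdom (sphere_chart b) y ->
  sphere_chart b x = sphere_chart b y -> x = y.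
Proof.
move=> cx cy e; apply/eqP; rewrite -br_pt_eq0 (sphere_chart_pt cx) (sphere_chart_pt cy).
by rewrite e /br /=; apply/eqP; ring.
Qed.

Lemma chart_pt_neq0 b w : chart_pt b w != 0.
Proof. by case: b; rewrite xpair_eqE/= oner_eq0 ?andbF. Qed.

(** At infinity the chart coordinate is the second homogeneous one, which enters the bracket with
    the opposite sign. *)
Definition chart_sign b : K := if b then -1 else 1.

Lemma br_chart_pt b w w' :
  br (chart_pt b w) (chart_pt b w') = chart_sign b * (w' - w).
Proof. by case: b; rewrite /br/=; ring. Qed.

Lemma chart_selZ b k v : chart_sel b (k * v.1, k * v.2) = k * chart_sel b v.
Proof. by case: b. Qed.

Lemma brZl k (u v : K * K) : br (k * u.1, k * u.2) v = k * br u v.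
Proof. by rewrite /br /=; ring. Qed.

Lemma brZr k (u v : K * K) : br u (k * v.1, k * v.2) = k * br u v.
Proof. by rewrite /br /=; ring. Qed.

Lemma dif_chart_pt1 (V : normedModType K) b (f : V -> K) v : differentiable f v ->
  differentiable (fun v => (chart_pt b (f v)).1) v.
Proof. by move=> df; case: b => //=; exact: differentiable_cst. Qed.

Lemma dif_chart_pt2 (V : normedModType K) b (f : V -> K) v : differentiable f v ->
  differentiable (fun v => (chart_pt b (f v)).2) v.
Proof. by move=> df; case: b => //=; exact: differentiable_cst. Qed.

End SphereCharts.

(** * Forms with ordered poles and their residues *)

Section ResiduesPoles.
Context {C : numClosedFieldType} {s : nat}.
Hypothesis s_ge2 : (2 <= s)%N.
Local Notation N := (s.-2.+1 + s.+1)%N.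
Local Notation Cov := (rp_cover C s).
Local Notation RP := (Omega_rp C s).
Implicit Types (x y : Cov) (q : RP) (b : 'I_s -> bool).

Definition poles x : {ffun 'I_s -> sphere C} := val x.2.
Definition resid x : {ffun 'I_s -> C} := val x.1.

Lemma poles_inj x : injective (poles x).
Proof. exact: (set_valP x.2). Qed.

Lemma resid_neq0 x i : resid x i != 0.
Proof. by have [r0 _] := set_valP x.1; exact: r0. Qed.

Lemma sum_resid x : \sum_i resid x i = 0.
Proof. by have [_ r0] := set_valP x.1. Qed.

Lemma cover_point (r : {ffun 'I_s -> C}) (p : {ffun 'I_s -> sphere C}) :
  (forall i, r i != 0) -> \sum_i r i = 0 -> injective p ->
  exists x : Cov, resid x = r /\ poles x = p.
Proof.
move=> r0 rs pi.
have hr : residues r by [].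
have hp : [set p : spheres C s | injective (p : {ffun _ -> _})] p by [].
by exists (SigSub (mem_set hr), SigSub (mem_set hp)).
Qed.

Lemma cover_eq x y : resid x = resid y -> poles x = poles y -> x = y.
Proof.
by case: x => x1 x2; case: y => y1 y2 e1 e2; congr (_, _); exact: val_inj.
Qed.

Lemma rp_relP x y : rp_rel x y <-> exists t : 'S_s,
  resid y = permute t (resid x) /\ poles y = permute t (poles x).
Proof.
split=> [/existsP[t /andP[/eqP e1 /eqP e2]]|[t [e1 e2]]]; first by exists t.
by apply/existsP; exists t; rewrite -/(resid y) -/(resid x) e1 -/(poles y) -/(poles x) e2 !eqxx.
Qed.

Lemma rp_quotP x y : \pi_(RP) x = \pi_(RP) y <-> rp_rel x y.
Proof. by split=> [/eqmodP//|xy]; apply/eqmodP. Qed.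

Definition rp_row (r : 'I_s -> C) (y : 'I_s -> C * C) : 'rV[C]_N :=
  form_row (pfrac r y) (\prod_i lin (y i)).

Lemma size_prod_lin_all (y : 'I_s -> C * C) :
  (size (\prod_i lin (y i))%R <= s.+1)%N.
Proof.
by have := size_prod_lin (index_enum 'I_s) xpredT y; rewrite sum1_card card_ord.
Qed.

Lemma numer_rp_row r (y : 'I_s -> C * C) : \sum_i r i = 0 -> numer_row (rp_row r y) = pfrac r y.
Proof. by move=> r0; rewrite numer_form_row// size_pfrac// ltnW. Qed.

Lemma denom_rp_row r (y : 'I_s -> C * C) : denom_row (rp_row r y) = \prod_i lin (y i).
Proof. by rewrite denom_form_row ?size_prod_lin_all. Qed.

Lemma rp_row_scale (k : 'I_s -> C) r (y : 'I_s -> C * C) :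
  rp_row r (fun i => (k i * (y i).1, k i * (y i).2)) = (\prod_i k i) *: rp_row r y.
Proof. by rewrite /rp_row pfrac_scale prod_lin_scale form_rowZ. Qed.

Lemma rp_row_perm (t : 'S_s) r (y : 'I_s -> C * C) : rp_row (r \o t) (y \o t) = rp_row r y.
Proof.
rewrite /rp_row; congr (form_row _ _); last first.
  by rewrite [RHS](reindex_inj (@perm_inj _ t)).
rewrite /pfrac [RHS](reindex_inj (@perm_inj _ t)); apply: eq_bigr => i _.
congr (_ *: _); rewrite [RHS](reindex_inj (@perm_inj _ t)) /=.
by apply: eq_bigl => j; rewrite (inj_eq perm_inj).
Qed.

Definition cover_row x := rp_row (resid x) (fun i => pt (poles x i)).

Lemma numer_cover_row x : numer_row (cover_row x) = pfrac (resid x) (fun i => pt (poles x i)).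
Proof. by rewrite numer_rp_row// sum_resid. Qed.

Lemma denom_cover_row x : denom_row (cover_row x) = root_poly (poles x).
Proof. by rewrite denom_rp_row root_polyE. Qed.

Lemma cover_row_rel x y : rp_rel x y -> cover_row x = cover_row y.
Proof.
move=> /rp_relP[t [e1 e2]]; rewrite /cover_row e1 e2 -[LHS](rp_row_perm t).
by congr rp_row; apply/funext => i; rewrite /= ffunE.
Qed.

Lemma heval_cover_row x i :
  heval s.-2 (numer_row (cover_row x)) (pt (poles x i)) =
  resid x i * \prod_(j | j != i) br (pt (poles x j)) (pt (poles x i)).
Proof. by rewrite numer_cover_row heval_pfrac ?sum_resid ?pt_neq0. Qed.

Lemma simple_cover_row x : simple_row (cover_row x).
Proof.
apply/simple_rowP => //; set Q := numer_row (cover_row x).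
have Qx i : heval s.-2 Q (pt (poles x i)) != 0.
  rewrite heval_cover_row mulf_neq0 ?resid_neq0// br_prod_neq0//; exact: poles_inj.
have Q0 : Q != 0.
  apply/eqP => Q0; have i : 'I_s by exists 0%N; lia.
  by have := Qx i; rewrite Q0 heval0 eqxx.
have [|c Qc] := @root_poly_exists _ s.-2 Q Q0.
  by rewrite (leq_trans (size_numer_row s_ge2 _))//; lia.
exists 1, (lead_coef Q), (poles x), c.
rewrite oner_neq0 lead_coef_eq0 Q0 scale1r denom_cover_row; split=> //.
split; first exact: poles_inj.
move=> j i cx; have := Qx i; rewrite Qc hevalZ heval_root_poly (bigD1 j)//= cx.
by rewrite brxx mul0r mulr0 eqxx.
Qed.

(** The order of the poles is prescribed by p, so that the poles of a nearby form can later be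
    listed in the order of those of a given one. The residues come from [pfrac_exists]. *)
Lemma cover_row_surj (v : 'rV[C]_N) k (p : {ffun 'I_s -> sphere C}) :
  simple_row v -> k != 0 -> denom_row v = k *: root_poly p ->
  exists x, poles x = p /\ cover_row x = k^-1 *: v.
Proof.
move=> /(simple_rowP s_ge2)[k' [l [p' [c [k'0 l0 [p'i cp'] dv nv]]]]] k0 dv'.
have kk : k = k'.
  have /(congr1 lead_coef) := dv; rewrite dv' !lead_coefZ.
  by rewrite !(monicP (root_poly_monic _)) !mulr1.
have [t pt'] : exists t : 'S_s, p = permute t p'.
  by apply: root_poly_inj; apply: (scalerI k0); rewrite -dv' kk dv.
have pi : injective p by move=> i j; rewrite pt' !ffunE => /p'i /perm_inj.
have sQ : (size (k^-1 *: numer_row v)%R <= s.-1)%N.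
  by rewrite (leq_trans (size_scale_leq _ _))// size_numer_row.
have [Qe r0] := pfrac_exists s_ge2 pi sQ.
set r := (fun i => _) in Qe r0.
have [|||x [xr xp]] := @cover_point (finfun r) p => //.
- move=> i; rewrite ffunE mulf_neq0 ?invr_eq0 ?br_prod_neq0//.
  rewrite hevalZ nv hevalZ heval_root_poly !mulf_neq0 ?invr_eq0//.
  apply/prodf_neq0 => j _; rewrite br_pt_eq0 pt' ffunE; apply/eqP; exact: cp'.
- by under eq_bigr do rewrite ffunE.
exists x; split=> //; rewrite /cover_row xr xp -[v]form_rowK -form_rowZ.
rewrite dv' scalerA mulVf// scale1r /rp_row -root_polyE Qe; congr (form_row _ _).
by congr pfrac; apply/funext => i; rewrite ffunE.
Qed.

(** Monic denominators give k = 1 and a permutation t of the poles. The residue at a pole is the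
    value of Q there divided by a non-zero product over the other poles, so it is carried along by
    t. *)
Lemma cover_row_inj x y k : cover_row y = k *: cover_row x -> rp_rel x y.
Proof.
move=> e; have ed : root_poly (poles y) = k *: root_poly (poles x).
  by rewrite -!denom_cover_row e denom_rowZ.
have k1 : k = 1.
  have /(congr1 lead_coef) := ed; rewrite lead_coefZ.
  by rewrite !(monicP (root_poly_monic _)) mulr1 => <-.
rewrite k1 scale1r in ed e; have [t xy] := root_poly_inj (esym ed).
have yE j : poles y j = poles x (t j) by rewrite xy ffunE.
apply/rp_relP; exists t; split=> //; apply/ffunP => i; rewrite ffunE.
have := heval_cover_row y i; rewrite e scale1r yE heval_cover_row.
rewrite [X in _ = _ * X -> _](eq_bigr (fun j =>
  br (pt (poles x (t j))) (pt (poles x (t i))))); last first.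
  by move=> j _; rewrite yE.
set B := \prod_(j | j != i) _.
have -> : \prod_(j | j != t i) br (pt (poles x j)) (pt (poles x (t i))) = B.
  rewrite (reindex_inj (@perm_inj _ t)); apply: eq_bigl => j.
  by rewrite (inj_eq perm_inj).
move=> /esym/mulIf; apply.
apply/prodf_neq0 => j ji; rewrite br_pt_eq0 (inj_eq (@poles_inj x)).
by rewrite (inj_eq perm_inj).
Qed.

End ResiduesPoles.

Lemma near_forall (K : numFieldType) (V : normedModType K) (I : finType)
    (P : I -> V -> Prop) (v : V) : (forall i, \forall w \near v, P i w) ->
  \forall w \near v, forall i, P i w.
Proof. exact: filter_forall. Qed.

Section ModelResidues.
Context {K : numFieldType}.

(** The chart of [Hs] omits the last residue: for i = s - 1 [insub] fails, and the vanishing of the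
    sum supplies the value. *)
Definition model_resid s (rho : 'rV[K]_s.-1) (i : 'I_s) : K :=
  if insub (i : nat) is Some k then rho 0 k else - \sum_k rho 0 k.

Lemma model_resid_widen s rho (k : 'I_s.-1) :
  model_resid rho (widen_ord (leq_pred s) k) = rho 0 k.
Proof. by rewrite /model_resid /= valK. Qed.

Lemma sum_model_resid s (rho : 'rV[K]_s.-1) : \sum_i model_resid rho i = 0.
Proof.
case: s rho => [|n] rho; first by rewrite big_ord0.
rewrite big_ord_recr/= {2}/model_resid insubF ?ltnn//=.
by apply/eqP; rewrite subr_eq0; apply/eqP/eq_bigr => k _; rewrite /model_resid /= valK.
Qed.

Lemma model_residK s (r : 'I_s -> K) i : \sum_i r i = 0 ->
  model_resid (\row_(k < s.-1) r (widen_ord (leq_pred s) k)) i = r i.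
Proof.
case: s r i => [|n] r i; first by case: i.
rewrite big_ord_recr /= => /eqP; rewrite addr_eq0 => /eqP rs.
rewrite /model_resid; case: insubP => [k _ ki|].
  by rewrite mxE; congr r; apply: val_inj; rewrite /= ki.
rewrite -leqNgt => ni.
have -> : i = ord_max by apply: val_inj; apply/eqP; rewrite eqn_leq ni -ltnS ltn_ord.
rewrite -[RHS]opprK -rs; congr (- _); apply: eq_bigr => k _; rewrite mxE.
by congr r; apply: val_inj.
Qed.

Lemma dif_model_resid (V : normedModType K) s (f : V -> 'rV[K]_s.-1) i v :
  differentiable f v -> differentiable (fun v => model_resid (f v) i) v.
Proof.
move=> df; rewrite /model_resid; case: insub => [k|]; first exact: dif_entry.
by apply: dif_opp; apply: dif_sum => k _; exact: dif_entry.
Qed.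

End ModelResidues.

(** * Charts of the quotient by the symmetric group *)

Section ResiduesPolesCharts.
Context {C : numClosedFieldType} {s : nat}.
Hypothesis s_ge2 : (2 <= s)%N.
Local Notation N := (s.-2.+1 + s.+1)%N.
Local Notation Cov := (rp_cover C s).
Local Notation RP := (Omega_rp C s).
Implicit Types (x y : Cov) (q : RP) (b : 'I_s -> bool).

Definition cover_chart b : chart Cov (model Cov) :=
  Chart (cdom (@Hs_chart C s) `*`
         (set_val @^-1` cdom (spheres_chart (fun i => sphere_chart (b i)))))
        (fun x => (Hs_chart C s x.1,
           spheres_chart (fun i => sphere_chart (b i)) (set_val x.2))).

Lemma atlas_coverP c : atlas Cov c <-> exists b, c = cover_chart b.
Proof.
split=> [[_ -> [_ [_ [e he <-] <-] <-]]|[b ->]].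
  have [b ->] : exists b, e = fun i => sphere_chart (b i); last by exists b.
  exists (fun i => `[< e i = chart_oo >]); apply/funext => i.
  by case: asboolP => [//|ne]; case: (he i).
exists (Hs_chart C s) => //.
exists (Chart (set_val @^-1` cdom (spheres_chart (fun i => @sphere_chart C (b i))))
  (spheres_chart (fun i => sphere_chart (b i)) \o set_val)) => //.
exists (spheres_chart (fun i => sphere_chart (b i))) => //.
by exists (fun i => sphere_chart (b i)) => // i; case: (b i); [right|left].
Qed.

Lemma cdom_cover_chart b x :
  cdom (cover_chart b) x <-> forall i, cdom (sphere_chart (b i)) (poles x i).
Proof. by split=> [[]|cx]. Qed.

Lemma cover_chart1 b x i : model_resid (cover_chart b x).1 i = resid x i.
Proof. by rewrite model_residK ?sum_resid. Qed.

Lemma cover_chart1_widen b x k :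
  (cover_chart b x).1 0 k = resid x (widen_ord (leq_pred s) k).
Proof. by rewrite mxE. Qed.

Lemma cover_chart2 b x i :
  (cover_chart b x).2 0 i = sphere_chart (b i) (poles x i).
Proof. by rewrite mxE. Qed.

Definition model_pt b (m : model Cov) (i : 'I_s) : C * C := chart_pt (b i) (m.2 0 i).

Definition cover_lift b (m : model Cov) : 'rV[C]_N :=
  rp_row (model_resid m.1) (model_pt b m).

Lemma pt_cover_chart b x i : cdom (cover_chart b) x ->
  pt (poles x i) = (chart_sel (b i) (pt (poles x i)) * (model_pt b (cover_chart b x) i).1,
                    chart_sel (b i) (pt (poles x i)) * (model_pt b (cover_chart b x) i).2).
Proof.
move=> /cdom_cover_chart cx; rewrite /model_pt cover_chart2.
exact: sphere_chart_pt.
Qed.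

Lemma cover_row_lift b x : cdom (cover_chart b) x ->
  exists2 k, k != 0 & cover_row x = k *: cover_lift b (cover_chart b x).
Proof.
move=> cx; exists (\prod_i chart_sel (b i) (pt (poles x i))).
  apply/prodf_neq0 => i _; apply/cdom_sphere_chart; move: i.
  exact/cdom_cover_chart.
rewrite -rp_row_scale /cover_row; congr rp_row; apply/funext => i.
  by rewrite cover_chart1.
exact: pt_cover_chart.
Qed.

Lemma dif_model_pt1 b i (m : model Cov) :
  differentiable (fun m => (model_pt b m i).1) m.
Proof.
apply: dif_chart_pt1.
by apply: (@dif_entry _ _ _ _ (fun m : model Cov => m.2)); exact: dif_snd.
Qed.

Lemma dif_model_pt2 b i (m : model Cov) :
  differentiable (fun m => (model_pt b m i).2) m.
Proof.
apply: dif_chart_pt2.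
by apply: (@dif_entry _ _ _ _ (fun m : model Cov => m.2)); exact: dif_snd.
Qed.

Lemma pdif_model_lin b i (m : model Cov) : pdif (fun m => lin (model_pt b m i)) m.
Proof.
move=> k; apply: (dif_ext (f := fun m => (lin ((model_pt b m i).1, (model_pt b m i).2))`_k)).
  by move=> v; rewrite -surjective_pairing.
by apply: pdif_lin; [exact: dif_model_pt1|exact: dif_model_pt2].
Qed.

Lemma dif_cover_lift b (m : model Cov) : differentiable (cover_lift b) m.
Proof.
apply: dif_row_mx; apply: dif_poly_rV; last first.
  by apply: pdif_prod => i _; exact: pdif_model_lin.
apply: pdif_sum => i _; apply: pdif_scale; last first.
  by apply: pdif_prod => j _; exact: pdif_model_lin.
apply: dif_mul; last exact: dif_model_pt2.
by apply: (@dif_model_resid _ _ _ (fun m : model Cov => m.1)); exact: dif_fst.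
Qed.

Lemma cover_chart_surj b (m : model Cov) : (forall i, model_resid m.1 i != 0) ->
  (forall i j, i != j -> br (model_pt b m i) (model_pt b m j) != 0) ->
  exists2 x, cdom (cover_chart b) x & cover_chart b x = m.
Proof.
move=> r0 pij.
have /choice[p pP] : forall i, exists z, cdom (sphere_chart (b i)) z /\ sphere_chart (b i) z = m.2 0 i.
  by move=> i; have [z cz zE] := sphere_chart_surj (b i) (m.2 0 i); exists z.
have [|||x [xr xp]] := @cover_point C s [ffun i => model_resid m.1 i] (finfun p).
- by move=> i; rewrite ffunE.
- by rewrite -[RHS](sum_model_resid m.1); apply: eq_bigr => i _; rewrite ffunE.
- move=> i j; rewrite !ffunE => pij'; apply/eqP/negPn/negP => /pij.
  apply/negP; rewrite negbK; have [ci ei] := pP i; have [cj ej] := pP j.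
  have := br_pt_eq0 (p i) (p j); rewrite {2}pij' eqxx.
  rewrite (sphere_chart_pt ci) (sphere_chart_pt cj) brZl brZr ei ej.
  rewrite !mulf_eq0 => /or3P[/eqP e|/eqP e|//].
    by move/cdom_sphere_chart : ci; rewrite e eqxx.
  by move/cdom_sphere_chart : cj; rewrite e eqxx.
exists x; first by apply/cdom_cover_chart => i; rewrite xp ffunE; case: (pP i).
rewrite [LHS]surjective_pairing [RHS]surjective_pairing; congr (_, _).
  by apply/rowP => k; rewrite cover_chart1_widen xr ffunE model_resid_widen.
by apply/rowP => i; rewrite cover_chart2 xp ffunE; case: (pP i).
Qed.

Lemma set_inj_cover_chart b : set_inj (cdom (cover_chart b)) (cover_chart b).
Proof.
move=> x y /set_mem/cdom_cover_chart cx /set_mem/cdom_cover_chart cy e.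
apply: cover_eq; apply/ffunP => i; first by rewrite -!(cover_chart1 b) e.
by apply: (sphere_chart_inj (cx i) (cy i)); rewrite -!cover_chart2 e.
Qed.

Lemma cover_chart_open b : open (cover_chart b @` cdom (cover_chart b)).
Proof.
rewrite openE => _ [x cx <-]; rewrite /interior.
have n1 : \forall m \near cover_chart b x, forall i, model_resid m.1 i != 0.
  apply: near_forall => i; apply: (@near_neq0 _ _ (fun m : model Cov => model_resid m.1 i)).
    by apply: (@dif_model_resid _ _ _ (fun m : model Cov => m.1)); exact: dif_fst.
  by rewrite cover_chart1 resid_neq0.
have n2 : \forall m \near cover_chart b x, forall i j,
    i != j -> br (model_pt b m i) (model_pt b m j) != 0.
  apply: near_forall => i; apply: near_forall => j.
  have [->|ij] := eqVneq i j; first by near=> m.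
  have d m : differentiable (fun m => br (model_pt b m i) (model_pt b m j)) m.
    by apply: dif_sub; apply: dif_mul; (exact: dif_model_pt1 || exact: dif_model_pt2).
  apply: filterS (near_neq0 (d _) _) => [m bm _ //|].
  have : br (pt (poles x i)) (pt (poles x j)) != 0.
    by rewrite br_pt_eq0 (inj_eq (@poles_inj _ _ x)).
  rewrite (pt_cover_chart i cx) (pt_cover_chart j cx) brZl brZr.
  by rewrite !mulf_eq0 !negb_or => /and3P[].
near=> m.
have [||y cy ym] := @cover_chart_surj b m; [by near: m|by near: m|].
by exists y.
Unshelve. all: by end_near. Qed.

Lemma holomorphic_from_rp (f : RP -> Omega_coef C s) :
  (forall q, exists2 k, k != 0 & coef_row (f q) = k *: cover_row (repr q)) ->
  holomorphic f.
Proof.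
move=> fE; apply: holomorphic_to_coef => _ q [c [V [t [/atlas_coverP[b ->] tK _ tc ->]]]] Vq.
exists (cover_lift b); first exact: dif_cover_lift.
near=> v => q' Vq' <-; have [k k0 ->] := fE q'.
(* [cover_row] is constant on orbits, so the section t of the chart can replace [repr]. *)
have -> : cover_row (repr q') = cover_row (t q').
  by apply: (cover_row_rel (x := repr q')); apply/rp_quotP; rewrite reprK tK.
have [k' k'0 ->] : exists2 k, k != 0 & cover_row (t q') = k *: cover_lift b (cover_chart b (t q')).
  by apply: cover_row_lift; apply: tc; exists q'.
by exists (k * k'); rewrite ?mulf_neq0// scalerA.
Unshelve. all: by end_near. Qed.

(* The neighbourhoods of the poles p_i of [x] in which the disjointness is
   evident: those of points that are closer to p_i than to the other poles. *)
Definition voronoi x y := forall i j, j != i ->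
  `|br (pt (poles y i)) (pt (poles x i))| < `|br (pt (poles y i)) (pt (poles x j))|.

Lemma voronoi_refl x : voronoi x x.
Proof.
move=> i j ji; rewrite brxx normr0 normr_gt0 br_pt_eq0.
by rewrite (inj_eq (@poles_inj _ _ x)) eq_sym.
Qed.

(** If t moved i, the common pole z_i = y_(t i) would be closer to x_i than to x_(t i), and also the
    other way round. *)
Lemma voronoi_rel x y z : voronoi x y -> voronoi x z -> rp_rel y z -> y = z.
Proof.
move=> xy xz /rp_relP[t [e1 e2]]; suff t1 : t = 1%g.
  by apply: cover_eq; rewrite ?e1 ?e2 t1 permute1.
apply/permP => i; rewrite perm1; apply/eqP/negPn/negP => ti.
have := xz i (t i) ti; rewrite e2 ffunE => h1.
have := xy (t i) i; rewrite eq_sym => /(_ ti) h2.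
by have := lt_trans h1 h2; rewrite ltxx.
Qed.

(** Both sides of each inequality are homogeneous of the same degree in the coordinates of the pole
    of y, so the condition can be tested in any chart b'. *)
Lemma voronoi_open x b : @open Cov [set y | cdom (cover_chart b) y /\ voronoi x y].
Proof.
rewrite charted_openE => _ y /atlas_coverP[b' ->] cy [cby xy].
have n1 : \forall m \near cover_chart b' y, forall i, chart_sel (b i) (model_pt b' m i) != 0.
  apply: near_forall => i.
  apply: (@near_neq0 _ _ (fun m : model Cov => chart_sel (b i) (model_pt b' m i))).
    by case: (b i); [exact: dif_model_pt1|exact: dif_model_pt2].
  have /cdom_cover_chart/(_ i)/cdom_sphere_chart := cby.
  by rewrite (pt_cover_chart i cy) chart_selZ mulf_eq0 negb_or => /andP[].
have n2 : \forall m \near cover_chart b' y, forall i j, j != i ->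
    `|br (model_pt b' m i) (pt (poles x i))| < `|br (model_pt b' m i) (pt (poles x j))|.
  apply: near_forall => i; apply: near_forall => j.
  have [->|ij] := eqVneq j i; first by near=> m.
  have d k m : differentiable (fun m => br (model_pt b' m i) (pt (poles x k))) m.
    by apply: dif_sub; apply: dif_mul; (exact: dif_model_pt1 || exact: dif_model_pt2
      || exact: differentiable_cst).
  apply: filterS (near_norm_lt (d i _) (d j _) _) => [m bm _ //|].
  have := xy i j ij; rewrite (pt_cover_chart i cy) !brZl !normrM ltr_pM2l//.
  rewrite normr_gt0; apply/cdom_sphere_chart; move: (i).
  exact/cdom_cover_chart.
apply: filterS2 n1 n2 => m m1 m2 z cz zm.
have sel i : chart_sel (b' i) (pt (poles z i)) != 0.
  by apply/cdom_sphere_chart; move: i; exact/cdom_cover_chart.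
split.
  apply/cdom_cover_chart => i; apply/cdom_sphere_chart.
  by rewrite (pt_cover_chart i cz) chart_selZ mulf_neq0// zm.
move=> i j ji; rewrite (pt_cover_chart i cz) !brZl !normrM ltr_pM2l ?normr_gt0//.
by rewrite zm; exact: m2.
Unshelve. all: by end_near. Qed.

(** By [voronoi_rel] the projection is injective on the open set W around x; inverting it there
    gives a section whose image is W. *)
Lemma covered_rp : covered RP.
Proof.
move=> q; pose x : Cov := repr q.
have /choice[b bP] : forall i, exists e, cdom (@sphere_chart C e) (poles x i).
  by move=> i; case: (poles x i) => [z|]; [exists false|exists true].
have cx : cdom (cover_chart b) x by exact/cdom_cover_chart.
pose W := [set y : Cov | cdom (cover_chart b) y /\ voronoi x y].
pose V := [set q' : RP | exists2 y, W y & \pi_(RP) y = q'].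
have /choice[t tP] : forall q', exists y : Cov, V q' -> W y /\ \pi_(RP) y = q'.
  move=> q'; have [[y Wy yq]|nV] := pselect (V q'); first by exists y.
  by exists x => /nV.
exists (Chart V (cover_chart b \o t)); last first.
  by exists x; [split=> //; exact: voronoi_refl|exact: reprK].
have tW : t @` V = W.
  apply/seteqP; split=> [_ [q' Vq' <-]|y Wy]; first by case: (tP q' Vq').
  have Vy : V (\pi_(RP) y) by exists y.
  exists (\pi_(RP) y) => //; have [[_ Wt] e] := tP _ Vy.
  by apply: voronoi_rel Wt (Wy.2) _; exact/rp_quotP.
exists (cover_chart b), V, t; split=> //.
- by apply/atlas_coverP; exists b.
- by move=> q' Vq'; case: (tP q' Vq').
- by rewrite tW; exact: voronoi_open.
- by rewrite tW => y [].
Qed.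

Lemma set_inj_rp (c : chart RP (model RP)) : atlas RP c -> set_inj (cdom c) c.
Proof.
move=> [_ [V [t [/atlas_coverP[b ->] tK _ tc ->]]]] q q' /set_mem/= Vq /set_mem/= Vq' e.
rewrite -(tK q Vq) -(tK q' Vq'); congr (\pi_(RP) _).
by apply: (set_inj_cover_chart _ _ e); rewrite inE; apply: tc; [exists q|exists q'].
Qed.

Lemma rp_chart_open (c : chart RP (model RP)) : atlas RP c -> open (c @` cdom c).
Proof.
move=> [c' [V [t [Ac' tK oV tc ->]]]] /=; rewrite -(image_comp t c' V).
apply: (chart_image_open Ac') => //.
by have /atlas_coverP[b ->] := Ac'; exact: cover_chart_open.
Qed.

End ResiduesPolesCharts.

(** * Persistence of roots *)

Section RootPersistence.
Context {K : numFieldType}.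

(** A quantitative form of the fact that a point much closer to w0 than to the reference point u is
    near w0. It depends only on the ratio of two brackets, so the choice of homogeneous coordinates
    of x is immaterial. *)
Lemma chart_close (e : bool) (u : K * K) (w0 : K) (U : set K) : nbhs w0 U ->
  exists2 D : K, 0 < D & forall x : sphere K,
    D * `|br (pt x) (chart_pt e w0)| < `|br (pt x) u| ->
    cdom (sphere_chart e) x /\ U (sphere_chart e x).
Proof.
move=> /nbhs_ballP[r /= r0 rU].
pose A := `|chart_sel e u|; pose B := `|br (chart_pt e w0) u|.
have A0 : 0 <= A by exact: normr_ge0. have B0 : 0 <= B by exact: normr_ge0.
have Br0 : 0 <= B / r by rewrite divr_ge0// ltW.
(* Outside the chart the two brackets have norms 1 and A, which A < D excludes. Inside, for d = |w0
   - w|, the hypothesis gives D d < B + A d, hence (B / r) d < B and d < r. *)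
pose D := 1 + A + B / r.
have D0 : 0 < D by rewrite ltr_pwDl// ltr_pwDl.
exists D => // x h.
have cx : cdom (sphere_chart e) x.
  apply/cdom_sphere_chart/negP => /eqP sx.
  have [e1 e2] : `|br (pt x) (chart_pt e w0)| = 1 /\ `|br (pt x) u| = A.
    move: sx; rewrite /A; case: (e); case: x {h} => [z|] /=.
    - by move=> ->; rewrite /br/= !mul0r !subr0 !mul1r normr1.
    - by move/eqP; rewrite oppr_eq0 oner_eq0.
    - by move/eqP; rewrite oner_eq0.
    - by rewrite /br/= !mul0r !mulN1r !sub0r !opprK normr1.
  move: h; rewrite e1 e2 mulr1 => h.
  have : A < D by rewrite /D -addrA addrCA ltrDl ltr_pwDl.
  by move=> /(lt_trans h); rewrite ltxx.
split=> //; apply: rU; rewrite /= -ball_normE /=.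
have sx : 0 < `|chart_sel e (pt x)| by rewrite normr_gt0; apply/cdom_sphere_chart.
set w := sphere_chart e x; set d := `|w0 - w|.
have brw : br (chart_pt e w) u =
    br (chart_pt e w0) u + (chart_sign e * (w0 - w)) * chart_sel e u.
  by rewrite /br /chart_sign; case: (e) => /=; ring.
have sign1 : `|chart_sign e : K| = 1 by rewrite /chart_sign; case: (e); rewrite ?normrN normr1.
move: h; rewrite (sphere_chart_pt cx) !brZl !normrM mulrCA ltr_pM2l//.
rewrite br_chart_pt normrM sign1 mul1r -/d => h.
have {}h : D * d < B + d * A.
  apply: lt_le_trans h _; rewrite brw (le_trans (ler_normD _ _))// lerD2l.
  by rewrite !normrM sign1 mul1r.
have d0 : 0 <= d by exact: normr_ge0.
have {}h : d + B / r * d < B.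
  by move: h; rewrite /D !mulrDl mul1r addrAC addrC [d * A]mulrC addrC ltrD2r.
have Bp : 0 < B by apply: le_lt_trans h; rewrite addr_ge0// mulr_ge0.
have : B / r * d < B by apply: le_lt_trans h; rewrite lerDr.
by rewrite -mulrA gtr_pMr// mulrC ltr_pdivrMr// mul1r.
Qed.

(* Since the leading coefficient of P v may tend to 0, the value of P v at w0 is
   compared with its value at an auxiliary point z: their ratio is the product
   over the roots p_j of the ratios of the brackets of p_j with w0 and z. *)
Lemma near_root (V : normedModType K) n (P : V -> {poly K}) (v0 : V)
    (e : bool) (w0 : K) (U : set K) :
  pdif P v0 -> (size (P v0) <= n.+1)%N -> P v0 != 0 ->
  heval n (P v0) (chart_pt e w0) = 0 -> nbhs w0 U ->
  \forall v \near v0, forall k (p : {ffun 'I_n -> sphere K}),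
    P v = k *: root_poly p ->
    exists j, cdom (sphere_chart e) (p j) /\ U (sphere_chart e (p j)).
Proof.
move=> dP sP P0 Py nU.
(* A non-zero form of degree n cannot vanish at all the n + 1 points 0, ..., n. *)
have [z Pz] : exists z : K, heval n (P v0) (z, 1) != 0.
  apply: contrapT => nz; move/eqP: P0; apply.
  apply: (@heval_vanish _ n.+1 _ (fun i => Some (i%:R))) => // [i j [] /eqP|i].
    by rewrite eqr_nat => /eqP /val_inj.
  by apply/eqP/negPn/negP => Pz; apply: nz; exists i%:R.
have [D D0 close] := chart_close e (z, 1) nU.
have d1 : differentiable (fun v => heval n (P v) ((chart_pt e w0).1, (chart_pt e w0).2)) v0.
  by apply: dif_heval => //; exact: differentiable_cst.
have d2 : differentiable (fun v => heval n (P v) (z, 1)) v0.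
  by apply: dif_heval => //; exact: differentiable_cst.
have d1' : differentiable (fun v => D ^+ n *
    heval n (P v) ((chart_pt e w0).1, (chart_pt e w0).2)) v0.
  by apply: dif_mul => //; exact: differentiable_cst.
have := near_norm_lt d1' d2; rewrite /= -!surjective_pairing Py mulr0 normr0 normr_gt0.
move=> /(_ Pz); apply: filterS => v h k p Pv; move: h.
rewrite Pv !hevalZ !heval_root_poly !normrM normrX (gtr0_norm D0) mulrCA => h.
have k0 : 0 < `|k|.
  rewrite normr_gt0; apply: contraTneq h => ->.
  by rewrite normr0 !mul0r ltxx.
move: h; rewrite ltr_pM2l// !normr_prod => h.
(* If no p_i passes the test of [chart_close], the product of the n reverse inequalities contradicts
   h. *)
apply: contrapT => nj; suff : \prod_(i < n) `|br (pt (p i)) (z, 1)| <=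
    D ^+ n * \prod_(i < n) `|br (pt (p i)) (chart_pt e w0)|.
  by move=> /(lt_le_trans h); rewrite ltxx.
have -> : D ^+ n = \prod_(i < n) D by rewrite prodr_const card_ord.
rewrite -big_split; apply: ler_prod => i _ /=; rewrite normr_ge0/=.
rewrite real_leNgt ?rpredM ?normr_real ?gtr0_real//.
by apply/negP => /close cl; apply: nj; exists i.
Qed.

End RootPersistence.

(** * A differentiable choice of poles and residues *)

Section LocalSection.
Context {C : numClosedFieldType} {s : nat}.
Hypothesis s_ge2 : (2 <= s)%N.
Local Notation N := (s.-2.+1 + s.+1)%N.
Local Notation Cov := (rp_cover C s).
Local Notation RP := (Omega_rp C s).

Lemma voronoi_chart (b : 'I_s -> bool) (x y : Cov) : cdom (cover_chart b) y ->
  voronoi x y <-> forall i j, j != i ->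
    `|br (model_pt b (cover_chart b y) i) (pt (poles x i))| <
    `|br (model_pt b (cover_chart b y) i) (pt (poles x j))|.
Proof.
move=> cy; have sel i : 0 < `|chart_sel (b i) (pt (poles y i))|.
  by rewrite normr_gt0; apply/cdom_sphere_chart; move: i; exact/cdom_cover_chart.
have E i j : (`|br (pt (poles y i)) (pt (poles x i))| <
              `|br (pt (poles y i)) (pt (poles x j))|) =
    (`|br (model_pt b (cover_chart b y) i) (pt (poles x i))| <
     `|br (model_pt b (cover_chart b y) i) (pt (poles x j))|).
  by rewrite (pt_cover_chart i cy) !brZl !normrM ltr_pM2l.
by split=> h i j ji; have := h i j ji; rewrite E.
Qed.

Section Fiber.
Variables (V : normedModType C) (L : V -> 'rV[C]_N) (v0 : V).
Variables (b : 'I_s -> bool) (z0 : Cov) (k0 : C).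
Hypotheses (dL : differentiable L v0) (cz : cdom (cover_chart b) z0).
Hypotheses (k0_neq0 : k0 != 0) (z0L : cover_row z0 = k0 *: L v0).

Let m0 := cover_chart b z0.
Let P v := denom_row (L v).
Let Q v := numer_row (L v).

Let dP : pdif P v0. Proof. by apply: pdif_rVpoly; exact: dif_rsubmx. Qed.
Let dQ : pdif Q v0. Proof. by apply: pdif_rVpoly; exact: dif_lsubmx. Qed.

(* The point of the fiber over L v that lies near z0. *)
Let fiber v y := [/\ cdom (cover_chart b) y, voronoi z0 y &
  exists2 k, k != 0 & cover_row y = k *: L v].

Let fiber_uniq v y y' : fiber v y -> fiber v y' -> y = y'.
Proof.
move=> [_ h [k k1 e]] [_ h' [k' k'1 e']]; apply: (voronoi_rel h h').
apply: (cover_row_inj s_ge2 (k := k' / k)).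
by rewrite e' e scalerA divfK.
Qed.

Let fiber0 : fiber v0 z0.
Proof. by split=> //; [exact: voronoi_refl|exists k0]. Qed.

Let simple_v0 : simple_row (L v0).
Proof.
have -> : L v0 = k0^-1 *: cover_row z0 by rewrite z0L scalerK.
by apply: simple_rowZ => //; [rewrite invr_eq0|exact: simple_cover_row].
Qed.

Let P0 : P v0 = k0^-1 *: root_poly (poles z0).
Proof. by rewrite -denom_cover_row// z0L denom_rowZ scalerK. Qed.

(** By [near_root] each pole of z0 keeps a root p (j i) nearby, in its own Voronoi cell W i. The
    cells are disjoint, so j is injective, hence a permutation, and [cover_row_surj] lists the poles
    in this order. *)
Let fiber_near (U : 'I_s -> set C) : (forall i, nbhs (m0.2 0 i) (U i)) ->
  \forall v \near v0, exists2 y, fiber v y & forall i, U i ((cover_chart b y).2 0 i).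
Proof.
move=> nU; pose W i := [set w : C | forall j, j != i ->
  `|br (chart_pt (b i) w) (pt (poles z0 i))| <
  `|br (chart_pt (b i) w) (pt (poles z0 j))|].
have nW i : nbhs (m0.2 0 i) (W i).
  suff : \forall w \near (m0.2 0 i : C), forall j, j != i ->
    `|br (chart_pt (b i) w) (pt (poles z0 i))| <
    `|br (chart_pt (b i) w) (pt (poles z0 j))| by [].
  apply: near_forall => j; have [->|ji] := eqVneq j i; first by near=> w.
  have d k (w : C) : differentiable (fun w : C => br (chart_pt (b i) w) (pt (poles z0 k))) w.
    apply: dif_sub; apply: dif_mul; try exact: differentiable_cst.
      by apply: dif_chart_pt2.
    by apply: dif_chart_pt1.
  apply: filterS (near_norm_lt (d i _) (d j _) _) => [w wj _ //|].
  by have [_ /(voronoi_chart z0 cz)/(_ i j ji) h _] := fiber0.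
have Py i : heval s (P v0) (chart_pt (b i) (m0.2 0 i)) = 0.
  rewrite P0 hevalZ heval_root_poly (bigD1 i)//= (pt_cover_chart i cz) brZl.
  by rewrite brxx mulr0 mul0r mulr0.
have nR : \forall v \near v0, forall i k (p : {ffun 'I_s -> sphere C}),
    P v = k *: root_poly p -> exists j, cdom (sphere_chart (b i)) (p j) /\
      (U i `&` W i) (sphere_chart (b i) (p j)).
  apply: near_forall => i; apply: near_root (Py i) _ => //.
  - exact: size_denom_row.
  - by rewrite P0 scaler_eq0 invr_eq0 negb_or k0_neq0 monic_neq0 ?root_poly_monic.
  - exact: filterI.
apply: filterS2 nR (near_simple_row dL simple_v0) => v rv sv.
have [k [_ [p [_ [k1 _ _ Pv _]]]]] := (simple_rowP s_ge2 _).1 sv.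
have /choice[j jP] : forall i, exists j, cdom (sphere_chart (b i)) (p j) /\
    (U i `&` W i) (sphere_chart (b i) (p j)) by move=> i; exact: (rv i k p Pv).
have sel i : 0 < `|chart_sel (b i) (pt (p (j i)))|.
  by rewrite normr_gt0; apply/cdom_sphere_chart; case: (jP i).
have closer i i' : i' != i -> `|br (pt (p (j i))) (pt (poles z0 i))| <
                              `|br (pt (p (j i))) (pt (poles z0 i'))|.
  have [ci [_ Wi]] := jP i => /Wi.
  by rewrite (sphere_chart_pt ci) !brZl !normrM ltr_pM2l.
have ji : injective j.
  move=> i i' jj; apply/eqP/negPn/negP => ii.
  have h1 := closer i' i ii; have := closer i i'; rewrite eq_sym => /(_ ii).
  by rewrite jj => h2; have := lt_trans h1 h2; rewrite ltxx.
pose t := perm ji.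
have Pv' : denom_row (L v) = k *: root_poly (permute t p) by rewrite root_poly_permute.
have [y [yp ye]] := cover_row_surj s_ge2 sv k1 Pv'.
have yE i : poles y i = p (j i) by rewrite yp ffunE permE.
exists y; last by move=> i; rewrite cover_chart2 yE; case: (jP i) => _ [].
split.
- by apply/cdom_cover_chart => i; rewrite yE; case: (jP i).
- by move=> i i' ii; rewrite yE; exact: closer.
- by exists k^-1; rewrite ?invr_eq0.
Unshelve. all: by end_near. Qed.

(** The same factor k serves P and Q, so it can be computed from P and then used to obtain the
    residues from Q. *)
Let heval_fiber v y : fiber v y -> exists k, [/\ k != 0,
  forall z, k * heval s (P v) z = \prod_i br (model_pt b (cover_chart b y) i) z &
  forall i, k * heval s.-2 (Q v) (model_pt b (cover_chart b y) i) =
    resid y i * \prod_(j | j != i) br (model_pt b (cover_chart b y) j)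
                                      (model_pt b (cover_chart b y) i)].
Proof.
move=> [cy _ [k k1 e]]; have [k' k'0 e'] := cover_row_lift cy.
set m := cover_chart b y in e' *.
have lE : cover_lift b m = (k'^-1 * k) *: L v.
  by rewrite -scalerA -e e' scalerK.
exists (k'^-1 * k); split; first by rewrite mulf_neq0 ?invr_eq0.
  move=> z; rewrite -hevalZ -denom_rowZ -lE /cover_lift denom_rp_row.
  by rewrite -heval_prod_lin sum1_card card_ord.
move=> i; rewrite -hevalZ -numer_rowZ -lE /cover_lift numer_rp_row ?sum_model_resid//.
rewrite heval_pfrac ?sum_model_resid ?chart_pt_neq0//; congr (_ * _).
exact: cover_chart1.
Qed.

(** Only the continuity of the poles at v0 is available at the start. It suffices to write them near
    v0 as a function G2 differentiable at v0; the residues are then a quotient of expressions in L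
    and G2. *)
Lemma local_section : exists G : V -> model Cov,
  [/\ differentiable G v0, G v0 = m0 & \forall v \near v0,
    exists y, [/\ cdom (cover_chart b) y, cover_chart b y = G v &
      exists2 k, k != 0 & cover_row y = k *: L v]].
Proof.
have /choice[om omP] : forall v, exists y, forall y', fiber v y' -> y = y'.
  move=> v; have [[y fy]|nf] := pselect (exists y, fiber v y).
    by exists y => y'; exact: fiber_uniq fy.
  by exists z0 => y' fy'; case: nf; exists y'.
pose w v : 'rV[C]_s := (cover_chart b (om v)).2.
have w0E : w v0 = m0.2 by rewrite /w (omP _ _ fiber0).
(* [fiber_near] with arbitrary neighbourhoods U is exactly the continuity of the poles at v0. *)
have cw : {for v0, continuous w}.
  move=> A; rewrite /= w0E => -[U nU UA].
  have nU' i : nbhs (m0.2 0 i) (U 0 i) by exact: nU.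
  apply: filterS (fiber_near nU') => v [y fy Uy] /=; apply: UA => i j.
  by rewrite ord1 /w (omP _ _ fy).
have nf : \forall v \near v0, fiber v (om v).
  by apply: filterS (fiber_near (fun i => filterT)) => v [y fy _]; rewrite (omP _ _ fy).
have [z Pz] : exists z : C, heval s (P v0) (z, 1) != 0.
  apply: contrapT => nz; have /eqP : P v0 != 0.
    by rewrite P0 scaler_eq0 invr_eq0 negb_or k0_neq0 monic_neq0 ?root_poly_monic.
  apply; apply: (@heval_vanish _ s.+1 _ (fun i => Some (i%:R))) => [i j [] /eqP||i].
  - by rewrite eqr_nat => /eqP /val_inj.
  - exact: size_denom_row.
  by apply/eqP/negPn/negP => Pz; apply: nz; exists i%:R.
have dPz : differentiable (fun v => heval s (P v) (z, 1)) v0.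
  by apply: dif_heval => //; exact: differentiable_cst.
pose y0 i := chart_pt (b i) (m0.2 0 i).
have dPy i : differentiable (fun v => heval s (P v) (y0 i)) v0.
  apply: (dif_ext (f := fun v => heval s (P v) ((y0 i).1, (y0 i).2))).
    by move=> v; rewrite -surjective_pairing.
  by apply: dif_heval => //; exact: differentiable_cst.
pose c i (u : 'rV[C]_s) := chart_pt (b i) (u 0 i).
have dc1 i u : differentiable (fun u => (c i u).1) u.
  by apply: dif_chart_pt1; exact: differentiable_coord.
have dc2 i u : differentiable (fun u => (c i u).2) u.
  by apply: dif_chart_pt2; exact: differentiable_coord.
have brc0 i j : j != i -> br (c j m0.2) (y0 i) != 0.
  move=> ji; have : br (pt (poles z0 j)) (pt (poles z0 i)) != 0.
    by rewrite br_pt_eq0 (inj_eq (@poles_inj _ _ z0)).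
  rewrite (pt_cover_chart i cz) (pt_cover_chart j cz) brZl brZr.
  by rewrite !mulf_eq0 !negb_or => /and3P[].
(* Evaluating P v, a multiple of the product of the [lin (c j (w v))], at y0 i
  gives m0_i - w_i(v) = A i v * Psi i (w v), where A is known to be differentiable
  and w to be continuous. *)
pose Psi i (u : 'rV[C]_s) := chart_sign (b i) *
  ((\prod_j br (c j u) (z, 1)) / \prod_(j | j != i) br (c j u) (y0 i)).
have dPsi i : differentiable (Psi i) m0.2.
  apply: dif_mul; first exact: differentiable_cst.
  apply: dif_div; last by apply/prodf_neq0 => j; exact: brc0.
    by apply: dif_prod => j _; apply: dif_sub; apply: dif_mul => //; exact: differentiable_cst.
  by apply: dif_prod => j _; apply: dif_sub; apply: dif_mul => //; exact: differentiable_cst.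
pose A i v := heval s (P v) (y0 i) / heval s (P v) (z, 1).
have dA i : differentiable (A i) v0 by exact: dif_div.
have A0 i : A i v0 = 0.
  rewrite /A P0 hevalZ heval_root_poly (bigD1 i)//= (pt_cover_chart i cz) brZl.
  by rewrite brxx mulr0 mul0r mulr0 mul0r.
pose G2 v : 'rV[C]_s := \row_i (m0.2 0 i - A i v * Psi i (w v)).
have dG2 : differentiable G2 v0.
  apply: dif_mx => a i.
  apply: (dif_ext (f := fun v => m0.2 0 i - A i v * Psi i (w v))).
    by move=> v; rewrite [RHS]mxE.
  apply: dif_sub; first exact: differentiable_cst.
  apply: dif_mul_cont => //; apply: (continuous_comp cw).
  by rewrite w0E; exact: differentiable_continuous.
have G20 : G2 v0 = m0.2.
  by apply/rowP => i; rewrite [LHS]mxE A0 mul0r subr0.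
have nPz : \forall v \near v0, heval s (P v) (z, 1) != 0 by exact: near_neq0.
have nG2 : \forall v \near v0, G2 v = w v.
  have nc : \forall v \near v0, forall i j, j != i -> br (c j (w v)) (y0 i) != 0.
    apply: near_forall => i; apply: near_forall => j.
    have [->|ji] := eqVneq j i; first by near=> v.
    have d : differentiable (fun u => br (c j u) (y0 i)) m0.2.
      by apply: dif_sub; apply: dif_mul => //; exact: differentiable_cst.
    have := near_neq0 d (brc0 i j ji); rewrite -w0E => nb.
    have : \forall v \near v0, br (c j (w v)) (y0 i) != 0 by exact: (cw _ nb).
    by apply: filterS => v bv _.
  apply: filterS3 nf nPz nc => v fv Pvz cv; apply/rowP => i; rewrite [LHS]mxE.
  have [k [k1 e _]] := heval_fiber fv.
  have Prod0 : \prod_j br (c j (w v)) (z, 1) != 0 by rewrite -e mulf_neq0.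
  have Prest : \prod_(j | j != i) br (c j (w v)) (y0 i) != 0.
    by apply/prodf_neq0 => j; exact: cv.
  have e1 := e (y0 i); rewrite (bigD1 i)//= br_chart_pt in e1.
  rewrite -/(w v) in e1.
  have -> : A i v = chart_sign (b i) * (m0.2 0 i - w v 0 i) *
      \prod_(j | j != i) br (c j (w v)) (y0 i) / \prod_j br (c j (w v)) (z, 1).
    by rewrite -e -e1 /A; field; rewrite k1 Pvz.
  have sq : chart_sign (b i) * chart_sign (b i) = 1 :> C.
    by rewrite /chart_sign; case: (b i); rewrite ?mulrNN mulr1.
  rewrite /Psi; set X := \prod_(j | j != i) _ in Prest *; set Y := \prod_j _ in Prod0 *.
  transitivity (m0.2 0 i - (chart_sign (b i) * chart_sign (b i)) * (m0.2 0 i - w v 0 i)).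
    by field; rewrite Prest Prod0.
  by rewrite sq mul1r subKr.
(* The factor k of [heval_fiber], recovered at the auxiliary point z, where P v does not vanish. *)
pose kap v := (\prod_j br (c j (G2 v)) (z, 1)) / heval s (P v) (z, 1).
pose rho i v := kap v * heval s.-2 (Q v) (c i (G2 v)) /
  \prod_(j | j != i) br (c j (G2 v)) (c i (G2 v)).
pose G1 v : 'rV[C]_s.-1 := \row_k rho (widen_ord (leq_pred s) k) v.
have dG2c1 i : differentiable (fun v => (c i (G2 v)).1) v0.
  by apply: dif_chart_pt1; exact: dif_entry.
have dG2c2 i : differentiable (fun v => (c i (G2 v)).2) v0.
  by apply: dif_chart_pt2; exact: dif_entry.
have drho i : differentiable (rho i) v0.
  apply: dif_div; last 1 first.
  - by apply/prodf_neq0 => j ji; rewrite G20; exact: brc0.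
  - apply: dif_mul.
      apply: dif_div => //; apply: dif_prod => j _; apply: dif_sub; apply: dif_mul => //;
        exact: differentiable_cst.
    apply: (dif_ext (f := fun v => heval s.-2 (Q v) ((c i (G2 v)).1, (c i (G2 v)).2))).
      by move=> v; rewrite -surjective_pairing.
    exact: dif_heval.
  - by apply: dif_prod => j _; apply: dif_sub; exact: dif_mul.
have dG1 : differentiable G1 v0.
  apply: dif_mx => a i; apply: (dif_ext (f := rho (widen_ord (leq_pred s) i))) => //.
  by move=> v; rewrite [RHS]mxE.
have nG : \forall v \near v0, fiber v (om v) /\ cover_chart b (om v) = (G1 v, G2 v).
  apply: filterS3 nf nPz nG2 => v fv Pvz G2v; split=> //.
  rewrite [LHS]surjective_pairing G2v; congr (_, _).
  apply/rowP => i; rewrite [RHS]mxE cover_chart1_widen; set l := widen_ord _ _.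
  have [k [k1 e e']] := heval_fiber fv.
  have kE : kap v = k.
    by rewrite /kap G2v; apply: (mulIf Pvz); rewrite divfK// e.
  rewrite /rho kE G2v e' mulfK//; apply/prodf_neq0 => j jl.
  have [cy _ _] := fv; have : br (pt (poles (om v) j)) (pt (poles (om v) l)) != 0.
    by rewrite br_pt_eq0 (inj_eq (@poles_inj _ _ _)).
  rewrite (pt_cover_chart j cy) (pt_cover_chart l cy) brZl brZr.
  by rewrite !mulf_eq0 !negb_or => /and3P[].
exists (fun v => (G1 v, G2 v)); split.
- exact: differentiable_pair.
- have [_ <-] := nbhs_singleton nG; rewrite (omP _ _ fiber0)//.
- by apply: filterS nG => v [[cy _ yL] <-]; exists (om v).
Unshelve. all: by end_near. Qed.

End Fiber.
End LocalSection.

(** * From residues and poles to coefficients and back *)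

Section ResiduesPolesBiholomorphism.
Context {C : numClosedFieldType} {s : nat}.
Hypothesis s_ge2 : (2 <= s)%N.
Local Notation Cov := (rp_cover C s).
Local Notation RP := (Omega_rp C s).

Lemma biholomorphic_rp_coef : biholomorphic RP (Omega_coef C s).
Proof.
have /choice[f fE] : forall q : RP, exists x : Omega_coef C s,
    exists2 k, k != 0 & coef_row x = k *: cover_row (repr q).
  by move=> q; apply: (coef_point s_ge2); exact: simple_cover_row.
have row_pi (y : Cov) : cover_row (repr (\pi_(RP) y)) = cover_row y.
  by apply: (cover_row_rel (y := y)); apply/rp_quotP; rewrite reprK.
have fi : injective f.
  move=> q q' ff; have [k k0 e] := fE q; have [k' k'0 e'] := fE q'.
  rewrite ff e' in e; rewrite -[q]reprK -[q']reprK; apply/rp_quotP.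
  apply: (cover_row_inj s_ge2 (k := k'^-1 * k)).
  by rewrite -scalerA -e scalerA mulVf// scale1r.
have f_pi (y : Cov) x k : k != 0 -> cover_row y = k *: coef_row x -> f (\pi_(RP) y) = x.
  move=> k0 e; have [k' k'0 e'] := fE (\pi_(RP) y).
  apply/esym; apply: (coef_row_inj (k := k' * k)); first by rewrite mulf_neq0.
  by rewrite e' row_pi e scalerA.
apply: (biholomorphic_bij (f := f)) => //.
- exact: holomorphic_from_rp.
- move=> x; have sx := simple_coef_row x.
  have [k [_ [p [_ [k0 _ _ dx _]]]]] := (simple_rowP s_ge2 _).1 sx.
  have [y [_ yx]] := cover_row_surj s_ge2 sx k0 dx.
  by exists (\pi_(RP) y); apply: f_pi yx; rewrite invr_eq0.
move=> g gK _ _ x /atlas_coefP[h ->] [_ [W [t [/atlas_coverP[b ->] tK oW tW ->]]]] cx.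
move=> /= Wg; pose v0 := coef_chart h x; pose z0 := t (g x).
have cz : cdom (cover_chart b) z0 by apply: tW; exists (g x).
have [k k0 e] := fE (g x); rewrite gK in e.
have row_z0 : cover_row z0 = cover_row (repr (g x)).
  by rewrite -(row_pi z0) /z0 tK.
have xh0 : coef_row x 0 h != 0 by [].
have z0L : cover_row z0 = (k^-1 * coef_row x 0 h) *: affine_lift h v0.
  by rewrite -scalerA -coef_chartE// e row_z0 scalerK.
have kx0 : k^-1 * coef_row x 0 h != 0 by rewrite mulf_neq0 ?invr_eq0.
have [G [dG G0 nG]] := local_section s_ge2 (@dif_affine_lift _ _ h v0) cz kx0 z0L.
exists G => //.
have Ab : atlas Cov (cover_chart b) by apply/atlas_coverP; exists b.
(* The section t of the chart is arbitrary, but its image is open. Hence the points of the cover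
   with coordinates G v lie in it for v near v0, and are values of t. *)
move: oW; rewrite charted_openE => /(_ _ _ Ab cz (ex_intro2 _ _ (g x) Wg erefl)) nW.
have {}nW : \forall v \near v0, forall y, cdom (cover_chart b) y ->
    cover_chart b y = G v -> (t @` W) y.
  by have /differentiable_continuous cG := dG; rewrite -G0 in nW; exact: (cG _ nW).
apply: filterS2 nG nW => v [y [cy yv [l l0 yL]]] Wv x' cx' x'v.
have [q Wq tq] := Wv y cy yv.
have fq : f q = x'.
  have x'E : coef_row x' = coef_row x' 0 h *: affine_lift h v.
    by rewrite -x'v; exact: coef_chartE.
  have x'0 : coef_row x' 0 h != 0 by [].
  rewrite -(tK q Wq) tq; apply: (f_pi _ _ (l / coef_row x' 0 h)).
    by rewrite mulf_neq0 ?invr_eq0.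
  by rewrite [X in _ = _ *: X]x'E scalerA divfK.
have -> : g x' = q by apply: fi; rewrite gK fq.
by split=> //=; rewrite tq.
Qed.

End ResiduesPolesBiholomorphism.

(** * Countable bases *)

Section SecondCountability.

(* The radii of the basic balls are the |d t|: K is not assumed Archimedean. *)
Lemma second_countable_rV (K : numFieldType) (T : countType) (d : T -> K) n :
  (forall x e, 0 < e -> exists t, `|x - d t| < e) -> @second_countable 'rV[K]_n.
Proof.
move=> dense; pose c (f : {ffun 'I_n -> T}) : 'rV[K]_n := \row_i d (f i).
exists [set U | exists f t, d t != 0 /\ U = ball (c f) `|d t|].
  apply: (@sub_countable _ _ _ ((fun ft : {ffun 'I_n -> T} * T => ball (c ft.1) `|d ft.2|) @` setT)).
    by apply: subset_card_le => U [f [t [_ ->]]]; exists (f, t).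
  by apply: sub_countable (card_image_le _ _) _; exact: countableP.
split=> [U [f [t [t0 ->]]]|x U /nbhs_ballP[e /= e0 xU]].
  by apply: ball_open; rewrite normr_gt0.
have e4 : 0 < e / 4 by rewrite divr_gt0.
have e8 : 0 < e / 8 by rewrite divr_gt0.
(* Being within e / 8 of e / 4, the number d t satisfies e / 8 < |d t| < e / 2: it is non-zero, and
   a ball of radius |d t| that contains x lies in the ball of radius e around x. *)
have [t te] := dense (e / 4) _ e8.
have e88 : e / 4 = e / 8 + e / 8 by field.
have t0 : e / 8 < `|d t|.
  have := lerB_dist (e / 4) (d t); rewrite gtr0_norm// => h.
  have := le_lt_trans h te; rewrite e88 ltrBlDr => h'.
  by rewrite -(ltrD2l (e / 8)).
have t1 : `|d t| < e / 2.
  have := lerB_dist (d t) (e / 4); rewrite [`|e / 4|]gtr0_norm// distrC => h.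
  have := le_lt_trans h te; rewrite ltrBlDl => /lt_trans; apply.
  by rewrite (_ : e / 2 = e / 4 + e / 4) ?ltrD2l; [rewrite e88 ltrDl|field].
have dt0 : 0 < `|d t| by exact: lt_trans t0.
have /choice[f fP] : forall i, exists t', `|x 0 i - d t'| < `|d t|.
  by move=> i; exact: dense.
have cx : ball (c (finfun f)) `|d t| x.
  split=> // i j; rewrite /c mxE ffunE ord1 -ball_normE /= distrC; exact: fP.
exists (ball (c (finfun f)) `|d t|) => /=.
  split=> //; exists (finfun f), t; split=> //.
  by rewrite -normr_gt0.
move=> y cy; apply: xU; apply: (@le_ball _ _ _ (`|d t| + `|d t|)).
  by rewrite [leRHS]splitr lerD// ltW.
by apply: ball_triangle cy; exact: ball_sym.
Qed.

Lemma complex_rat_dense (R : realType) (x e : R[i]) : 0 < e ->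
  exists t : rat * rat, `|x - (ratr t.1 +i* ratr t.2)%C| < e.
Proof.
(* In the order of R[i], 0 < e forces e to be real. *)
case: x => a b; case: e => r j; rewrite ltcE /= => /andP[/eqP -> r0].
have near_rat (c : R) : exists q : rat, `|c - ratr q| < r / 2.
  have r2 : 0 < r / 2 by rewrite divr_gt0.
  have /rat_in_itvoo[q] : c - r / 2 < c + r / 2.
    by rewrite ltrD2l (lt_trans _ r2)// oppr_lt0.
  rewrite in_itv /= => /andP[h1 h2]; exists q.
  by rewrite distrC ltr_distl h1 h2.
have [p ap] := near_rat a; have [q bq] := near_rat b; exists (p, q) => /=.
have -> : (a +i* b)%C - (ratr p +i* ratr q)%C =
    (a - ratr p)%:C%C + 'i%C * (b - ratr q)%:C%C.
  by apply/eqP; rewrite eq_complex /=; apply/andP; split; apply/eqP; ring.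
have normR (c : R) : `|c%:C%C| = `|c|%:C%C.
  by rewrite normc_def /= expr0n addr0 sqrtr_sqr.
rewrite (le_lt_trans (ler_normD _ _))// normrM normR normR.
have -> : `|'i%C : R[i]| = 1 by rewrite normc_def /= expr0n add0r expr1n sqrtr1.
rewrite mul1r ltcE /= addr0 eqxx /= [ltRHS]splitr ltrD//.
Qed.

End SecondCountability.

Theorem theorem2p1 (R : realType) (s : nat) (s_ge2 : (2 <= s)%N) :
  [/\ complex_manifold (Omega_coef R[i] s),
      complex_manifold (Omega_zp R[i] s),
      complex_manifold (Omega_rp R[i] s) &
      [/\ biholomorphic (Omega_coef R[i] s) (Omega_zp R[i] s),
          biholomorphic (Omega_coef R[i] s) (Omega_rp R[i] s) &
          biholomorphic (Omega_zp R[i] s) (Omega_rp R[i] s)]].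
Proof.
have coef_mf : complex_manifold (Omega_coef R[i] s).
  apply: (@complex_manifold_coef R[i] s s_ge2).
  exact: second_countable_rV (@complex_rat_dense R).
have coef_zp := biholomorphic_sym (@biholomorphic_zp_coef R[i] s s_ge2).
have coef_rp := biholomorphic_sym (@biholomorphic_rp_coef R[i] s s_ge2).
have cov_coef := @covered_coef R[i] s.
have cov_zp := @covered_zp R[i] s.
have cov_rp := @covered_rp R[i] s.
split=> //.
- apply: (complex_manifold_biholomorphic coef_mf coef_zp cov_zp) => c /atlas_zpP[a [i [j ->]]].
    exact: (@set_inj_zp_chart R[i] s s_ge2).
  exact: (@zp_chart_open R[i] s s_ge2).
- apply: (complex_manifold_biholomorphic coef_mf coef_rp cov_rp).
    exact: (@set_inj_rp R[i] s).
  exact: (@rp_chart_open R[i] s).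
- split=> //; apply: biholomorphic_trans cov_zp cov_coef cov_rp _ coef_rp.
  exact: biholomorphic_sym coef_zp.
Qed.
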